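(* Let $g=(g_{ij})$ be a smooth symmetric (possibly degenerate) bilinear form on a domain $U\subset\mathbb{R}^n$ such that flat coordinates for $g$ exist (near every point), and let $\omega=(\omega_{ij})$ be a smooth symplectic form on $U$. Let $P^{ij}$ be the inverse matrix of $\omega_{ij}$, i.e. $\sum_sP^{is}\omega_{sj}=\delta^i_j$, and let $\nabla=(\Gamma^i_{jk})$ be any smooth torsion-free connection compatible with $g$, i.e. $\Gamma^i_{jk}=\Gamma^i_{kj}$ and $$\sum_s\left(\Gamma^s_{jk}g_{is}+\Gamma^s_{ik}g_{js}\right)=\frac{\partial g_{ij}}{\partial x^k}\quad\text{for all } i,j,k.$$ Then there exists (near every point of $U$) a local coordinate system in which the components of both $g$ and $\omega$ are constant if and only if $$\sum_{a,b,c,d}g_{ia}P^{ab}P^{cd}g_{dj}\,\nabla_k\omega_{bc}=0\quad\text{for all } i,j,k.$$ This last condition does not depend on the choice of the connection $\nabla$ compatible with $g$.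
   Context: All indices run from $1$ to $n$. A local coordinate system is flat for a tensor field if the components of that tensor field in it are constant. A symplectic form is a closed nondegenerate differential 2-form. The covariant derivative is $\nabla_k\omega_{bc}=\frac{\partial\omega_{bc}}{\partial x^k}-\sum_s\left(\Gamma^s_{kb}\omega_{sc}+\Gamma^s_{kc}\omega_{bs}\right)$. *)

(* Defs.v *)
From HB Require Import structures.
From mathcomp Require Import all_boot all_order all_algebra.
From mathcomp Require Import all_classical all_reals all_analysis.
Set Implicit Arguments.
Unset Strict Implicit.
Unset Printing Implicit Defensive.
Import Order.TTheory GRing.Theory Num.Theory.
Import numFieldNormedType.Exports.
Local Open Scope classical_set_scope.
Local Open Scope ring_scope.

Section LocalTensors.
Variables (R : realType) (n : nat).
Local Notation E := 'rV[R]_n.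
Implicit Types (U V W : set E) (f : E -> R) (T g omega : E -> 'M[R]_n).

Definition domain U : Prop := [/\ open U, connected U & U !=set0].

Definition pderiv (k : 'I_n) f : E -> R := fun x => 'D_(delta_mx 0 k) f x.

Definition iter_pderiv (s : seq 'I_n) f : E -> R := foldr pderiv f s.

(* C^infinity on the open set U: partial derivatives of every order exist and
   are continuous at every point of U.  Values outside U are irrelevant. *)
Definition smooth_on U f : Prop :=
  forall (s : seq 'I_n) (x : E), U x ->
    {for x, continuous (iter_pderiv s f)} /\
    forall k : 'I_n, derivable (iter_pderiv s f) x (delta_mx 0 k).

Definition smooth_map_on U (F : E -> E) : Prop :=
  forall i : 'I_n, smooth_on U (fun x => F x 0 i).

Definition smooth_tensor_on U T : Prop :=
  forall i j : 'I_n, smooth_on U (fun x => T x i j).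

(* phi gives the new coordinates y on V, psi = phi^-1 expresses x through y on
   the open set W = phi(V). *)
Definition local_coordinates V W (phi psi : E -> E) : Prop :=
  [/\ open V, open W,
      forall x, V x -> W (phi x) /\ psi (phi x) = x,
      forall y, W y -> V (psi y) /\ phi (psi y) = y &
      smooth_map_on V phi /\ smooth_map_on W psi].

(* sum_{i,j} dx^i/dy^a dx^j/dy^b T_ij(x(y)), where x = psi(y) *)
Definition components T (psi : E -> E) (y : E) (a b : 'I_n) : R :=
  \sum_(i < n) \sum_(j < n)
    pderiv a (fun z => psi z 0 i) y * pderiv b (fun z => psi z 0 j) y
    * T (psi y) i j.

Definition flat_for T W (psi : E -> E) : Prop :=
  exists C : 'M[R]_n, forall y, W y -> forall a b, components T psi y a b = C a b.

Definition locally_flat U T : Prop :=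
  forall p, U p -> exists V W phi psi,
    [/\ V p, V `<=` U, local_coordinates V W phi psi & flat_for T W psi].

Definition locally_simultaneously_flat U T1 T2 : Prop :=
  forall p, U p -> exists V W phi psi,
    [/\ V p, V `<=` U, local_coordinates V W phi psi,
        flat_for T1 W psi & flat_for T2 W psi].

Definition symmetric_on U g : Prop :=
  forall x, U x -> forall i j, g x i j = g x j i.

(* omega = sum_{i<j} omega_ij dx^i /\ dx^j; the third clause is d omega = 0 *)
Definition symplectic_on U omega : Prop :=
  [/\ smooth_tensor_on U omega,
      forall x, U x -> forall i j, omega x i j = - omega x j i,
      forall x, U x -> forall i j k,
        pderiv i (fun z => omega z j k) x + pderiv j (fun z => omega z k i) x
        + pderiv k (fun z => omega z i j) x = 0 &
      forall x, U x -> omega x \in unitmx].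

(* Gamma x i j k stands for Gamma^i_{jk}(x) *)
Definition compatible_connection U g (Gamma : E -> 'I_n -> 'I_n -> 'I_n -> R)
    : Prop :=
  [/\ forall i j k, smooth_on U (fun x => Gamma x i j k),
      forall x, U x -> forall i j k, Gamma x i j k = Gamma x i k j &
      forall x, U x -> forall i j k,
        \sum_(s < n) (Gamma x s j k * g x i s + Gamma x s i k * g x j s)
        = pderiv k (fun z => g z i j) x].

(* nabla_k omega_bc *)
Definition nabla (Gamma : E -> 'I_n -> 'I_n -> 'I_n -> R) omega
    (x : E) (k b c : 'I_n) : R :=
  pderiv k (fun z => omega z b c) x
  - \sum_(s < n) (Gamma x s k b * omega x s c + Gamma x s k c * omega x b s).

Definition compatibility_condition g omega
    (Gamma : E -> 'I_n -> 'I_n -> 'I_n -> R) (x : E) : Prop :=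
  let P := invmx (omega x) in
  forall i j k : 'I_n,
    \sum_(a < n) \sum_(b < n) \sum_(c < n) \sum_(d < n)
      g x i a * P a b * P c d * g x d j * nabla Gamma omega x k b c = 0.

End LocalTensors.

(* Main.v *)
(** Choose coordinates [y] in which [g] is a constant matrix [C] and let
    [Q_ab = {y_a, y_b}] be the matrix of Poisson brackets.  Compatibility and
    vanishing torsion force [C Gamma_k = 0] in these coordinates, so that the
    condition becomes [C (d_k Q) C = 0].  It no longer involves the connection,
    it holds when [omega] is constant as well, and it says that those linear
    combinations of the [y_a] on which [g] depends have constant brackets.
    By the argument of Caratheodory, Jacobi and Lie these functions extend, one
    function at a time, to a coordinate system with constant brackets: the
    Hamiltonian fields of the functions found so far commute, hence can be
    straightened simultaneously.

    Flows are treated on the time interval [[0, 1]] only, through the forward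
    estimate [|y(t) - y(s) - (t - s) w(s)| <= C (t - s)^2], which passes to limits
    and for which Gronwall's inequality is elementary.  The same theorem on the
    equation [x' = u Z(x)] yields the inverse function theorem. *)
Require Import Defs.
From HB Require Import structures.
From mathcomp Require Import all_boot all_order all_algebra.
From mathcomp Require Import all_classical all_reals all_analysis.
From mathcomp Require Import ring lra.
Set Implicit Arguments.
Unset Strict Implicit.
Unset Printing Implicit Defensive.
Import Order.TTheory GRing.Theory Num.Theory.
Import numFieldNormedType.Exports.
Local Open Scope classical_set_scope.
Local Open Scope ring_scope.

(** * Differentiability of C^1 functions *)

(** That [C Gamma_k] vanishes is the uniqueness argument for the Levi-Civita connection: the
    discrepancy between the connection and the second derivatives of the flat coordinates,
    contracted with [g], is antisymmetric in one pair of indices and symmetric in an overlapping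
    pair. For degenerate [g] only contractions with [g] are controlled in this way, which is why the
    condition carries [g] on both sides.

    Degeneracy also shapes the construction. If r is the rank of [C], a linear change of the [y_a]
    moves everything that [g] depends on into the first r functions; the others do not enter [g] and
    may be replaced as long as the functions stay independent. No normal form of the brackets is
    sought, since constancy is all that is wanted. A new function only needs constant derivatives
    along the fields already straightened, and an affine function of the straightening coordinates
    has them; prescribing its differential at the point keeps independence. For [g = 0] the argument
    contains Darboux's theorem. *)

Section RowVectors.
Variables (R : realType) (n : nat).
Implicit Types (v w : 'rV[R]_n).

Lemma coord_le_norm v i : `|v 0 i| <= `|v|.
Proof.
rewrite [leRHS]/Num.Def.normr/= mx_normrE.
exact: (le_bigmax _ (fun ij : 'I_1 * 'I_n => `|v ij.1 ij.2|) (0, i)).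
Qed.

Lemma norm_leP v (c : R) : 0 <= c -> (`|v| <= c) <-> (forall i, `|v 0 i| <= c).
Proof.
move=> c0; split=> [vc i|h]; first exact: le_trans (coord_le_norm v i) vc.
rewrite /Num.Def.normr/= mx_normrE (bigmax_le _ c0)//= => -[i j] _ /=.
by rewrite ord1.
Qed.

Lemma row_sum_coord v : v = \sum_k v 0 k *: delta_mx 0 k.
Proof.
rewrite {1}(matrix_sum_delta v) (big_ord1 _ _).
by apply: eq_bigr => k _.
Qed.

End RowVectors.

Section MeanValue.
Variables (R : realType) (V : normedModType R).

Lemma is_derive_line (f : V -> R) (z v : V) (t : R) :
  derivable f (z + t *: v) v ->
  is_derive t 1 (fun t => f (z + t *: v)) ('D_v f (z + t *: v)).
Proof.
move=> df.
have E : (fun h : R => h^-1 *: (((fun t : R => f (z + t *: v)) \o shift t) (h *: 1) -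
     f (z + t *: v))) =
  (fun h => h^-1 *: ((f \o shift (z + t *: v)) (h *: v) - f (z + t *: v))).
  by apply/funext => h /=; rewrite [h *: 1]mulr1 scalerDl addrCA.
split; first by rewrite /derivable E.
by rewrite /derive E.
Qed.

(** Either sign of [d] is allowed, so the intermediate [t] is located only by [|t| <= |d|]; this is
    the form that balls and boxes around a centre call for. *)
Lemma mean_value_line (f : V -> R) (z v : V) (d : R) :
  (forall t : R, `|t| <= `|d| -> derivable f (z + t *: v) v) ->
  exists2 t, `|t| <= `|d| & f (z + d *: v) - f z = d * 'D_v f (z + t *: v).
Proof.
move=> df; pose g := fun t : R => f (z + t *: v).
have gd (t : R) : `|t| <= `|d| -> is_derive t 1 g ('D_v f (z + t *: v)).
  by move=> /df ?; apply: is_derive_line.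
have gc (a b : R) : (forall t : R, t \in `[a, b] -> `|t| <= `|d|) ->
    {within `[a, b], continuous g}.
  move=> ab; apply: derivable_within_continuous => t /ab /gd [] //.
have [d0|d0] := leP 0 d.
  have sub (t : R) : t \in `[0, d] -> `|t| <= `|d|.
    by rewrite in_itv/= => /andP[t0 td]; rewrite !ger0_norm.
  have sub' (t : R) : t \in `]0, d[ -> is_derive t 1 g ('D_v f (z + t *: v)).
    by move=> /subset_itv_oo_cc /sub /gd.
  have [c cd E] := MVT_segment d0 sub' (gc _ _ sub).
  exists c; first exact: sub.
  by move: E; rewrite /g scale0r addr0 subr0 mulrC.
have sub (t : R) : t \in `[d, 0] -> `|t| <= `|d|.
  by rewrite in_itv/= => /andP[t0 td]; rewrite !ler0_norm ?lerN2// ltW.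
have sub' (t : R) : t \in `]d, 0[ -> is_derive t 1 g ('D_v f (z + t *: v)).
  by move=> /subset_itv_oo_cc /sub /gd.
have [c cd E] := MVT_segment (ltW d0) sub' (gc _ _ sub).
exists c; first exact: sub.
move: E; rewrite /g scale0r addr0 sub0r mulrN => /eqP.
by rewrite -eqr_oppLR opprB => /eqP ->; rewrite mulrC.
Qed.

End MeanValue.

Section Differentiability.
Variables (R : realType) (n : nat).
Local Notation E := 'rV[R]_n.
Local Notation ev k := (delta_mx 0 k : E).
Implicit Types (f : E -> R) (x y : E).

(** The candidate differential, written as a matrix product so that linearity is immediate; it is
    registered as a linear map for [diff_unique]. *)
Let lin f x (v : E) : R := (v *m \col_k pderiv k f x) 0 0.

Let lin_is_linear f x : linear (lin f x).
Proof. by move=> a u v; rewrite /lin mulmxDl -scalemxAl !mxE. Qed.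

HB.instance Definition _ f x :=
  GRing.isLinear.Build R E R _ (lin f x) (lin_is_linear f x).

Let linE f x v : lin f x v = \sum_k v 0 k * pderiv k f x.
Proof. by rewrite /lin mxE; apply: eq_bigr => k _; rewrite mxE. Qed.

Lemma sum_coord_continuous (a : 'I_n -> R) :
  continuous (fun v : E => \sum_k v 0 k * a k).
Proof.
apply: continuous_big => [|k _ v]; first exact: add_continuous.
apply: (@continuousM R _ (fun x => x 0 k) (fun=> a k)).
  exact: coord_continuous.
exact: cst_continuous.
Qed.

(** Passes from [x] to [y] one coordinate at a time: consecutive points differ in a single
    coordinate, so an increment of [f] telescopes into one-variable increments. *)
Let mix (m : nat) x y : E := \row_i (if (i < m)%N then y 0 i else x 0 i).

Let mixS (m : 'I_n) x y : mix m.+1 x y = mix m x y + (y 0 m - x 0 m) *: ev m.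
Proof.
apply/rowP => i; rewrite !mxE eqxx/= ltnS leq_eqVlt -val_eqE/=.
have [E|ne] := eqVneq (i : nat) m.
  have -> : i = m by exact: val_inj.
  by rewrite ltnn/= mulr1 addrC subrK.
by rewrite /= mulr0 addr0.
Qed.

Lemma partial_estimate f x (d e : R) : 0 <= e ->
  (forall z, `|z - x| <= d -> forall k, derivable f z (ev k)) ->
  (forall z, `|z - x| <= d -> forall k, `|pderiv k f z - pderiv k f x| <= e) ->
  forall y, `|y - x| <= d ->
  `|f y - f x - \sum_k (y - x) 0 k * pderiv k f x| <= n%:R * e * `|y - x|.
Proof.
move=> e0 df dc y yd.
have d0 : 0 <= d by apply: le_trans yd.
have -> : f y - f x = \sum_(m < n) (f (mix m.+1 x y) - f (mix m x y)).
  have -> : \sum_(m < n) (f (mix m.+1 x y) - f (mix m x y)) =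
            \sum_(0 <= m < n) (f (mix m.+1 x y) - f (mix m x y)).
    by rewrite big_mkord.
  rewrite telescope_sumr//; congr (f _ - f _); apply/rowP => i; rewrite mxE//.
  by rewrite ltn_ord.
rewrite -sumrB (le_trans (ler_norm_sum _ _ _))//.
have -> : n%:R * e * `|y - x| = \sum_(m < n) e * `|y - x|.
  by rewrite sumr_const card_ord -mulrA mulr_natl.
apply: ler_sum => m _; rewrite mixS.
have ym : `|y 0 m - x 0 m| <= `|y - x|.
  by have := coord_le_norm (y - x) m; rewrite !mxE.
have near t : `|t| <= `|y 0 m - x 0 m| ->
    `|mix m x y + t *: ev m - x| <= d.
  move=> tm; apply/norm_leP => // i; rewrite !mxE eqxx/=.
  have [E|ne] := eqVneq i m.
    rewrite E ltnn mulr1 (addrC (x 0 m)) addrK.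
    by rewrite (le_trans tm)// (le_trans ym).
  rewrite mulr0 addr0; case: ifP => _; last by rewrite subrr normr0.
  rewrite (le_trans _ yd)//.
  by have := coord_le_norm (y - x) i; rewrite !mxE.
have [t tm ->] := mean_value_line (fun t tm => df _ (near t tm) m).
rewrite !mxE -mulrBr normrM mulrC ler_pM//.
exact: dc (near t tm) m.
Qed.

Lemma C1_differentiable f x :
  (\forall y \near x, forall k, derivable f y (ev k)) ->
  (forall k, {for x, continuous (pderiv k f)}) -> differentiable f x.
Proof.
move=> df cf.
have lc : continuous (lin f x).
  have -> : lin f x = (fun v => \sum_k v 0 k * pderiv k f x).
    by apply/funext => v; rewrite linE.
  exact: sum_coord_continuous.
have key : f \o shift x = cst (f x) + lin f x +o_ (0 : E) id.
  apply/eqaddoP => _/posnumP[e].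
  (* Dividing by n + 1 absorbs the factor n of [partial_estimate] and stays meaningful for n = 0. *)
  pose e' := e%:num / n.+1%:R.
  have e'0 : 0 < e' by rewrite divr_gt0.
  have cf' : \forall y \near x, forall k, `|pderiv k f x - pderiv k f y| <= e'.
    apply: (@filter_forall _ _ (fun k y => `|pderiv k f x - pderiv k f y| <= e') (nbhs x)) => k.
    move: (cf k) => /cvgrPdist_le; exact.
  have [d /= d0 hd] := (nbhs_ballP _ _).1 (filterI df cf').
  rewrite -ball_normE in hd.
  near=> h.
  have hh : `|h| <= d / 2.
    near: h; rewrite !near_simpl; apply: nbhs0_le; exact: divr_gt0.
  have sub z : `|z - x| <= d / 2 -> `|x - z| < d.
    by rewrite distrC => /le_lt_trans; apply; rewrite ltr_pdivrMr// ltr_pMr// ltr1n.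
  have hx : `|h + x - x| <= d / 2 by rewrite addrK.
  have := @partial_estimate f x (d / 2) e' (ltW e'0) _ _ _ hx.
  rewrite addrK /= -linE => est.
  rewrite (_ : (f \o _ - _) h = f (h + x) - f x - lin f x h); last first.
    by rewrite /= !fctE opprD addrA.
  apply: le_trans (est _ _) _.
  - by move=> z /sub/hd[].
  - by move=> z /sub/hd[_ +] k => /(_ k); rewrite distrC.
  rewrite ler_wpM2r// /e' mulrCA ler_piMr// ler_pdivrMr// mul1r ler_nat.
  exact: leqnSn.
apply/diff_locallyP.
by rewrite (diff_unique lc key).
Unshelve. all: by end_near. Qed.

Lemma derive_sum_coord f x v : differentiable f x ->
  'D_v f x = \sum_k v 0 k * pderiv k f x.
Proof.
move=> df; rewrite deriveE// {1}(row_sum_coord v) linear_sum/=.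
by apply: eq_bigr => k _; rewrite linearZ/= /pderiv deriveE.
Qed.

Lemma differentiable_row (V : normedModType R) (F : V -> E) (x : V) :
  (forall i, differentiable (fun z => F z 0 i) x) -> differentiable F x.
Proof.
move=> dF.
have -> : F = \sum_i (fun z => F z 0 i *: ev i).
  by apply/funext => z; rewrite fct_sumE {1}(row_sum_coord (F z)).
apply: differentiable_sum => i.
exact: differentiableZl.
Qed.

End Differentiability.

(** * Functions of class C^k *)

Section Ck.
Variables (R : realType) (n : nat).
Local Notation E := 'rV[R]_n.
Implicit Types (U : set E) (f g : E -> R).

(** Finite orders give an induction that [smooth_on], quantified over all sequences of indices, does
    not offer directly. Continuity is part of every level, since existence of partial derivatives
    alone does not imply it. *)
Fixpoint Ck (m : nat) U f : Prop :=
  (forall x, U x -> {for x, continuous f}) /\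
  if m is m'.+1 then
    forall k : 'I_n, (forall x, U x -> derivable f x 'e_k) /\ Ck m' U (pderiv k f)
  else True.

Lemma smooth_onP U f : smooth_on U f <-> forall m, Ck m U f.
Proof.
split=> [sf m|].
  elim: m f sf => [|m IH] f sf; split=> //; try by move=> x /(sf [::])[].
  move=> k; split; first by move=> x /(sf [::])[].
  (* [iter_pderiv] folds from the right, so the derivative taken first is the last entry of the
     sequence; hence [rcons] here and induction from the end below. *)
  apply: IH => s x Ux; have := sf (rcons s k) x Ux.
  by rewrite /iter_pderiv foldr_rcons.
move=> cf s; elim/last_ind: s f cf => [|s k IH] f cf x Ux.
  by case: (cf 1%N) => + /= h => /(_ x Ux); split=> // k; exact: (h k).1.
rewrite /iter_pderiv foldr_rcons; apply: IH => // m.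
exact: ((cf m.+1).2 k).2.
Qed.

Lemma eq_pderiv f g k x : f =1 g -> pderiv k f x = pderiv k g x.
Proof. by move=> /funext ->. Qed.

Lemma eq_on_near U f g x : open U -> U x -> {in U, f =1 g} ->
  {near x, f =1 g}.
Proof.
move=> oU Ux fg; have /open_nbhs_nbhs : open_nbhs x U by [].
by apply: filterS => y Uy; apply: fg; rewrite inE.
Qed.

Lemma eq_on_pderiv U f g x k : open U -> U x -> {in U, f =1 g} ->
  pderiv k f x = pderiv k g x.
Proof. by move=> oU Ux fg; apply: near_eq_derive; exact: eq_on_near oU Ux fg. Qed.

Lemma eq_on_continuous U f g x : open U -> U x -> {in U, f =1 g} ->
  {for x, continuous f} -> {for x, continuous g}.
Proof.
move=> oU Ux fg; rewrite /prop_for /continuous_at -(fg x) ?inE//.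
move=> fx; apply: cvg_trans fx; apply: (@near_eq_cvg _ _ (nbhs x) _ f g).
exact: eq_on_near fg.
Qed.

Lemma eq_Ck m U f g : open U -> {in U, f =1 g} -> Ck m U f -> Ck m U g.
Proof.
move=> oU; elim: m f g => [|m IH] f g fg [cf df].
  by split=> // x Ux; exact: eq_on_continuous fg (cf x Ux).
split=> [x Ux|k]; first exact: eq_on_continuous fg (cf x Ux).
have [dk ck] := df k; split=> [x Ux|].
  exact: near_eq_derivable (eq_on_near oU Ux fg) (dk x Ux).
apply: IH ck => x; rewrite inE => Ux.
exact: eq_on_pderiv oU Ux fg.
Qed.

Lemma Ck_subset m U U' f : U' `<=` U -> Ck m U f -> Ck m U' f.
Proof.
move=> UU; elim: m f => [|m IH] f [cf df]; split=> //; try by move=> x /UU/cf.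
move=> k; have [dk ck] := df k; split; last exact: IH.
by move=> x /UU/dk.
Qed.

Lemma CkS m U f : Ck m.+1 U f -> Ck m U f.
Proof.
elim: m f => [|m IH] f [cf df]; split=> // k.
by have [dk ck] := df k; split=> //; exact: IH.
Qed.

Lemma Ck_continuous m U f x : Ck m U f -> U x -> {for x, continuous f}.
Proof. by case: m => [|m] [cf _] /cf. Qed.

Lemma Ck_local m U f :
  (forall x, U x -> exists U', [/\ open U', U' x & Ck m U' f]) -> Ck m U f.
Proof.
elim: m f => [|m IH] f h; split=> //.
- by move=> x /h[U' [oU Ux []]] + _; exact.
- by move=> x /h[U' [oU Ux []]] + _; exact.
- move=> k; split=> [x /h[U' [oU Ux [_ /(_ k)[+ _]]]]|]; first exact.
  by apply: IH => x /h[U' [oU Ux [_ /(_ k)[_ ck]]]]; exists U'.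
Qed.

Lemma Ck_differentiable m U f x : open U -> Ck m.+1 U f -> U x ->
  differentiable f x.
Proof.
move=> oU [cf df] Ux; apply: C1_differentiable => [|k].
  have /open_nbhs_nbhs : open_nbhs x U by [].
  by apply: filterS => y Uy k; exact: (df k).1.
exact: Ck_continuous (df k).2 Ux.
Qed.

Lemma Ck_cst m U (c : R) : Ck m U (fun=> c).
Proof.
elim: m c => [|m IH] c; split=> //; try by move=> x _; exact: cst_continuous.
move=> k; split=> [x Ux|]; first exact: derivable_cst.
rewrite (_ : pderiv k _ = fun=> 0)//; apply/funext => x.
by rewrite /pderiv; exact: derive_cst.
Qed.

Lemma is_derive_coord (x v : E) i : is_derive x v (fun z : E => z 0 i) (v 0 i).
Proof.
have d : differentiable (fun z : E => z 0 i : R) x.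
  exact: differentiable_coord.
split; first exact: diff_derivable.
apply/lim_near_cst => //; near=> h.
rewrite /= !mxE addrK [_ *: _]mulrA mulVf ?mul1r//.
by near: h; exact: nbhs_dnbhs_neq.
Unshelve. all: by end_near. Qed.

Lemma Ck_coord m U i : Ck m U (fun x => x 0 i).
Proof.
case: m => [|m]; split=> //; try by move=> x _; exact: coord_continuous.
move=> k; split=> [x Ux|].
  by case: (is_derive_coord x 'e_k i).
rewrite (_ : pderiv k _ = fun=> ('e_k : E) 0 i); first exact: Ck_cst.
by apply/funext => x; rewrite /pderiv (@derive_val _ _ _ _ _ _ _ (is_derive_coord x 'e_k i)).
Qed.

Lemma CkD m U f g : open U -> Ck m U f -> Ck m U g -> Ck m U (fun x => f x + g x).
Proof.
move=> oU; elim: m f g => [|m IH] f g [cf df] [cg dg]; split=> //.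
- by move=> x Ux; apply: (@continuousD _ _ _ f g); [exact: cf|exact: cg].
- by move=> x Ux; apply: (@continuousD _ _ _ f g); [exact: cf|exact: cg].
move=> k; have [dfk cfk] := df k; have [dgk cgk] := dg k; split=> [x Ux|].
  by apply: derivableD; [exact: dfk|exact: dgk].
apply: eq_Ck (IH _ _ cfk cgk) => // x; rewrite inE => Ux.
by rewrite /pderiv [RHS]deriveD//; [exact: dfk|exact: dgk].
Qed.

Lemma pderivM f g x k : derivable f x 'e_k -> derivable g x 'e_k ->
  pderiv k (fun x => f x * g x) x = pderiv k f x * g x + f x * pderiv k g x.
Proof.
move=> df dg; apply: etrans (deriveM df dg) _; rewrite addrC.
by congr (_ + _); exact: mulrC.
Qed.

Lemma CkM m U f g : open U -> Ck m U f -> Ck m U g -> Ck m U (fun x => f x * g x).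
Proof.
move=> oU; elim: m f g => [|m IH] f g Cf Cg; have [cf df] := Cf; have [cg dg] := Cg; split=> //.
- by move=> x Ux; apply: (@continuousM _ _ f g); [exact: cf|exact: cg].
- by move=> x Ux; apply: (@continuousM _ _ f g); [exact: cf|exact: cg].
move=> k; have [dfk cfk] := df k; have [dgk cgk] := dg k; split=> [x Ux|].
  by apply: derivableM; [exact: dfk|exact: dgk].
have := CkD oU (IH _ _ cfk (CkS Cg)) (IH _ _ (CkS Cf) cgk).
apply: eq_Ck => // x; rewrite inE => Ux.
by rewrite pderivM//; [exact: dfk|exact: dgk].
Qed.

Lemma Ck_sum m U (I : Type) (r : seq I) (P : pred I) (F : I -> E -> R) : open U ->
  (forall i, P i -> Ck m U (F i)) -> Ck m U (fun x => \sum_(i <- r | P i) F i x).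
Proof.
move=> oU CF; elim: r => [|i r IH].
  by apply: eq_Ck (Ck_cst m U 0) => // x _; rewrite big_nil.
have [Pi|Pi] := boolP (P i).
  by apply: eq_Ck (CkD oU (CF i Pi) IH) => // x _; rewrite big_cons Pi.
by apply: eq_Ck IH => // x _; rewrite big_cons (negbTE Pi).
Qed.

Lemma Ck_prod m U (I : Type) (r : seq I) (P : pred I) (F : I -> E -> R) : open U ->
  (forall i, P i -> Ck m U (F i)) -> Ck m U (fun x => \prod_(i <- r | P i) F i x).
Proof.
move=> oU CF; elim: r => [|i r IH].
  by apply: eq_Ck (Ck_cst m U 1) => // x _; rewrite big_nil.
have [Pi|Pi] := boolP (P i).
  by apply: eq_Ck (CkM oU (CF i Pi) IH) => // x _; rewrite big_cons Pi.
by apply: eq_Ck IH => // x _; rewrite big_cons (negbTE Pi).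
Qed.

Lemma CkV m U f : open U -> (forall x, U x -> f x != 0) -> Ck m U f ->
  Ck m U (fun x => (f x)^-1).
Proof.
move=> oU f0; elim: m => [|m IH] Cf; have [cf df] := Cf; split=> //.
- by move=> x Ux; apply: continuousV; [exact: f0|exact: cf].
- by move=> x Ux; apply: continuousV; [exact: f0|exact: cf].
move=> k; have [dfk cfk] := df k; split=> [x Ux|].
  by apply: derivableV; [exact: f0|exact: dfk].
have C := IH (CkS Cf).
have := CkM oU (Ck_cst m U (-1)) (CkM oU (CkM oU C C) cfk).
apply: eq_Ck => // x; rewrite inE => Ux.
rewrite /pderiv [RHS]deriveV//; [|exact: f0|exact: dfk].
by rewrite mulN1r -[RHS]/(- (f x) ^- 2 * _) mulNr expr2 invfM.
Qed.

End Ck.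

(** * Chain rule and composition *)

Section Composition.
Variables (R : realType).

(* [v *m jac F x] is the derivative of [F] at [x] along the row vector [v]. *)
Definition jac (n p : nat) (F : 'rV[R]_n -> 'rV[R]_p) (x : 'rV[R]_n) : 'M[R]_(n, p) :=
  \matrix_(k, i) pderiv k (fun z => F z 0 i) x.

Lemma continuous_row (n : nat) (T : topologicalType) (F : T -> 'rV[R]_n) (x : T) :
  (forall i, {for x, continuous (fun z => F z 0 i)}) -> {for x, continuous F}.
Proof.
move=> cF; apply/cvgrPdist_le => e e0.
have h : \forall z \near x, forall i, `|F x 0 i - F z 0 i| <= e.
  apply: (@filter_forall _ _ (fun i z => `|F x 0 i - F z 0 i| <= e) (nbhs x)) => i.
  by move: (cF i) => /cvgrPdist_le; exact.
apply: filterS h => z h; apply/norm_leP; first exact: ltW.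
by move=> i; rewrite !mxE.
Qed.

Lemma chain_rule (n : nat) (V : normedModType R) (F : V -> 'rV[R]_n) (f : 'rV[R]_n -> R) (x v : V) :
  (forall i, differentiable (fun z => F z 0 i) x) -> differentiable f (F x) ->
  'D_v (f \o F) x = \sum_i 'D_v (fun z => F z 0 i) x * pderiv i f (F x).
Proof.
move=> dF df; have dF' := differentiable_row dF.
rewrite deriveE; last exact: differentiable_comp.
rewrite diff_comp//= -deriveE// derive_sum_coord//; apply: eq_bigr => i _.
by rewrite -deriveE// derive_mx ?mxE//; exact: diff_derivable.
Qed.

(** By the chain rule a partial derivative of the composite is a sum of products of derivatives of
    [F] with [pderiv i f] composed with [F], and these factors have one order less. *)
Lemma Ck_comp (n p m : nat) (U : set 'rV[R]_n) (V : set 'rV[R]_p) (F : 'rV[R]_n -> 'rV[R]_p) f :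
  open U -> open V -> (forall x, U x -> V (F x)) ->
  (forall i, Ck m U (fun x => F x 0 i)) -> Ck m V f -> Ck m U (f \o F).
Proof.
move=> oU oV UV; elim: m f => [|m IH] f CF Cf.
  split=> // x Ux; apply: continuous_comp; last exact: (Ck_continuous Cf (UV _ Ux)).
  by apply: continuous_row => i; exact: Ck_continuous (CF i) Ux.
have dF x : U x -> forall i, differentiable (fun x => F x 0 i) x.
  by move=> Ux i; apply: Ck_differentiable oU (CF i) Ux.
have df x : U x -> differentiable f (F x).
  by move=> Ux; apply: Ck_differentiable oV Cf (UV _ Ux).
have dc x : U x -> differentiable (f \o F) x.
  move=> Ux; apply: differentiable_comp; last exact: df.
  by apply: differentiable_row; exact: dF.
split=> [x Ux|k]; first by apply: differentiable_continuous; exact: dc.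
split=> [x Ux|]; first by apply: diff_derivable; exact: dc.
have : Ck m U (fun x => \sum_i pderiv k (fun z => F z 0 i) x * (pderiv i f \o F) x).
  apply: Ck_sum => // i _; apply: CkM => //; first exact: ((CF i).2 k).2.
  apply: IH; last exact: (Cf.2 i).2.
  by move=> j; exact: CkS.
apply: eq_Ck => // x; rewrite inE => Ux.
by rewrite /pderiv chain_rule//; [exact: dF|exact: df].
Qed.

End Composition.

(** * Estimates on boxes *)

Section Boxes.
Variables (R : realType) (n : nat).
Local Notation E := 'rV[R]_n.
Implicit Types (U : set E) (f : E -> R) (c r : E).

(** The radius depends on the coordinate because a point and a derivative will later be paired into
    one state, with boxes of different sizes. *)
Definition box c r : set E := [set v | forall i, `|v 0 i - c 0 i| <= r 0 i].

Lemma box_compact c r : compact (box c r).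
Proof.
have -> : box c r = [set v | forall i, `[c 0 i - r 0 i, c 0 i + r 0 i]%classic (v 0 i)].
  by apply/seteqP; split=> v h i; have := h i; rewrite /= in_itv/= ler_distl.
apply: (@rV_compact R n (fun i => `[c 0 i - r 0 i, c 0 i + r 0 i]%classic)) => i.
exact: segment_compact.
Qed.

Lemma box_convex c r x y (t : R) : 0 <= t <= 1 -> box c r x -> box c r y ->
  box c r (x + t *: (y - x)).
Proof.
move=> /andP[t0 t1] bx bY i; rewrite !mxE.
have -> : x 0 i + t * (y 0 i - x 0 i) - c 0 i =
  (1 - t) * (x 0 i - c 0 i) + t * (y 0 i - c 0 i) by ring.
rewrite (le_trans (ler_normD _ _))// !normrM (ger0_norm t0) (@ger0_norm _ (1 - t)) ?subr_ge0//.
have -> : r 0 i = (1 - t) * r 0 i + t * r 0 i by ring.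
by rewrite lerD// ler_wpM2l// subr_ge0.
Qed.

Lemma box_bounded c r U f : box c r `<=` U -> Ck 0 U f ->
  exists2 M, 0 <= M & forall x, box c r x -> `|f x| <= M.
Proof.
move=> bU [cf _].
have [b0|b0] := pselect (box c r !=set0); last first.
  by exists 0 => // x bx; case: b0; exists x.
have cn : {within box c r, continuous (fun x => `|f x|)}.
  apply: continuous_in_subspaceT => x; rewrite inE => /bU /cf cx.
  by apply: continuous_comp cx _; exact: norm_continuous.
have [x _ xm] := EVT_max_rV b0 (@box_compact c r) cn.
by exists `|f x| => // y by_; apply: xm; rewrite inE.
Qed.

Lemma mean_value_segment U f x y : open U -> Ck 1 U f ->
  (forall t : R, 0 <= t <= 1 -> U (x + t *: (y - x))) ->
  exists2 t : R, 0 <= t <= 1 & f y - f x = 'D_(y - x) f (x + t *: (y - x)).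
Proof.
move=> oU Cf xyU; pose g := fun t : R => f (x + t *: (y - x)).
have gd (t : R) : t \in `[0, 1] -> is_derive t 1 g ('D_(y - x) f (x + t *: (y - x))).
  rewrite in_itv/= => t01; apply: is_derive_line; apply: diff_derivable.
  by apply: Ck_differentiable oU Cf _; exact: xyU.
have gd' (t : R) : t \in `]0, 1[ -> is_derive t 1 g ('D_(y - x) f (x + t *: (y - x))).
  by move=> /subset_itv_oo_cc /gd.
have gc : {within `[0, 1], continuous g}.
  by apply: derivable_within_continuous => t /gd[].
have [t t01 E] := MVT_segment ler01 gd' gc.
exists t; first by move: t01; rewrite in_itv.
by move: E; rewrite /g scale0r addr0 scale1r subr0 mulr1 (addrC x) subrK.
Qed.

Lemma box_bounded_pderiv c r U f : box c r `<=` U -> Ck 1 U f ->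
  exists2 M, 0 <= M & forall x, box c r x -> forall k, `|pderiv k f x| <= M.
Proof.
move=> bU [_ df].
have H k := box_bounded bU (df k).2.
exists (\sum_k sval (cid2 (H k))) => [|x bx k].
  by apply: sumr_ge0 => k _; case: cid2.
rewrite (bigD1 k)//=; case: cid2 => M M0 h /=.
rewrite (le_trans (h x bx))// lerDl; apply: sumr_ge0 => j _; by case: cid2.
Qed.

Lemma box_lipschitz c r U f : open U -> box c r `<=` U -> Ck 1 U f ->
  exists2 L, 0 <= L & forall x y, box c r x -> box c r y ->
    `|f y - f x| <= L * `|y - x|.
Proof.
move=> oU bU Cf; have [M M0 hM] := box_bounded_pderiv bU Cf.
exists (n%:R * M) => [|x y bx bY]; first by rewrite mulr_ge0.
have [t t01 ->] := mean_value_segment oU Cf (fun t t01 => bU _ (box_convex t01 bx bY)).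
have bt := box_convex t01 bx bY.
rewrite derive_sum_coord; last exact: Ck_differentiable oU Cf (bU _ bt).
rewrite (le_trans (ler_norm_sum _ _ _))//.
rewrite -mulrA -[n in n%:R]card_ord mulr_natl -sumr_const ler_sum// => k _.
by rewrite normrM mulrC ler_pM//; [exact: hM|exact: coord_le_norm].
Qed.

(** The mean value theorem leaves increments of first partial derivatives, which are Lipschitz on
    the box; no second-order Taylor formula is involved. *)
Lemma box_quadratic c r U f : open U -> box c r `<=` U -> Ck 2 U f ->
  exists2 Q, 0 <= Q & forall x y, box c r x -> box c r y ->
    `|f y - f x - \sum_k (y - x) 0 k * pderiv k f x| <= Q * `|y - x| ^+ 2.
Proof.
move=> oU bU Cf; have [_ df] := Cf.
have H k := box_lipschitz oU bU (df k).2.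
exists (\sum_k sval (cid2 (H k))) => [|x y bx bY].
  by apply: sumr_ge0 => k _; case: cid2.
have [t t01 ->] := mean_value_segment oU (CkS Cf) (fun t t01 => bU _ (box_convex t01 bx bY)).
have bt := box_convex t01 bx bY.
rewrite derive_sum_coord; last exact: Ck_differentiable oU (CkS Cf) (bU _ bt).
rewrite -sumrB (le_trans (ler_norm_sum _ _ _))// mulr_suml ler_sum// => k _.
rewrite -mulrBr normrM; case: cid2 => L L0 hL /=.
rewrite expr2 mulrA mulrC ler_pM//; last exact: coord_le_norm.
rewrite (le_trans (hL _ _ bx bt))// ler_wpM2l// addrC addKr normrZ ler_piMl//.
by case/andP: t01 => t0 t1; rewrite ger0_norm.
Qed.

Lemma box_const_norm x (e : R) y : 0 <= e -> box x (const_mx e) y <-> `|y - x| <= e.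
Proof.
move=> e0; rewrite norm_leP//.
by split=> h i; have := h i; rewrite !mxE.
Qed.

Lemma open_box_nbhs U x : open U -> U x ->
  exists2 e : R, 0 < e & box x (const_mx e) `<=` U.
Proof.
move=> oU Ux.
have [d /= d0 hd] := (nbhs_ballP _ _).1 (open_nbhs_nbhs (conj oU Ux)).
rewrite -ball_normE in hd.
have d20 : 0 < d / 2 by exact: divr_gt0.
exists (d / 2) => // y.
rewrite (box_const_norm _ _ (ltW d20)) => yx; apply: hd.
by rewrite /ball_/= distrC (le_lt_trans yx)// ltr_pdivrMr// ltr_pMr// ltr1n.
Qed.

End Boxes.

(** * Symmetry of second partial derivatives *)

Section Schwarz.
Variables (R : realType) (n : nat).
Local Notation E := 'rV[R]_n.

(** Two applications of the mean value theorem: along ['e_i] to the difference of [f] and its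
    translate by [h *: 'e_j], then along ['e_j] to [pderiv i f]. *)
Let second_difference (U : set E) (f : E -> R) x (h : R) (i j : 'I_n) : open U -> Ck 2 U f ->
  0 < h -> box x (const_mx (h *+ 2)) `<=` U ->
  exists2 y, `|y - x| <= h *+ 2 & f (x + h *: 'e_j + h *: 'e_i) - f (x + h *: 'e_i)
    - (f (x + h *: 'e_j) - f x) = h * (h * pderiv j (pderiv i f) y).
Proof.
move=> oU Cf h0 hU.
have e1 k : `|'e_k : E| <= 1.
  by apply/norm_leP => // l; rewrite !mxE eqxx/=; case: eqP; rewrite ?normr1 ?normr0.
have nh : `|h| = h by rewrite gtr0_norm.
have hh : `|h| <= h by rewrite nh.
have near (a b : R) : `|a| <= h -> `|b| <= h -> `|x + a *: 'e_j + b *: 'e_i - x| <= h *+ 2.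
  move=> ah bh; rewrite addrC !addrA addNr add0r (le_trans (ler_normD _ _))// mulr2n.
  by rewrite lerD// normrZ (le_trans (ler_wpM2l _ (e1 _)))// mulr1.
have h20 : 0 <= h *+ 2 by rewrite mulrn_wge0 ?ltW.
have nearU (a b : R) : `|a| <= h -> `|b| <= h -> U (x + a *: 'e_j + b *: 'e_i).
  by move=> ah bh; apply: hU; apply/box_const_norm => //; exact: near.
have C1 := CkS Cf; have [_ df] := C1; have [_ ddf] := Cf.
pose g z := f (h *: 'e_j + z) - f z.
have n0 : `|0 : R| <= h by rewrite normr0 ltW.
have dg (t : R) : `|t| <= `|h| -> is_derive (x + t *: 'e_i) 'e_i g
     (pderiv i f (h *: 'e_j + (x + t *: 'e_i)) - pderiv i f (x + t *: 'e_i)).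
  rewrite nh => th.
  have d1 : derivable f (x + t *: 'e_i) 'e_i.
    by apply: (df i).1; have := nearU 0 t n0 th; rewrite scale0r addr0.
  have d2 : derivable f (h *: 'e_j + (x + t *: 'e_i)) 'e_i.
    apply: (df i).1; rewrite addrA (addrC (h *: _) x). exact: nearU.
  have d3 : is_derive (x + t *: 'e_i) 'e_i (fun z => f (h *: 'e_j + z)) (pderiv i f (h *: 'e_j + (x + t *: 'e_i))).
    have EE : (fun s : R => s^-1 *: (((fun z => f (h *: 'e_j + z)) \o shift (x + t *: 'e_i)) (s *: 'e_i) - f (h *: 'e_j + (x + t *: 'e_i))))
      = (fun s : R => s^-1 *: ((f \o shift (h *: 'e_j + (x + t *: 'e_i))) (s *: 'e_i) - f (h *: 'e_j + (x + t *: 'e_i)))).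
      by apply/funext => s /=; rewrite (addrCA (h *: _)).
    by split; [rewrite /derivable EE|rewrite /pderiv /derive EE].
  apply: is_deriveB.
  exact: derivableP.
have [t th] := @mean_value_line _ _ g x 'e_i h (fun t th => let: DeriveDef d _ := dg t th in d).
rewrite (@derive_val _ _ _ _ _ _ _ (dg t th)) /g => E.
rewrite nh in th.
have ds (s : R) : `|s| <= `|h| -> derivable (pderiv i f) (x + t *: 'e_i + s *: 'e_j) 'e_j.
  by rewrite nh => sh; apply: (((ddf i).2).2 j).1; rewrite addrAC; exact: nearU.
have [s sh] := mean_value_line ds.
rewrite nh in sh => E2.
have yE : x + t *: 'e_i + s *: 'e_j = x + s *: 'e_j + t *: 'e_i by rewrite addrAC.
exists (x + t *: 'e_i + s *: 'e_j); first by rewrite yE; exact: near.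
have E3 : pderiv i f (h *: 'e_j + (x + t *: 'e_i)) - pderiv i f (x + t *: 'e_i) =
    h * pderiv j (pderiv i f) (x + t *: 'e_i + s *: 'e_j).
  by rewrite (addrC (h *: _)); exact: E2.
have zE : x + h *: 'e_j + h *: 'e_i = h *: 'e_j + (x + h *: 'e_i).
  by rewrite addrAC addrC.
by rewrite -E3 -E zE (addrC x (h *: 'e_j)).
Qed.

Let eq_of_near_values (A B : E -> R) x :
  {for x, continuous A} -> {for x, continuous B} ->
  (forall d : R, 0 < d -> exists y z, [/\ `|y - x| <= d, `|z - x| <= d & A y = B z]) ->
  A x = B x.
Proof.
move=> cA cB h; apply/eqP; rewrite -subr_eq0 -normr_le0.
apply/ler_addgt0Pl => e e0; rewrite addr0.
have e20 : 0 < e / 2 by exact: divr_gt0.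
have hA : \forall y \near x, `|A x - A y| <= e / 2.
  exact: ((cvgrPdist_le _ _).1 cA).
have hB : \forall y \near x, `|B x - B y| <= e / 2.
  exact: ((cvgrPdist_le _ _).1 cB).
have [d /= d0 hd] := (nbhs_ballP _ _).1 (filterI hA hB).
rewrite -ball_normE in hd.
have d20 : 0 < d / 2 by exact: divr_gt0.
have d2 : d / 2 < d by rewrite ltr_pdivrMr// ltr_pMr// ltr1n.
have [y [z [yx zx yz]]] := h _ d20.
have /hd[hy _] : ball_ Num.Def.normr x d y by rewrite /ball_/= distrC (le_lt_trans yx).
have /hd[_ hz] : ball_ Num.Def.normr x d z by rewrite /ball_/= distrC (le_lt_trans zx).
have -> : A x - B x = (A x - A y) - (B x - B z) by rewrite yz; ring.
by rewrite (le_trans (ler_normB _ _))// (splitr e) lerD.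
Qed.

(** The second difference is symmetric in i and j, so the two mixed derivatives share values at
    points arbitrarily near [x]; continuity concludes. *)
Lemma pderivC (U : set E) (f : E -> R) x i j : open U -> Ck 2 U f -> U x ->
  pderiv i (pderiv j f) x = pderiv j (pderiv i f) x.
Proof.
move=> oU Cf Ux; have [_ df] := Cf.
apply: eq_of_near_values => [||d d0].
- exact: (((df j).2).2 i).2.1 x Ux.
- exact: (((df i).2).2 j).2.1 x Ux.
have [r r0 hr] := open_box_nbhs oU Ux.
pose h := Num.min (r / 2) (d / 2).
have h0 : 0 < h by rewrite lt_min !divr_gt0.
have h20 : 0 <= h *+ 2 by rewrite mulrn_wge0// ltW.
have h2r : h *+ 2 <= r by rewrite -mulr_natr -ler_pdivlMr// ge_min lexx.
have h2d : h *+ 2 <= d by rewrite -mulr_natr -ler_pdivlMr// ge_min lexx orbT.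
have hU : box x (const_mx (h *+ 2)) `<=` U.
  move=> y; rewrite (box_const_norm _ _ h20) => yh; apply: hr.
  by rewrite (box_const_norm _ _ (ltW r0)) (le_trans yh).
have [y yx Ey] := second_difference j i oU Cf h0 hU.
have [z zx Ez] := second_difference i j oU Cf h0 hU.
exists y, z; split; [exact: le_trans h2d|exact: le_trans h2d|].
apply: (mulfI (lt0r_neq0 h0)); apply: (mulfI (lt0r_neq0 h0)).
apply: etrans (esym Ey) _; apply: etrans _ Ez.
by rewrite (addrAC x); ring.
Qed.

End Schwarz.

(** * Gronwall's inequality *)

Section QuadraticDerivative.
Variables (R : realType) (n : nat).
Local Notation V := 'rV[R]_n.

Definition qder (y w : R -> V) : Prop := exists2 C, 0 <= C &
  forall s t, 0 <= s -> s <= t -> t <= 1 ->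
    `|y t - y s - (t - s) *: w s| <= C * (t - s) ^+ 2.

Lemma qderB (y1 y2 w1 w2 : R -> V) : qder y1 w1 -> qder y2 w2 ->
  qder (fun s => y1 s - y2 s) (fun s => w1 s - w2 s).
Proof.
move=> [C C0 hC] [D D0 hD]; exists (C + D) => [|s t s0 st t1]; first exact: addr_ge0.
have -> : y1 t - y2 t - (y1 s - y2 s) - (t - s) *: (w1 s - w2 s) =
  (y1 t - y1 s - (t - s) *: w1 s) - (y2 t - y2 s - (t - s) *: w2 s).
  by apply/rowP => i; rewrite !mxE; ring.
by rewrite (le_trans (ler_normB _ _))// mulrDl lerD// ?hC ?hD.
Qed.

Lemma qderZ (y w : R -> V) (c : R) : qder y w ->
  qder (fun s => c *: y s) (fun s => c *: w s).
Proof.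
move=> [C C0 hC]; exists (`|c| * C) => [|s t s0 st t1]; first exact: mulr_ge0.
rewrite scalerA mulrC -scalerA -!scalerBr normrZ -mulrA ler_wpM2l//.
exact: hC.
Qed.

Lemma ler_of_inv_nat (a b D : R) : (forall N, a <= b + D / N.+1%:R) -> a <= b.
Proof.
move=> h; apply/ler_addgt0Pr => e e0.
have [N hN] : exists N : nat, D / e < N.+1%:R.
  exists (Num.truncn `|D / e|); rewrite (le_lt_trans (ler_norm _))//.
  by rewrite truncnS_gt.
rewrite (le_trans (h N))// lerD2l ler_pdivrMr// mulrC -ler_pdivrMr//.
exact: ltW.
Qed.

(** Discrete steps replace integrals: over N + 1 equal steps of length d, the norm is each time
    multiplied by at most [1 + a d] and increased by at most [b d + C d^2]. The factors multiply to
    at most [exp(a l)], and the quadratic errors add up to [C l^2 / (N + 1)], which disappears as N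
    grows. *)
Lemma gronwall (y w : R -> V) (s0 s1 a b : R) : qder y w ->
  0 <= s0 -> s0 <= s1 -> s1 <= 1 -> 0 <= a -> 0 <= b ->
  (forall s, s0 <= s <= s1 -> `|w s| <= a * `|y s| + b) ->
  `|y s1| <= expR (a * (s1 - s0)) * (`|y s0| + b * (s1 - s0)).
Proof.
move=> [C C0 hC] s00 s01 s11 a0 b0 hw.
set l := s1 - s0; have l0 : 0 <= l by rewrite subr_ge0.
apply: (@ler_of_inv_nat _ _ (expR (a * l) * (C * l ^+ 2))) => N.
pose d := l / N.+1%:R; have d0 : 0 <= d by rewrite divr_ge0.
pose t k := s0 + k%:R * d.
have tN : t N.+1 = s1 by rewrite /t /d mulrCA divff// mulr1 addrC subrK.
have tS k : t k.+1 = t k + d by rewrite /t -natr1 mulrDl mul1r addrA.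
have t0 k : s0 <= t k by rewrite lerDl mulr_ge0.
have t1 k : (k <= N.+1)%N -> t k <= s1.
  by move=> kN; rewrite -tN lerD2l ler_wpM2r// ler_nat.
have e1 : 0 <= 1 + a * d by rewrite addr_ge0// mulr_ge0.
have e2 : 0 <= b * d + C * d ^+ 2 by rewrite addr_ge0// mulr_ge0// exprn_ge0.
have key k : (k <= N.+1)%N ->
    `|y (t k)| <= (1 + a * d) ^+ k * (`|y s0| + k%:R * (b * d + C * d ^+ 2)).
  elim: k => [|k IH] kN; first by rewrite expr0 !mul1r mul0r addr0 /t mul0r addr0.
  have {}IH := IH (ltnW kN).
  have dE : t k.+1 - t k = d by rewrite tS addrC addKr.
  have := hC (t k) (t k.+1) (le_trans s00 (t0 k)) _ (le_trans (t1 _ kN) s11).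
  rewrite dE tS lerDl => /(_ d0) H1.
  have H2 : `|w (t k)| <= a * `|y (t k)| + b by apply: hw; rewrite t0 t1// ltnW.
  have H3 : `|y (t k + d)| <= `|y (t k)| + (d * (a * `|y (t k)| + b) + C * d ^+ 2).
    have -> : y (t k + d) = y (t k) + (d *: w (t k) + (y (t k + d) - y (t k) - d *: w (t k))).
      by apply/rowP => i; rewrite !mxE; ring.
    rewrite (le_trans (ler_normD _ _))// lerD2l (le_trans (ler_normD _ _))// lerD//.
    by rewrite normrZ ger0_norm// ler_wpM2l.
  apply: le_trans H3 _.
  have p1 : 1 <= (1 + a * d) ^+ k.+1 by rewrite exprn_ege1// lerDl mulr_ge0.
  set p := (1 + a * d) ^+ k in IH; rewrite exprS in p1 *; rewrite -/p in p1 *.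
  set q := b * d + C * d ^+ 2 in e2 IH *.
  have -> : `|y (t k)| + (d * (a * `|y (t k)| + b) + C * d ^+ 2) =
     (1 + a * d) * `|y (t k)| + q by rewrite /q; ring.
  rewrite -natr1.
  have H4 : (1 + a * d) * `|y (t k)| <= (1 + a * d) * (p * (`|y s0| + k%:R * q)).
    exact: ler_wpM2l.
  have H5 : q <= (1 + a * d) * p * q by rewrite ler_peMl.
  by apply: le_trans (lerD H4 H5) _; rewrite le_eqVlt; apply/orP; left; apply/eqP; ring.
have := key N.+1 (leqnn _); rewrite tN => /le_trans; apply.
have H6 : N.+1%:R * (b * d + C * d ^+ 2) = b * l + C * l ^+ 2 / N.+1%:R.
  have : N.+1%:R != 0 :> R by rewrite pnatr_eq0.
  by rewrite /d; move: (N.+1%:R : R) => M M0; field.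
have H7 : (1 + a * d) ^+ N.+1 <= expR (a * l).
  have -> : a * l = (a * d) * N.+1%:R.
    by rewrite -mulrA /d divfK// pnatr_eq0.
  by rewrite expRM_natr lerXn2r// ?nnegrE ?expR_ge0// expR_ge1Dx.
rewrite H6 -[X in _ <= _ + X]mulrA -mulrDr addrA ler_wpM2r//.
by rewrite !addr_ge0// !mulr_ge0// ?invr_ge0// exprn_ge0.
Qed.

Lemma qder_mean_value (y w : R -> V) (s0 s1 b : R) : qder y w ->
  0 <= s0 -> s0 <= s1 -> s1 <= 1 -> 0 <= b ->
  (forall s, s0 <= s <= s1 -> `|w s| <= b) ->
  `|y s1 - y s0| <= b * (s1 - s0).
Proof.
move=> [C C0 hC] s00 s01 s11 b0 hw.
have yq : qder (fun s => y s - y s0) w.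
  exists C => // s t h0 h1 h2.
  have -> : y t - y s0 - (y s - y s0) = y t - y s by rewrite opprB subrKA.
  exact: hC.
have := gronwall yq s00 s01 s11 (lexx 0) b0.
rewrite mul0r expR0 subrr normr0 mul1r add0r; apply.
by move=> s /hw; rewrite mul0r add0r.
Qed.

Lemma qder_cst (v : V) : qder (fun=> v) (fun=> 0).
Proof. by exists 0 => // s t _ _ _; rewrite subrr scaler0 subrr normr0 mul0r. Qed.

Lemma qder_id (v : V) : qder (fun s => s *: v) (fun=> v).
Proof. by exists 0 => // s t _ _ _; rewrite scalerBl subrr normr0 mul0r. Qed.

(** Product rule for [s y(s)]; the bound on [w] controls the extra term [(t - s)^2 w(s)]. *)
Lemma qder_scale (y w : R -> V) (M : R) : qder y w ->
  (forall s, 0 <= s <= 1 -> `|w s| <= M) ->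
  qder (fun s => s *: y s) (fun s => y s + s *: w s).
Proof.
move=> [C C0 hC] hM.
have M0 : 0 <= M by apply: le_trans (hM 0 _) => //; rewrite lexx ler01.
exists (C + M) => [|s t s0 st t1]; first exact: addr_ge0.
have -> : t *: y t - s *: y s - (t - s) *: (y s + s *: w s) =
  t *: (y t - y s - (t - s) *: w s) + (t - s) ^+ 2 *: w s.
  by apply/rowP => i; rewrite !mxE; ring.
have t0 : 0 <= t by apply: le_trans st.
rewrite (le_trans (ler_normD _ _))// mulrDl lerD//.
  rewrite normrZ ger0_norm// -[leRHS]mul1r ler_pM//.
  exact: hC.
rewrite normrZ ger0_norm ?sqr_ge0// mulrC ler_wpM2r ?sqr_ge0//.
by apply: hM; rewrite s0 (le_trans st).
Qed.

End QuadraticDerivative.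

(** * Smooth dependence of trajectories on parameters *)

Section VectorEstimates.
Variables (R : realType).

Definition smooth_map (n p : nat) (U : set 'rV[R]_n) (F : 'rV[R]_n -> 'rV[R]_p) :=
  forall m i, Ck m U (fun x => F x 0 i).

(** Summing the constants over the finite index type makes them uniform; [T] consists of points in
    some uses and of pairs of points in others. *)
Lemma uniform_factor (I : finType) (T : Type) (P : T -> Prop) (f : I -> T -> R) (g : T -> R) :
  (forall t, P t -> 0 <= g t) ->
  (forall i, exists2 M, 0 <= M & forall t, P t -> f i t <= M * g t) ->
  exists2 M, 0 <= M & forall i t, P t -> f i t <= M * g t.
Proof.
move=> g0 H; exists (\sum_i sval (cid2 (H i))) => [|i t Pt].
  by apply: sumr_ge0 => i _; case: cid2.
rewrite (bigD1 i)//=; case: cid2 => M M0 h /=.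
rewrite (le_trans (h t Pt))// ler_wpM2r ?g0// lerDl.
by apply: sumr_ge0 => j _; case: cid2.
Qed.

Lemma mulmx_jacE (n p : nat) (F : 'rV[R]_n -> 'rV[R]_p) x (v : 'rV[R]_n) i :
  (v *m jac F x) 0 i = \sum_k v 0 k * pderiv k (fun z => F z 0 i) x.
Proof. by rewrite mxE; apply: eq_bigr => k _; rewrite mxE. Qed.

Lemma norm_mulmx_le (n p : nat) (v : 'rV[R]_n) (A : 'M[R]_(n, p)) (M : R) : 0 <= M ->
  (forall k i, `|A k i| <= M) -> `|v *m A| <= n%:R * M * `|v|.
Proof.
move=> M0 hA; apply/norm_leP => [|i]; first by rewrite !mulr_ge0.
rewrite mxE (le_trans (ler_norm_sum _ _ _))//.
rewrite -mulrA -[n in n%:R]card_ord mulr_natl -sumr_const ler_sum// => k _.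
by rewrite normrM mulrC ler_pM//; exact: coord_le_norm.
Qed.

Definition field_bounds (n p : nat) (F : 'rV[R]_n -> 'rV[R]_p) c r (K : R) : Prop :=
  [/\ 0 <= K,
      forall x, box c r x -> `|F x| <= K,
      forall x y, box c r x -> box c r y -> `|F y - F x| <= K * `|y - x|,
      forall x y, box c r x -> box c r y ->
        `|F y - F x - (y - x) *m jac F x| <= K * `|y - x| ^+ 2 &
      forall x y (v : 'rV[R]_n), box c r x -> box c r y ->
        `|v *m jac F x| <= K * `|v| /\
        `|v *m jac F y - v *m jac F x| <= K * `|y - x| * `|v| ].

Lemma field_boundsP (n p : nat) (U : set 'rV[R]_n) (F : 'rV[R]_n -> 'rV[R]_p) c r :
  open U -> box c r `<=` U -> smooth_map U F -> exists K, field_bounds F c r K.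
Proof.
move=> oU bU sF.
have [K1 K10 h1] : exists2 M, 0 <= M & forall (i : 'I_p) x, box c r x -> `|F x 0 i| <= M * 1.
  apply: uniform_factor => // i; have [M M0 h] := box_bounded bU (sF 0%N i).
  by exists M => // x /h; rewrite mulr1.
have [K2 K20 h2] : exists2 M, 0 <= M & forall (i : 'I_p) t, (box c r t.1 /\ box c r t.2) ->
    `|F t.2 0 i - F t.1 0 i| <= M * `|t.2 - t.1|.
  apply: uniform_factor => // i; have [M M0 h] := box_lipschitz oU bU (sF 1%N i).
  by exists M => // -[x y] [bx bY]; exact: h.
have [K3 K30 h3] : exists2 M, 0 <= M & forall (i : 'I_p) t, (box c r t.1 /\ box c r t.2) ->
    `|F t.2 0 i - F t.1 0 i - \sum_k (t.2 - t.1) 0 k * pderiv k (fun z => F z 0 i) t.1| <= M * `|t.2 - t.1| ^+ 2.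
  apply: uniform_factor => [t _|i]; first by rewrite exprn_ge0.
  have [M M0 h] := box_quadratic oU bU (sF 2%N i).
  by exists M => // -[x y] [bx bY]; exact: h.
have [K4 K40 h4] : exists2 M, 0 <= M & forall (ki : 'I_n * 'I_p) x, box c r x -> `|jac F x ki.1 ki.2| <= M * 1.
  apply: uniform_factor => // -[k i]; have [M M0 h] := box_bounded bU ((sF 1%N i).2 k).2.
  by exists M => // x /h; rewrite mulr1 mxE.
have [K5 K50 h5] : exists2 M, 0 <= M & forall (ki : 'I_n * 'I_p) t, (box c r t.1 /\ box c r t.2) ->
    `|jac F t.2 ki.1 ki.2 - jac F t.1 ki.1 ki.2| <= M * `|t.2 - t.1|.
  apply: uniform_factor => // -[k i]; have [M M0 h] := box_lipschitz oU bU ((sF 2%N i).2 k).2.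
  by exists M => // -[x y] [bx bY]; rewrite !mxE; exact: h.
pose K := K1 + K2 + K3 + n%:R * K4 + n%:R * K5.
have n4 : 0 <= n%:R * K4 by rewrite mulr_ge0.
have n5 : 0 <= n%:R * K5 by rewrite mulr_ge0.
have [k1 k2 k3] : [/\ K1 <= K, K2 <= K & K3 <= K] by rewrite /K; split; lra.
have [k4 k5] : n%:R * K4 <= K /\ n%:R * K5 <= K by rewrite /K; split; lra.
exists K; split.
- by rewrite /K; lra.
- move=> x bx; apply/norm_leP => [|i]; first exact: le_trans k1.
  by rewrite (le_trans (h1 i x bx))// mulr1.
- move=> x y bx bY; apply: (@le_trans _ _ (K2 * `|y - x|)); last by rewrite ler_wpM2r.
  apply/norm_leP => [|i]; first exact: mulr_ge0.
  by rewrite !mxE; exact: (h2 i (x, y)).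
- move=> x y bx bY; apply: (@le_trans _ _ (K3 * `|y - x| ^+ 2)); last first.
    by rewrite ler_wpM2r ?exprn_ge0.
  apply/norm_leP => [|i]; first by rewrite mulr_ge0 ?exprn_ge0.
  rewrite !mxE (_ : \sum_j _ = \sum_k (y - x) 0 k * pderiv k (fun z => F z 0 i) x).
    exact: (h3 i (x, y)).
  by apply: eq_bigr => k _; rewrite !mxE.
- move=> x y v bx bY; split.
    apply: le_trans (norm_mulmx_le v K40 _) _; last by rewrite ler_wpM2r.
    by move=> k i; have := h4 (k, i) x bx; rewrite mulr1.
  rewrite -mulmxBr; apply: le_trans (norm_mulmx_le (M := K5 * `|y - x|) v _ _) _.
  + by rewrite mulr_ge0.
  + by move=> k i; rewrite !mxE; have := h5 (k, i) (x, y) (conj bx bY); rewrite !mxE.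
  + by rewrite ler_wpM2r// mulrA ler_wpM2r.
Qed.

End VectorEstimates.

(** * Difference quotients of trajectories *)

Section Quotients.
Variables (R : realType) (n : nat).
Local Notation E := 'rV[R]_n.

(** The quotients [D h] solve the linearised equation along [x] up to an error of order [h].
    Gronwall's inequality for [D h - D k] carries the Cauchy property from time 0 to all times, so
    the limit exists; it inherits the linearised equation because the estimates hold with constants
    that do not depend on [h]. *)
Lemma limit_quotients (F : E -> E) (c r : E) (K : R) (x : R -> E)
    (X : R -> R -> E) (v0 : E) :
  field_bounds F c r K ->
  qder x (F \o x) -> (forall s, 0 <= s <= 1 -> box c r (x s)) ->
  (\forall h \near (0 : R)^', qder (X h) (F \o X h) /\
     forall s, 0 <= s <= 1 -> box c r (X h s)) ->
  h^-1 *: (X h 0 - x 0) @[h --> 0^'] --> v0 ->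
  exists2 v : R -> E, (forall s, 0 <= s <= 1 -> h^-1 *: (X h s - x s) @[h --> 0^'] --> v s) &
    qder v (fun s => v s *m jac F (x s)).
Proof.
move=> [K0 F0 FL FQ FJ] qx bx qX cv0.
pose D (h s : R) := h^-1 *: (X h s - x s).
pose w (h s : R) := h^-1 *: (F (X h s) - F (x s)).
(* Gronwall's bound for [D h]: close to 0 the initial quotient is within 1 of its limit [v0]. *)
have [B B0 BE] : exists2 B, 0 <= B & expR K * (`|v0| + 1) <= B.
  by exists (expR K * (`|v0| + 1)) => //; rewrite mulr_ge0// ?expR_ge0// addr_ge0.
pose good (h : R) := [/\ h != 0, qder (D h) (w h), (forall s, 0 <= s <= 1 -> `|w h s| <= K * `|D h s|),
  (forall s, 0 <= s <= 1 -> `|D h s| <= B) &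
  (forall s, 0 <= s <= 1 -> `|w h s - D h s *m jac F (x s)| <= K * `|h| * B ^+ 2)].
have nD0 : \forall h \near (0 : R)^', `|D h 0| <= `|v0| + 1.
  have H : \forall h \near (0 : R)^', `|v0 - D h 0| <= 1.
    exact: ((cvgrPdist_le _ _).1 cv0).
  apply: filterS H => h hh; rewrite -[D h 0](subKr v0) (le_trans (ler_normB _ _))//.
  by rewrite lerD2l.
have ngood : \forall h \near (0 : R)^', good h.
  near=> h.
  have h0 : h != 0 by near: h; exact: nbhs_dnbhs_neq.
  have [qXh bXh] : qder (X h) (F \o X h) /\ forall s, 0 <= s <= 1 -> box c r (X h s).
    by near: h.
  have qD : qder (D h) (w h).
    by apply: qderZ; apply: qderB.
  have wK s : 0 <= s <= 1 -> `|w h s| <= K * `|D h s|.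
    move=> s01; rewrite !normrZ mulrCA ler_wpM2l//.
    by apply: FL; [exact: bx|exact: bXh].
  have DB s : 0 <= s <= 1 -> `|D h s| <= B.
    move=> /andP[s0 s1].
    have := gronwall qD (lexx 0) s0 s1 K0 (lexx 0).
    rewrite mul0r addr0 subr0 => /(_ _)/le_trans; apply.
      by move=> t /andP[t0 ts]; rewrite addr0 wK// t0 (le_trans ts).
    rewrite (le_trans _ BE)// ler_pM ?expR_ge0//; last by near: h.
    by rewrite ler_expR ler_piMr.
  split=> // s s01.
  have -> : w h s - D h s *m jac F (x s) =
      h^-1 *: (F (X h s) - F (x s) - (X h s - x s) *m jac F (x s)).
    by rewrite /w /D -scalemxAl -scalerBr.
  rewrite normrZ.
  have E1 : `|X h s - x s| = `|h| * `|D h s|.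
    by rewrite /D normrZ mulrA -normrM mulfV// normr1 mul1r.
  apply: (@le_trans _ _ (`|h^-1| * (K * (`|h| * B) ^+ 2))).
    rewrite ler_wpM2l// (le_trans (FQ _ _ (bx _ s01) (bXh _ s01)))//.
    rewrite ler_wpM2l// E1 lerXn2r ?nnegrE ?mulr_ge0// ler_wpM2l//.
    exact: DB.
  rewrite normfV le_eqVlt; apply/orP; left; apply/eqP.
  have : `|h| != 0 by rewrite normr_eq0.
  by move: `|h| => a a0; field.
have JK (s : R) (u : E) : 0 <= s <= 1 -> `|u *m jac F (x s)| <= K * `|u|.
  by move=> s01; case: (FJ _ _ u (bx _ s01) (bx _ s01)).
have cauchy s : 0 <= s <= 1 -> cvg (D h s @[h --> 0^']).
  move=> /andP[s0 s1]; apply/cauchy_cvgP; apply/cauchy_exP => e e0.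
  have key h k : good h -> good k ->
      `|D h s - D k s| <= expR K * (`|D h 0 - D k 0| + K * B ^+ 2 * (`|h| + `|k|)).
    move=> [_ qh _ _ ah] [_ qk _ _ ak].
    have b0 : 0 <= K * B ^+ 2 * (`|h| + `|k|) by rewrite !mulr_ge0 ?exprn_ge0// addr_ge0.
    have := gronwall (qderB qh qk) (lexx 0) s0 s1 K0 b0.
    rewrite subr0 => /(_ _)/le_trans; apply.
      move=> t /andP[t0 ts]; have t01 : 0 <= t <= 1 by rewrite t0 (le_trans ts).
      have -> : w h t - w k t = (D h t - D k t) *m jac F (x t) +
         ((w h t - D h t *m jac F (x t)) - (w k t - D k t *m jac F (x t))).
        by rewrite mulmxBl; apply/rowP => i; rewrite !mxE; ring.
      rewrite (le_trans (ler_normD _ _))// lerD ?JK// (le_trans (ler_normB _ _))//.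
      have -> : K * B ^+ 2 * (`|h| + `|k|) = K * `|h| * B ^+ 2 + K * `|k| * B ^+ 2 by ring.
      by rewrite lerD ?ah ?ak.
    rewrite ler_pM ?expR_ge0//.
    - by rewrite addr_ge0// mulr_ge0.
    - by rewrite ler_expR ler_piMr.
    - by rewrite lerD2l ler_piMr.
  (* Both terms of [key] become at most [e'], for a total of [e / 2], strictly below [e]. *)
  pose e' := e / (expR K * 4).
  have e'0 : 0 < e' by rewrite divr_gt0// mulr_gt0// expR_gt0.
  pose e2 := e' / (K * B ^+ 2 + 1).
  have KB0 : 0 <= K * B ^+ 2 by rewrite mulr_ge0 ?exprn_ge0.
  have e20 : 0 < e2 by rewrite divr_gt0// ltr_wpDl.
  have nc : \forall h \near (0 : R)^', `|v0 - D h 0| <= e' / 2.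
    by apply: ((cvgrPdist_le _ _).1 cv0); exact: divr_gt0.
  have nh : \forall h \near (0 : R)^', `|h| <= e2 / 2.
    by apply: dnbhs0_le; exact: divr_gt0.
  have : \forall k \near (0 : R)^', (good k /\ `|v0 - D k 0| <= e' / 2) /\ `|k| <= e2 / 2.
    by apply: filterI => //; apply: filterI.
  move=> H; have [k [[gk ck] hk]] := @filter_ex _ _ (Proper_dnbhs_numFieldType (0 : R)) _ H.
  exists (D k s); suff : \forall h \near (0 : R)^', ball (D k s) e (D h s) by [].
  near=> h.
  rewrite -ball_normE /ball_ /= distrC.
  have gh : good h by near: h.
  have ch : `|v0 - D h 0| <= e' / 2 by near: h.
  have hh : `|h| <= e2 / 2 by near: h.
  apply: le_lt_trans (key h k gh gk) _.
  have H1 : `|D h 0 - D k 0| <= e'.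
    rewrite -(subrKA v0) (le_trans (ler_normD _ _))// (splitr e') lerD//.
    by rewrite distrC.
  have H2 : K * B ^+ 2 * (`|h| + `|k|) <= e'.
    apply: (@le_trans _ _ ((K * B ^+ 2 + 1) * e2)).
      by rewrite ler_pM// ?addr_ge0// ?lerDl// (splitr e2) lerD.
    by rewrite /e2 mulrC divfK// gt_eqF// ltr_wpDl.
  apply: (@le_lt_trans _ _ (expR K * (e' + e'))).
    by rewrite ler_wpM2l ?expR_ge0// lerD.
  have -> : expR K * (e' + e') = e / 2.
    have := expR_gt0 K; rewrite /e'; move: (expR K) => a a0; field.
    by rewrite gt_eqF.
  by rewrite ltr_pdivrMr// ltr_pMr// ltr1n.
pose v s := lim (D h s @[h --> 0^']).
have vD s : 0 <= s <= 1 -> D h s @[h --> 0^'] --> v s by move=> /cauchy.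
exists v => //.
exists (K * K * B + K * K * B) => [|s t s0 st t1]; first by rewrite addr_ge0// !mulr_ge0.
have s01 : 0 <= s <= 1 by rewrite s0 (le_trans st).
have t01 : 0 <= t <= 1 by rewrite t1 (le_trans s0).
have ts0 : 0 <= t - s by rewrite subr_ge0.
(* A [qder] estimate whose constant is free of [h], up to a term that vanishes with [h]. Subtracting
   the tangent line at [s] leaves a mean value bound; of the two terms [K * K * B], one bounds the
   motion of [D h] and the other that of [x] inside the Jacobian. *)
have est h : good h -> `|D h t - D h s - (t - s) *: (D h s *m jac F (x s))| <=
   (K * `|h| * B ^+ 2 + (K * K * B + K * K * B) * (t - s)) * (t - s).
  move=> [_ qh wh bh ah].
  pose z tau := D h tau - tau *: (D h s *m jac F (x s)).
  have qz : qder z (fun tau => w h tau - D h s *m jac F (x s)).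
    by apply: qderB => //; exact: qder_id.
  have -> : D h t - D h s - (t - s) *: (D h s *m jac F (x s)) = z t - z s.
    by rewrite /z; apply/rowP => i; rewrite !mxE; ring.
  apply: (qder_mean_value qz s0 st t1 _ _).
    rewrite addr_ge0//; first by rewrite !mulr_ge0// exprn_ge0.
    by rewrite mulr_ge0// addr_ge0// !mulr_ge0.
  move=> tau /andP[stau taut].
  have tau0 : 0 <= tau by exact: le_trans s0 stau.
  have tau1 : tau <= 1 by exact: le_trans taut t1.
  have tau01 : 0 <= tau <= 1 by rewrite tau0.
  have tauts : tau - s <= t - s by rewrite lerD2r.
  have -> : w h tau - D h s *m jac F (x s) = (w h tau - D h tau *m jac F (x tau)) +
     ((D h tau - D h s) *m jac F (x tau) + (D h s *m jac F (x tau) - D h s *m jac F (x s))).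
    by rewrite mulmxBl; apply/rowP => i; rewrite !mxE; ring.
  rewrite (le_trans (ler_normD _ _))// lerD ?ah// mulrDl (le_trans (ler_normD _ _))// lerD//.
    rewrite (le_trans (JK _ _ tau01))// -!mulrA ler_wpM2l//.
    apply: (@le_trans _ _ (K * B * (tau - s))); last first.
      by rewrite -mulrA; apply: ler_wpM2l => //; apply: ler_wpM2l.
    apply: (qder_mean_value qh s0 stau tau1 _ _); first exact: mulr_ge0.
    move=> a /andP[sa atau]; have a01 : 0 <= a <= 1 by rewrite (le_trans s0)// (le_trans atau).
    by rewrite (le_trans (wh a a01))// ler_wpM2l// bh.
  have [_ H] := FJ _ _ (D h s) (bx _ s01) (bx _ tau01).
  rewrite (le_trans H)// -!mulrA ler_wpM2l//.
  have H2 : `|x tau - x s| <= K * (tau - s).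
    apply: (qder_mean_value qx s0 stau tau1 _ _) => // a /andP[sa atau].
    by apply: F0; apply: bx; rewrite (le_trans s0)// (le_trans atau).
  have -> : K * (B * (t - s)) = K * (t - s) * B by ring.
  by rewrite ler_pM// ?bh// (le_trans H2)// ler_wpM2l.
set C := K * K * B + K * K * B in est *.
have C0 : 0 <= C by rewrite /C addr_ge0// !mulr_ge0.
have KB0 : 0 <= K * B ^+ 2 by rewrite mulr_ge0 ?exprn_ge0.
apply/ler_addgt0Pr => e e0.
(* Collects the coefficients of [e1] below: [K * B ^+ 2] from [est], 2 from the errors at [s] and
   [t], [K] from the Jacobian term. *)
pose M := K * B ^+ 2 + 2 + K.
have M0 : 0 < M by rewrite /M; lra.
pose e1 := e / M; have e10 : 0 < e1 by exact: divr_gt0.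
have nt : \forall h \near (0 : R)^', `|v t - D h t| <= e1.
  exact: ((cvgrPdist_le _ _).1 (vD t t01)).
have ns : \forall h \near (0 : R)^', `|v s - D h s| <= e1.
  exact: ((cvgrPdist_le _ _).1 (vD s s01)).
have nh : \forall h \near (0 : R)^', `|h| <= e1 by exact: dnbhs0_le.
have H : \forall h \near (0 : R)^', (good h /\ `|v t - D h t| <= e1) /\
    (`|v s - D h s| <= e1 /\ `|h| <= e1).
  by apply: filterI; apply: filterI.
have [h [[gh ht] [hs hh]]] := @filter_ex _ _ (Proper_dnbhs_numFieldType (0 : R)) _ H.
have -> : v t - v s - (t - s) *: (v s *m jac F (x s)) =
   (D h t - D h s - (t - s) *: (D h s *m jac F (x s))) +
   ((v t - D h t) - (v s - D h s) - (t - s) *: ((v s - D h s) *m jac F (x s))).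
  by rewrite mulmxBl; apply/rowP => i; rewrite !mxE; ring.
rewrite (le_trans (ler_normD _ _))//.
have ts1 : t - s <= 1 by lra.
have H1 := est h gh.
have H2 : `|(v t - D h t) - (v s - D h s) - (t - s) *: ((v s - D h s) *m jac F (x s))| <=
    e1 + e1 + K * e1.
  rewrite (le_trans (ler_normB _ _))// lerD//; first by rewrite (le_trans (ler_normB _ _))// lerD.
  rewrite normrZ ger0_norm// -[leRHS]mul1r ler_pM// (le_trans (JK _ _ s01))//.
  exact: ler_wpM2l.
have H3 : (K * `|h| * B ^+ 2 + C * (t - s)) * (t - s) <= K * B ^+ 2 * e1 + C * (t - s) ^+ 2.
  rewrite mulrDl expr2 -(mulrA C) lerD2r.
  apply: (@le_trans _ _ (K * `|h| * B ^+ 2)).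
    by rewrite ler_piMr// !mulr_ge0 ?exprn_ge0.
  by rewrite mulrAC ler_wpM2l.
have H4 : M * e1 = e by rewrite /e1 mulrC divfK// gt_eqF.
rewrite -H4 /M.
have := lerD (le_trans H1 H3) H2.
by move/le_trans; apply; rewrite le_eqVlt; apply/orP; left; apply/eqP; ring.
Unshelve. all: by end_near. Qed.

End Quotients.

(** * Families of trajectories and their derivatives in the parameter *)

Section Families.
Variables (R : realType).

Lemma qder_ext (n : nat) (y w y' w' : R -> 'rV[R]_n) :
  (forall s, 0 <= s <= 1 -> y s = y' s) -> (forall s, 0 <= s <= 1 -> w s = w' s) ->
  qder y w -> qder y' w'.
Proof.
move=> yE wE [C C0 hC]; exists C => // s t s0 st t1.
have s01 : 0 <= s <= 1 by rewrite s0 (le_trans st).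
have t01 : 0 <= t <= 1 by rewrite t1 (le_trans s0).
by rewrite -!yE// -wE// hC.
Qed.

(** The field does not depend on [u]: a parameter of the equation becomes part of the state, with
    velocity zero, as in [controlled_field]. The common box makes all constants uniform in [u]. *)
Definition solution_family (n d : nat) (Om : set 'rV[R]_n) (c r : 'rV[R]_n)
    (F : 'rV[R]_n -> 'rV[R]_n) (O : set 'rV[R]_d) (x : R -> 'rV[R]_d -> 'rV[R]_n) : Prop :=
  [/\ open Om /\ box c r `<=` Om, smooth_map Om F,
      open O /\ smooth_map O (x 0),
      forall s u, 0 <= s <= 1 -> O u -> box c r (x s u) &
      forall u, O u -> qder (x^~ u) (F \o x^~ u)].

Section OneFamily.
Variables (n d : nat) (Om : set 'rV[R]_n) (c r : 'rV[R]_n).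
Variables (F : 'rV[R]_n -> 'rV[R]_n) (O : set 'rV[R]_d) (x : R -> 'rV[R]_d -> 'rV[R]_n).
Hypothesis xF : solution_family Om c r F O x.

Lemma family_lipschitz : exists2 K, 0 <= K & forall s u u', 0 <= s <= 1 -> O u -> O u' ->
  `|x s u' - x s u| <= K * `|x 0 u' - x 0 u|.
Proof.
have [[oOm bOm] sF _ bx qx] := xF.
have [K [K0 _ FL _ _]] := field_boundsP oOm bOm sF.
exists (expR K) => [|s u u' /andP[s0 s1] Ou Ou']; first exact: expR_ge0.
have := gronwall (qderB (qx _ Ou') (qx _ Ou)) (lexx 0) s0 s1 K0 (lexx 0).
rewrite mul0r addr0 subr0 => /(_ _)/le_trans; apply.
  move=> t /andP[t0 ts]; rewrite addr0.
  have t01 : 0 <= t <= 1 by rewrite t0 (le_trans ts).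
  by apply: FL; apply: bx.
by rewrite ler_wpM2r// ler_expR ler_piMr.
Qed.

Lemma family_continuous s u i : 0 <= s <= 1 -> O u ->
  {for u, continuous (fun u => x s u 0 i)}.
Proof.
move=> s01 Ou; have [_ _ [oO s0] _ _] := xF.
have [K K0 hK] := family_lipschitz.
have c0 : {for u, continuous (x 0)}.
  by apply: continuous_row => j; exact: Ck_continuous (s0 0%N j) Ou.
apply/(@cvgrPdist_le _ _ _ (nbhs u)) => e e0.
have e1 : 0 < e / (K + 1) by rewrite divr_gt0// ltr_wpDl.
have H : \forall u' \near u, `|x 0 u - x 0 u'| <= e / (K + 1).
  exact: ((cvgrPdist_le _ _).1 c0).
have HO : \forall u' \near u, O u' by apply: open_nbhs_nbhs.
apply: filterS (filterI H HO) => u' [hu Ou'].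
apply: (@le_trans _ _ `|x s u - x s u'|).
  by have := coord_le_norm (x s u - x s u') i; rewrite !mxE.
rewrite (le_trans (hK s u' u s01 Ou' Ou))//.
apply: (@le_trans _ _ ((K + 1) * (e / (K + 1)))); first by rewrite ler_pM// lerDl.
by rewrite mulrC divfK// gt_eqF// ltr_wpDl.
Qed.

Lemma family_derivable u (j : 'I_d) : O u ->
  (forall s i, 0 <= s <= 1 -> derivable (fun u => x s u 0 i) u 'e_j) /\
  qder (fun s => row j (jac (x s) u)) (fun s => row j (jac (x s) u) *m jac F (x s u)).
Proof.
move=> Ou; have [[oOm bOm] sF [oO sx0] bx qx] := xF.
have [K FK] := field_boundsP oOm bOm sF.
pose X (h s : R) := x s (h *: 'e_j + u).
have nearO : \forall h \near (0 : R)^', O (h *: 'e_j + u).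
  have cont : (h *: 'e_j + u : 'rV[R]_d) @[h --> (0 : R)] --> (0 : R) *: ('e_j : 'rV[R]_d) + u.
    by apply: cvgD; [apply: cvgZr_tmp; exact: cvg_id|exact: cvg_cst].
  rewrite scale0r add0r in cont.
  apply: nbhs_dnbhs; apply: cont; exact: open_nbhs_nbhs.
have H1 : \forall h \near (0 : R)^', qder (X h) (F \o X h) /\
    forall s, 0 <= s <= 1 -> box c r (X h s).
  by apply: filterS nearO => h Oh; split=> [|s s01]; [exact: qx|exact: bx].
have d0 : derivable (x 0) u 'e_j.
  by apply/derivable_mxP => k i; rewrite ord1; exact: ((sx0 1%N i).2 j).1.
have H2 : h^-1 *: (X h 0 - x 0 u) @[h --> (0 : R)^'] --> 'D_'e_j (x 0) u by exact: d0.
have H3 s : 0 <= s <= 1 -> box c r (x s u) by move=> s01; exact: bx.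
have [v vl qv] := limit_quotients FK (qx u Ou) H3 H1 H2.
have dx s : 0 <= s <= 1 -> derivable (x s) u 'e_j.
  by move=> /vl cv; apply/cvg_ex; exists (v s).
have dE s : 0 <= s <= 1 -> v s = row j (jac (x s) u).
  move=> s01; have <- : 'D_'e_j (x s) u = v s by apply/cvg_lim => //; exact: vl.
  by rewrite derive_mx; [apply/rowP => i; rewrite !mxE|exact: dx].
split=> [s i s01|]; first by have /derivable_mxP := dx s s01; exact.
by apply: qder_ext qv => s s01; rewrite -dE.
Qed.

(** Gronwall's inequality for the variational equation. It yields the radius of the box in which the
    derivatives move once they are adjoined to the state. *)
Lemma family_derivative_bound : exists2 K, 0 <= K & forall s u j, 0 <= s <= 1 -> O u ->
  `|row j (jac (x s) u)| <= K * `|row j (jac (x 0) u)|.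
Proof.
have [[oOm bOm] sF _ bx _] := xF.
have [K [K0 _ _ _ FJ]] := field_boundsP oOm bOm sF.
exists (expR K) => [|s u j /andP[s0 s1] Ou]; first exact: expR_ge0.
have [_ qD] := family_derivable j Ou.
have := gronwall qD (lexx 0) s0 s1 K0 (lexx 0).
rewrite mul0r addr0 subr0 => /(_ _)/le_trans; apply.
  move=> t /andP[t0 ts]; rewrite addr0.
  have t01 : 0 <= t <= 1 by rewrite t0 (le_trans ts).
  by case: (FJ _ _ (row j (jac (x t) u)) (bx _ _ t01 Ou) (bx _ _ t01 Ou)).
by rewrite ler_wpM2r// ler_expR ler_piMr.
Qed.

End OneFamily.

(** The complete lift of [F] to the tangent bundle: the tangent vector in the second half evolves by
    the linearised equation. *)
Definition tangent_field (n : nat) (F : 'rV[R]_n -> 'rV[R]_n) (z : 'rV[R]_(n + n)) : 'rV[R]_(n + n) :=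
  row_mx (F (lsubmx z)) (rsubmx z *m jac F (lsubmx z)).

Lemma open_lsubmx (n p : nat) (U : set 'rV[R]_n) : open U ->
  open [set z : 'rV[R]_(n + p) | U (lsubmx z)].
Proof.
move=> oU; apply: (@open_comp _ _ (lsubmx : 'rV[R]_(n + p) -> 'rV[R]_n)) => // z _.
by apply: differentiable_continuous; exact: differentiable_lsubmx.
Qed.

Lemma smooth_lsubmx (n p : nat) (U : set 'rV[R]_n) (f : 'rV[R]_n -> R) m : open U -> Ck m U f ->
  Ck m [set z : 'rV[R]_(n + p) | U (lsubmx z)] (fun z => f (lsubmx z)).
Proof.
move=> oU Cf; apply: (Ck_comp (open_lsubmx oU) oU (F := @lsubmx R 1 n p)) => // i.
apply: eq_Ck (Ck_coord m _ (lshift p i)); first exact: open_lsubmx.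
by move=> z _; rewrite mxE.
Qed.

Lemma smooth_tangent_field (n : nat) (U : set 'rV[R]_n) (F : 'rV[R]_n -> 'rV[R]_n) :
  open U -> smooth_map U F ->
  smooth_map [set z : 'rV[R]_(n + n) | U (lsubmx z)] (tangent_field F).
Proof.
move=> oU sF m i; have oU' := @open_lsubmx n n U oU.
rewrite /tangent_field; case: (split_ordP i) => k ->.
  apply: eq_Ck (smooth_lsubmx n oU (sF m k)) => // z _.
  by rewrite row_mxEl.
have : Ck m [set z : 'rV[R]_(n + n) | U (lsubmx z)]
    (fun z => \sum_l z 0 (rshift n l) * pderiv l (fun y => F y 0 k) (lsubmx z)).
  apply: Ck_sum => // l _; apply: CkM => //; first exact: Ck_coord.
  by apply: smooth_lsubmx => //; exact: ((sF m.+1 k).2 l).2.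
apply: eq_Ck => // z _.
by rewrite row_mxEr mulmx_jacE; apply: eq_bigr => l _; rewrite mxE.
Qed.

Lemma norm_row_mx (n p : nat) (a : 'rV[R]_n) (b : 'rV[R]_p) (M : R) : 0 <= M ->
  `|a| <= M -> `|b| <= M -> `|row_mx a b| <= M.
Proof.
move=> M0 aM bM; apply/norm_leP => // i.
case: (split_ordP i) => k ->; first by rewrite row_mxEl (le_trans (coord_le_norm _ _)).
by rewrite row_mxEr (le_trans (coord_le_norm _ _)).
Qed.

Lemma qder_row_mx (n p : nat) (y1 w1 : R -> 'rV[R]_n) (y2 w2 : R -> 'rV[R]_p) :
  qder y1 w1 -> qder y2 w2 ->
  qder (fun s => row_mx (y1 s) (y2 s)) (fun s => row_mx (w1 s) (w2 s)).
Proof.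
move=> [C C0 hC] [D D0 hD]; exists (C + D) => [|s t s0 st t1]; first exact: addr_ge0.
rewrite scale_row_mx !opp_row_mx !add_row_mx.
apply: norm_row_mx; first by rewrite mulr_ge0 ?addr_ge0 ?sqr_ge0.
  by rewrite (le_trans (hC s t s0 st t1))// ler_wpM2r ?sqr_ge0// lerDl.
by rewrite (le_trans (hD s t s0 st t1))// ler_wpM2r ?sqr_ge0// lerDr.
Qed.

(* Differentiating in a parameter turns a family of trajectories of [F] into a
   family of trajectories of its tangent field, so that each order of
   smoothness reduces to the previous one. *)
Theorem solution_family_smooth (n d : nat) Om c r F O (x : R -> 'rV[R]_d -> 'rV[R]_n) s :
  solution_family Om c r F O x -> 0 <= s <= 1 -> smooth_map O (x s).
Proof.
move=> xF s01 m; elim: m n Om c r F O x xF => [|m IH] n Om c r F O x xF i.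
  by split=> // u Ou; exact: (family_continuous xF).
have [[oOm bOm] sF [oO sx0] bx qx] := xF.
split=> [u Ou|j]; first exact: (family_continuous xF).
split=> [u Ou|]; first by have [+ _] := family_derivable xF j Ou; exact.
(* The enlarged family needs a box for the derivatives, but at time 0 these are bounded only near
   each [u]; hence the restriction to a ball around [u]. *)
apply: Ck_local => u Ou.
have [K K0 hK] := family_derivative_bound xF.
pose B := K * (`|row j (jac (x 0) u)| + 1).
have c0 : {for u, continuous (fun u => row j (jac (x 0) u))}.
  apply: continuous_row => k.
  have cc : {for u, continuous (pderiv j (fun u => x 0 u 0 k))}.
    exact: ((sx0 1%N k).2 j).2.1 u Ou.
  apply: (@eq_on_continuous _ _ O _ _ _ oO Ou _ cc) => u' _.
  by rewrite !mxE.
have nB : \forall u' \near u, O u' /\ `|row j (jac (x 0) u')| <= `|row j (jac (x 0) u)| + 1.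
  have H : \forall u' \near u, `|row j (jac (x 0) u) - row j (jac (x 0) u')| <= 1.
    exact: ((cvgrPdist_le _ _).1 c0).
  have HO : \forall u' \near u, O u' by apply: open_nbhs_nbhs.
  apply: filterS (filterI H HO) => u' [h Ou']; split=> //.
  rewrite -[row j (jac (x 0) u')](subKr (row j (jac (x 0) u))).
  by rewrite (le_trans (ler_normB _ _))// lerD2l.
have [e /= e0 he] := (nbhs_ballP _ _).1 nB.
pose O' := ball u e.
have oO' : open O' by exact: ball_open.
have O'u : O' u by exact: ballxx.
have O'O u' : O' u' -> O u' by move=> /he[].
exists O'; split=> //.
pose X t u := row_mx (x t u) (row j (jac (x t) u)).
have XF : solution_family [set z : 'rV[R]_(n + n) | Om (lsubmx z)] (row_mx c 0)
    (row_mx r (const_mx B)) (tangent_field F) O' X.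
  split.
  - split=> [|z bz]; first exact: open_lsubmx.
    apply: bOm => k; have := bz (lshift n k).
    by rewrite !row_mxEl mxE.
  - exact: smooth_tangent_field.
  - split=> // l k; rewrite /X; case: (split_ordP k) => k' ->.
      apply: eq_Ck (Ck_subset O'O (sx0 l k')) => // v _.
      by rewrite row_mxEl.
    apply: eq_Ck (Ck_subset O'O ((sx0 l.+1 k').2 j).2) => // v _.
    by rewrite row_mxEr !mxE.
  - move=> t v t01 O'v k; case: (split_ordP k) => k' ->.
      by rewrite !row_mxEl; apply: bx => //; exact: O'O.
    rewrite /X !row_mxEr [(0 : 'rV_n) 0 _]mxE [const_mx _ _ _]mxE subr0.
    rewrite (le_trans (coord_le_norm _ _))// (le_trans (hK _ _ _ t01 (O'O _ O'v)))//.
    by rewrite ler_wpM2l//; have [] := he _ O'v.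
  - move=> v O'v; have [_ q2] := family_derivable xF j (O'O _ O'v).
    apply: qder_ext (qder_row_mx (qx _ (O'O _ O'v)) q2) => // t t01.
    by rewrite /tangent_field /X /= row_mxKl row_mxKr.
have := IH _ _ _ _ _ _ _ XF (rshift n i).
apply: eq_Ck => // v _.
by rewrite /X row_mxEr !mxE.
Qed.

End Families.

(** * Existence of trajectories *)

Section Picard.
Variables (R : realType).

Let mu := @lebesgue_measure R.

(** Integration starts at -1 so that all of [0, 1] lies inside the interval and the fundamental
    theorem gives two-sided derivatives at 0 and 1 as well. *)
Definition primitive (f : R -> R) (t : R) : R :=
  (\int[mu]_(x in `[-1, t]) f x - \int[mu]_(x in `[-1, 0]) f x)%R.

Lemma primitive0 f : primitive f 0 = 0.
Proof. by rewrite /primitive subrr. Qed.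

Lemma is_derive_primitive (f : R -> R) (t : R) : continuous f -> t \in `]-1, 2[ ->
  is_derive t 1 (primitive f) (f t).
Proof.
move=> cf; rewrite in_itv/= => /andP[t1 t2].
have fi : mu.-integrable `[-1, 2] (EFin \o f).
  apply: continuous_compact_integrable; first exact: segment_compact.
  exact: continuous_subspaceT.
have [d e] := @continuous_FTC1 R f (BLeft (-1)) t 2 t2 fi (ltac:(by rewrite lte_fin)) (cf t).
have H : is_derive t 1 (fun t => \int[mu]_(x in `[-1, t]) f x)%R (f t).
  by split; [exact: d|rewrite -derive1E; exact: e].
rewrite -[f t]subr0; exact: is_deriveB.
Qed.

(** The 1-Lipschitz retraction onto [a, b]. It extends data from [0, 1] to all times and,
    coordinatewise, from a box to the whole space. *)
Definition clamp (a b s : R) : R := Num.max a (Num.min b s).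

Lemma clamp_in a b s : a <= b -> a <= clamp a b s <= b.
Proof. by move=> ab; rewrite /clamp le_max lexx/= ge_max ab ge_min lexx. Qed.

Lemma clamp_id a b s : a <= s <= b -> clamp a b s = s.
Proof. by move=> /andP[as_ sb]; rewrite /clamp (min_idPr sb) (max_idPr as_). Qed.

Lemma clamp_lipschitz a b s t : `|clamp a b s - clamp a b t| <= `|s - t|.
Proof.
have E u : clamp a b u = if a <= b then (if u <= a then a else if u <= b then u else b) else a.
  rewrite /clamp; case: (leP b u) => bu; case: leP => //; case: (leP a b) => ab;
    do ?case: (leP u a) => ua; do ?case: (leP u b) => ub //; lra.
rewrite !E; case: (leP a b) => ab; last by rewrite subrr normr0.
have [h|h] := leP 0 (s - t).
  rewrite (ger0_norm h) ler_norml; apply/andP.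
  by case: (leP s a); case: (leP t a); case: (leP s b); case: (leP t b); split; lra.
rewrite (ltr0_norm h) ler_norml; apply/andP.
by case: (leP s a); case: (leP t a); case: (leP s b); case: (leP t b); split; lra.
Qed.

Lemma clamp_continuous a b : continuous (clamp a b).
Proof.
move=> s; apply/cvgrPdist_le => e e0; near=> t.
apply: le_trans (clamp_lipschitz _ _ _ _) _.
by near: t; apply: (cvgrPdist_le _ _).1 => //; exact: cvg_id.
Unshelve. all: by end_near. Qed.

Variable n : nat.
Local Notation E := 'rV[R]_n.
Variables (G : E -> E) (x0 : E) (M : R).
Hypothesis (GM : forall y, `|G y| <= M).
Hypothesis (GL : forall y z, `|G y - G z| <= 2^-1 * `|y - z|).

(** Freezing the time outside [0, 1] keeps the iterates continuous on the whole line. With Lipschitz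
    constant 1/2 and time at most 1 a step halves distances, so the time interval is never
    shortened. *)
Definition picard_step (y : R -> E) (s : R) : E :=
  \row_i (x0 0 i + primitive (fun t => G (y t) 0 i) (clamp 0 1 s)).

Let G_continuous : continuous G.
Proof.
move=> y; apply/(@cvgrPdist_le _ _ _ (nbhs y)) => e e0.
have H : \forall z \near y, `|y - z| <= e.
  exact: ((@cvgrPdist_le _ _ _ (nbhs y) _ id y).1 cvg_id).
apply: filterS H => z h; rewrite (le_trans (GL _ _))// -[leRHS]mul1r ler_pM//.
by rewrite invf_le1// ler1n.
Qed.

Let coord_G_continuous (y : R -> E) i : continuous y -> continuous (fun t => G (y t) 0 i).
Proof.
move=> cy t; apply: (@continuous_comp _ _ _ (fun t => G (y t)) (fun v : E => v 0 i)).
  by apply: continuous_comp; [exact: cy|exact: G_continuous].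
exact: coord_continuous.
Qed.

Let primitive_G (y : R -> E) i (t : R) : continuous y -> 0 <= t <= 1 ->
  is_derive t 1 (primitive (fun t => G (y t) 0 i)) (G (y t) 0 i).
Proof.
move=> cy /andP[t0 t1].
apply: (@is_derive_primitive (fun t => G (y t) 0 i)); first exact: coord_G_continuous.
by rewrite in_itv/=; apply/andP; split; lra.
Qed.

Let picard_step_continuous (y : R -> E) : continuous y -> continuous (picard_step y).
Proof.
move=> cy s; apply: continuous_row => i.
have cs := @clamp_in 0 1 s ler01.
have c1 : {for clamp 0 1 s, continuous (primitive (fun t => G (y t) 0 i))}.
  have [d _] := primitive_G i cy cs.
  by apply: differentiable_continuous; apply/derivable1_diffP.
have c2 := continuous_comp (@clamp_continuous 0 1 s) c1.
have c3 := continuousD (@cst_continuous _ _ (x0 0 i) s) c2.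
by rewrite (_ : (fun z => picard_step y z 0 i) = (fun z => x0 0 i + (primitive (fun t => G (y t) 0 i) \o clamp 0 1) z)) //;
  apply/funext => z; rewrite mxE.
Qed.

Let picard_step_increment (y : R -> E) i s t : continuous y -> 0 <= s -> s <= t -> t <= 1 ->
  exists2 c, s <= c <= t & (picard_step y t - picard_step y s) 0 i = G (y c) 0 i * (t - s).
Proof.
move=> cy s0 st t1.
have s01 : 0 <= s <= 1 by rewrite s0 (le_trans st).
have t01 : 0 <= t <= 1 by rewrite t1 (le_trans s0).
rewrite !mxE !clamp_id//.
have D (c : R) : c \in `[s, t] -> is_derive c 1 (primitive (fun t => G (y t) 0 i)) (G (y c) 0 i).
  rewrite in_itv/= => /andP[sc ct]; apply: primitive_G => //.
  by rewrite (le_trans s0)// (le_trans ct).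
have D' (c : R) : c \in `]s, t[ -> is_derive c 1 (primitive (fun t => G (y t) 0 i)) (G (y c) 0 i).
  by move=> /subset_itv_oo_cc /D.
have cc : {within `[s, t], continuous (primitive (fun t => G (y t) 0 i))}.
  by apply: derivable_within_continuous => c /D[].
have [c cst E] := MVT_segment st D' cc.
exists c; first by move: cst; rewrite in_itv.
by rewrite -E; ring.
Qed.

Let picard_step_contraction (y z : R -> E) b : continuous y -> continuous z -> 0 <= b ->
  (forall t, 0 <= t <= 1 -> `|y t - z t| <= b) ->
  forall t, 0 <= t <= 1 -> `|picard_step y t - picard_step z t| <= 2^-1 * b.
Proof.
move=> cy cz b0 yz t /andP[t0 t1].
have b20 : 0 <= 2^-1 * b by rewrite mulr_ge0.
apply/norm_leP => // i; rewrite !mxE opprD addrACA subrr add0r clamp_id ?t0//.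
pose P s := primitive (fun t => G (y t) 0 i) s - primitive (fun t => G (z t) 0 i) s.
have D (c : R) : c \in `[0, t] -> is_derive c 1 P (G (y c) 0 i - G (z c) 0 i).
  rewrite in_itv/= => /andP[sc ct].
  have c01 : 0 <= c <= 1 by rewrite sc (le_trans ct).
  have d1 := primitive_G i cy c01.
  have d2 := primitive_G i cz c01.
  exact: is_deriveB.
have D' (c : R) : c \in `]0, t[ -> is_derive c 1 P (G (y c) 0 i - G (z c) 0 i).
  by move=> /subset_itv_oo_cc /D.
have cc : {within `[0, t], continuous P}.
  by apply: derivable_within_continuous => c /D[].
have [c cst EE] := MVT_segment t0 D' cc.
have -> : primitive (fun t => G (y t) 0 i) t - primitive (fun t => G (z t) 0 i) t = P t - P 0.
  by rewrite /P !primitive0 subrr subr0.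
rewrite EE subr0 normrM (ger0_norm t0).
move: cst; rewrite in_itv/= => /andP[c0 ct].
have c01 : 0 <= c <= 1 by rewrite c0 (le_trans ct).
rewrite -[leRHS]mulr1 ler_pM//.
have := coord_le_norm (G (y c) - G (z c)) i; rewrite !mxE => /le_trans; apply.
by rewrite (le_trans (GL _ _))// ler_wpM2l// yz.
Qed.

Let X k := iter k picard_step (fun=> x0).

Let X_continuous k : continuous (X k).
Proof.
elim: k => [|k IH]; first exact: cst_continuous.
exact: picard_step_continuous.
Qed.

Let M0 : 0 <= M. Proof. exact: le_trans (GM 0). Qed.

Let X_start k : X k 0 = x0.
Proof.
case: k => // k; apply/rowP => i; rewrite /= mxE clamp_id ?lexx ?ler01//.
by rewrite primitive0 addr0.
Qed.

Let X_lipschitz k s t : 0 <= s -> s <= t -> t <= 1 -> `|X k t - X k s| <= M * (t - s).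
Proof.
move=> s0 st t1; have ts0 : 0 <= t - s by rewrite subr_ge0.
case: k => [|k]; first by rewrite subrr normr0 mulr_ge0.
apply/norm_leP => [|i]; first exact: mulr_ge0.
have [c _ ->] := picard_step_increment i (@X_continuous k) s0 st t1.
rewrite normrM (ger0_norm ts0) ler_wpM2r//.
by rewrite (le_trans (coord_le_norm _ _)).
Qed.

Let X_step k t : 0 <= t <= 1 -> `|X k.+1 t - X k t| <= (2^-1) ^+ k * M.
Proof.
elim: k t => [|k IH] t t01.
  rewrite expr0 mul1r; case/andP: t01 => t0 t1.
  rewrite -[X 0 t](X_start 1) (le_trans (X_lipschitz _ _ _ _))// subr0.
  by rewrite ler_piMr.
rewrite exprS -mulrA.
apply: (picard_step_contraction (@X_continuous k.+1) (@X_continuous k) _ IH) => //.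
by rewrite mulr_ge0// exprn_ge0.
Qed.

(** [X_step] summed: [2 (1 - 2^-j)] is the geometric sum [1 + 1/2 + ... + 2^-(j-1)], kept exact so
    that the induction closes. *)
Let X_far k j t : 0 <= t <= 1 -> `|X (k + j) t - X k t| <= (2^-1) ^+ k * M * 2 * (1 - (2^-1) ^+ j).
Proof.
move=> t01; elim: j => [|j IH].
  by rewrite addn0 subrr normr0 expr0 subrr mulr0.
rewrite addnS -(subrKA (X (k + j) t)) (le_trans (ler_normD _ _))//.
apply: le_trans (lerD (X_step _ t01) IH) _.
rewrite exprD exprS le_eqVlt; apply/orP; left; apply/eqP.
by field.
Qed.

Theorem picard : exists2 x : R -> E, x 0 = x0 & qder x (G \o x).
Proof.
have half0 k : 0 <= (2^-1 : R) ^+ k by rewrite exprn_ge0.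
have halfn k : (2^-1 : R) ^+ k <= k.+1%:R^-1.
  rewrite exprVn lef_pV2 ?posrE ?exprn_gt0//.
  by rewrite -natrX ler_nat ltn_expl.
have far k l t : 0 <= t <= 1 -> (k <= l)%N -> `|X l t - X k t| <= M * 2 / k.+1%:R.
  move=> t01 kl; have := X_far k (l - k) t01; rewrite subnKC// => /le_trans; apply.
  apply: (@le_trans _ _ ((2^-1) ^+ k * (M * 2))).
    by rewrite -mulrA -mulrA ler_wpM2l// mulrA ler_piMr ?mulr_ge0// gerBl.
  by rewrite mulrC ler_wpM2l ?mulr_ge0.
have cvgX t : 0 <= t <= 1 -> cvg (X k t @[k --> \oo]).
  move=> t01; apply/cauchy_cvgP; apply/cauchy_exP => e e0.
  have [N hN] : exists N : nat, M * 2 / N.+1%:R < e.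
    exists (Num.truncn (M * 2 / e)); rewrite ltr_pdivrMr// (mulrC e) -ltr_pdivrMr//.
    exact: truncnS_gt.
  exists (X N t); suff : \forall k \near \oo, ball (X N t) e (X k t) by [].
  exists N => // k /= Nk; rewrite -ball_normE /ball_/= distrC.
  exact: le_lt_trans (far _ _ _ t01 Nk) hN.
pose x t := lim (X k t @[k --> \oo]).
have xfar k t : 0 <= t <= 1 -> `|x t - X k t| <= M * 2 / k.+1%:R.
  move=> t01; have cn : `|X l t - X k t| @[l --> \oo] --> `|x t - X k t|.
    by apply: cvg_norm; apply: cvgB; [exact: cvgX|exact: cvg_cst].
  apply: (closed_cvg (fun r : R => r <= M * 2 / k.+1%:R) _ _ _ cn); first exact: closed_le.
  by exists k => // l /= kl; exact: far.
exists x.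
  rewrite /x (_ : (fun k => X k 0) = fun=> x0); last by apply/funext => k; rewrite X_start.
  by apply/cvg_lim => //; exact: cvg_cst.
(* For the iterates the constant [M] works because they are [M]-Lipschitz and [G] contracts. Passing
   to the limit costs three errors of size at most [2 M / (k + 1)], which fit under the
   [8 M / (k + 1)] chosen below. *)
exists M => // s t s0 st t1.
have ts0 : 0 <= t - s by rewrite subr_ge0.
have s01 : 0 <= s <= 1 by rewrite s0 (le_trans st).
have t01 : 0 <= t <= 1 by rewrite t1 (le_trans s0).
apply: (@ler_of_inv_nat _ _ _ (M * 8)) => k.
have h1 : `|X k.+1 t - X k.+1 s - (t - s) *: G (X k s)| <= M * (t - s) ^+ 2.
  apply/norm_leP => [|i]; first by rewrite mulr_ge0// sqr_ge0.
  have [c /andP[sc ct] E1] := picard_step_increment i (@X_continuous k) s0 st t1.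
  have -> : (X k.+1 t - X k.+1 s - (t - s) *: G (X k s)) 0 i =
      (picard_step (X k) t - picard_step (X k) s) 0 i - (t - s) * G (X k s) 0 i.
    by rewrite [LHS]mxE; congr (_ + _); rewrite !mxE.
  rewrite E1 mulrC -mulrBr normrM (ger0_norm ts0) mulrC expr2 mulrA.
  rewrite ler_wpM2r//.
  have := coord_le_norm (G (X k c) - G (X k s)) i; rewrite !mxE => /le_trans; apply.
  rewrite (le_trans (GL _ _))//.
  apply: (@le_trans _ _ (`|X k c - X k s|)).
    by rewrite ler_piMl// invf_le1// ler1n.
  rewrite (le_trans (X_lipschitz _ s0 sc (le_trans ct t1)))// ler_wpM2l//.
  by rewrite lerD2r.
have -> : x t - x s - (t - s) *: (G \o x) s =
   (X k.+1 t - X k.+1 s - (t - s) *: G (X k s)) +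
   ((x t - X k.+1 t) - (x s - X k.+1 s) - (t - s) *: (G (x s) - G (X k s))).
  by apply/rowP => i; rewrite !mxE /=; ring.
rewrite (le_trans (ler_normD _ _))// lerD//.
have e1 : M * 2 / k.+2%:R <= M * 2 / k.+1%:R.
  by rewrite ler_wpM2l ?mulr_ge0// lef_pV2 ?posrE// ler_nat.
have e3 : `|(t - s) *: (G (x s) - G (X k s))| <= M * 2 / k.+1%:R.
  rewrite normrZ (ger0_norm ts0).
  apply: (@le_trans _ _ (`|G (x s) - G (X k s)|)); first by rewrite ler_piMl//; lra.
  rewrite (le_trans (GL _ _))// (le_trans _ (xfar k s s01))//.
  by rewrite ler_piMl// invf_le1// ler1n.
have -> : M * 8 / k.+1%:R = M * 2 / k.+1%:R + M * 2 / k.+1%:R + M * 2 / k.+1%:R + M * 2 / k.+1%:R by ring.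
rewrite (le_trans (ler_normB _ _))//.
have e4 := le_trans (xfar k.+1 t t01) e1.
have e5 := le_trans (xfar k.+1 s s01) e1.
have e6 := ler_normB (x t - X k.+1 t) (x s - X k.+1 s).
apply: le_trans (lerD (le_trans e6 (lerD e4 e5)) e3) _.
by rewrite lerDl !mulr_ge0// invr_ge0.
Qed.

End Picard.

(** * Controlled flows *)

Section Flow.
Variables (R : realType).

Lemma pderiv_lshift (n p : nat) (f : 'rV[R]_(n + p) -> R) y u k :
  pderiv (lshift p k) f (row_mx y u) = pderiv k (fun y => f (row_mx y u)) y.
Proof.
rewrite /pderiv /derive.
set F := (X in X @ _); set G := (X in _ = lim (X @ _)).
suff -> : F = G by []; rewrite /F /G; apply/funext => h /=.
have -> : h *: delta_mx 0 (lshift p k) + row_mx y u = row_mx (h *: delta_mx 0 k + y) u.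
  apply/rowP => i; case: (split_ordP i) => j ->; rewrite [LHS]mxE ?row_mxEl ?row_mxEr.
    by rewrite !mxE eqxx/= (inj_eq (@lshift_inj _ _)).
  by rewrite !mxE eq_rlshift andbF mulr0 add0r.
by [].
Qed.

Lemma pderiv_rshift (n p : nat) (f : 'rV[R]_(n + p) -> R) y u k :
  pderiv (rshift n k) f (row_mx y u) = pderiv k (fun u => f (row_mx y u)) u.
Proof.
rewrite /pderiv /derive.
set F := (X in X @ _); set G := (X in _ = lim (X @ _)).
suff -> : F = G by []; rewrite /F /G; apply/funext => h /=.
have -> : h *: delta_mx 0 (rshift n k) + row_mx y u = row_mx y (h *: delta_mx 0 k + u).
  apply/rowP => i; case: (split_ordP i) => j ->; rewrite [LHS]mxE ?row_mxEl ?row_mxEr.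
    by rewrite !mxE eq_lrshift andbF mulr0 add0r.
  by rewrite !mxE eqxx/= (inj_eq (@rshift_inj _ _)).
by [].
Qed.

Lemma pderiv_mulmx (n p : nat) (A : 'M[R]_(n, p)) k i u :
  pderiv k (fun u : 'rV[R]_n => (u *m A) 0 i) u = A k i.
Proof.
rewrite /pderiv /derive; apply/lim_near_cst => //; near=> h.
rewrite /= mulmxDl -scalemxAl -rowE [X in X - _]mxE addrK !mxE.
rewrite [_ *: _]mulrA mulVf ?mul1r//.
by near: h; exact: nbhs_dnbhs_neq.
Unshelve. all: by end_near. Qed.

Lemma pderiv_cst (n : nat) (c : R) k (x : 'rV[R]_n) : pderiv k (fun=> c) x = 0.
Proof. exact: derive_cst. Qed.

Section ControlledField.
Variables (n : nat) (Z : 'rV[R]_n -> 'M[R]_n).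

(** The equation [x' = u Z(x)] with the control [u] adjoined as a motionless state, which turns
    dependence on [u] into dependence on initial values. *)
Definition controlled_field (z : 'rV[R]_(n + n)) : 'rV[R]_(n + n) :=
  row_mx (rsubmx z *m Z (lsubmx z)) 0.

Lemma mul_jac_controlled_field (y u v w : 'rV[R]_n) :
  row_mx v w *m jac controlled_field (row_mx y u) =
  row_mx (v *m jac (fun y => u *m Z y) y + w *m Z y) 0.
Proof.
apply/rowP => i; rewrite mulmx_jacE big_split_ord/=.
case: (split_ordP i) => k ->.
  rewrite row_mxEl mxE [(v *m _) _ _]mxE [(w *m _) _ _]mxE; congr (_ + _).
    apply: eq_bigr => l _; rewrite row_mxEl mxE pderiv_lshift.
    congr (_ * _); apply: eq_pderiv => z.
    by rewrite /controlled_field row_mxEl row_mxKl row_mxKr.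
  apply: eq_bigr => l _; rewrite row_mxEr pderiv_rshift -(pderiv_mulmx (Z y) l k u).
  congr (_ * _); apply: eq_pderiv => z.
  by rewrite /controlled_field row_mxEl row_mxKl row_mxKr.
have E : (fun z => controlled_field z 0 (rshift n k)) = fun=> 0.
  by apply/funext => z; rewrite /controlled_field row_mxEr mxE.
rewrite row_mxEr mxE !E big1 ?add0r ?big1// => l _; by rewrite pderiv_cst mulr0.
Qed.

Lemma smooth_controlled_field V : open V -> (forall m i j, Ck m V (fun x => Z x i j)) ->
  smooth_map [set z : 'rV[R]_(n + n) | V (lsubmx z)] controlled_field.
Proof.
move=> oV sZ m i; have oU := @open_lsubmx R n n V oV.
case: (split_ordP i) => k ->; last first.
  by apply: eq_Ck (Ck_cst m _ 0) => // z _; rewrite /controlled_field row_mxEr mxE.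
have : Ck m [set z : 'rV[R]_(n + n) | V (lsubmx z)]
    (fun z => \sum_l z 0 (rshift n l) * Z (lsubmx z) l k).
  apply: Ck_sum => // l _; apply: CkM => //; first exact: Ck_coord.
  exact: (smooth_lsubmx n oV (sZ m l k)).
apply: eq_Ck => // z _; rewrite /controlled_field row_mxEl mxE.
by apply: eq_bigr => l _; rewrite mxE.
Qed.

End ControlledField.

Lemma qder_lsubmx (n p : nat) (y w : R -> 'rV[R]_(n + p)) : qder y w ->
  qder (fun s => lsubmx (y s)) (fun s => lsubmx (w s)).
Proof.
move=> [C C0 hC]; exists C => // s t s0 st t1.
apply: le_trans (hC s t s0 st t1); apply/norm_leP => // i.
by have := coord_le_norm (y t - y s - (t - s) *: w s) (lshift p i); rewrite !mxE.
Qed.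

Definition clamp_box (n : nat) (p : 'rV[R]_n) (rho : R) (y : 'rV[R]_n) : 'rV[R]_n :=
  \row_i clamp (p 0 i - rho) (p 0 i + rho) (y 0 i).

Lemma clamp_box_in (n : nat) (p : 'rV[R]_n) rho y : 0 <= rho ->
  box p (const_mx rho) (clamp_box p rho y).
Proof.
move=> r0 i; rewrite !mxE ler_distl.
by apply: clamp_in; lra.
Qed.

Lemma clamp_box_id (n : nat) (p : 'rV[R]_n) rho y : box p (const_mx rho) y -> clamp_box p rho y = y.
Proof.
move=> bY; apply/rowP => i; rewrite mxE clamp_id//.
by have := bY i; rewrite mxE ler_distl.
Qed.

Lemma clamp_box_lipschitz (n : nat) (p : 'rV[R]_n) rho y z :
  `|clamp_box p rho y - clamp_box p rho z| <= `|y - z|.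
Proof.
apply/norm_leP => // i; rewrite !mxE (le_trans (clamp_lipschitz _ _ _ _))//.
by have := coord_le_norm (y - z) i; rewrite !mxE.
Qed.

Lemma small_factor (a b : R) : 0 <= a -> 0 < b ->
  exists2 e, 0 < e & forall u, 0 <= u -> u < e -> a * u <= b.
Proof.
move=> a0 b0; exists (b / (a + 1)) => [|u u0 ub]; first by rewrite divr_gt0// ltr_wpDl.
have a1 : 0 < a + 1 by rewrite ltr_wpDl.
move: ub; rewrite ltr_pdivlMr// => /ltW; apply: le_trans.
by rewrite mulrC ler_wpM2l// lerDl.
Qed.

Section FlowLemma.
Variables (n : nat) (V : set 'rV[R]_n) (p : 'rV[R]_n).
Variables (Z : 'rV[R]_n -> 'M[R]_n) (W : 'M[R]_n).
Hypotheses (oV : open V) (Vp : V p) (sZ : forall m i j, Ck m V (fun x => Z x i j)).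

(** Smallness of [u] plays the role of a short time: it slows the field [u Z] down until a
    trajectory over [0, 1] stays in the box. The last clause is the variational equation, whose
    source term is the derivative of [u Z] in [u_j]. Through [W] the starting point may move with
    [u]. *)
Theorem parametric_flow : exists e rho : R, exists x : R -> 'rV[R]_n -> 'rV[R]_n,
  [/\ [/\ 0 < e, 0 < rho & box p (const_mx rho) `<=` V],
      forall u, ball 0 e u -> x 0 u = p + u *m W,
      forall s u, 0 <= s <= 1 -> ball 0 e u -> box p (const_mx rho) (x s u),
      forall s, 0 <= s <= 1 -> smooth_map (ball 0 e) (x s) &
      forall u, ball 0 e u -> qder (x^~ u) (fun s => u *m Z (x s u)) /\
        forall j, qder (fun s => row j (jac (x s) u))
          (fun s => row j (jac (x s) u) *m jac (fun y => u *m Z y) (x s u) + row j (Z (x s u)))].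
Proof.
have [rho rho0 bV] := open_box_nbhs oV Vp.
have [M M0 hM] : exists2 M, 0 <= M & forall (ki : 'I_n * 'I_n) x, box p (const_mx rho) x ->
    `|Z x ki.1 ki.2| <= M * 1.
  apply: uniform_factor => // -[k i]; have [M M0 h] := box_bounded bV (sZ 0 k i).
  by exists M => // x /h; rewrite mulr1.
have [L L0 hL] : exists2 L, 0 <= L & forall (ki : 'I_n * 'I_n) t,
    box p (const_mx rho) t.1 /\ box p (const_mx rho) t.2 ->
    `|Z t.2 ki.1 ki.2 - Z t.1 ki.1 ki.2| <= L * `|t.2 - t.1|.
  apply: uniform_factor => // -[k i]; have [L L0 h] := box_lipschitz oV bV (sZ 1 k i).
  by exists L => // -[x y] [bx bY]; exact: h.
pose B := \sum_(ki : 'I_n * 'I_n) `|W ki.1 ki.2|.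
have B0 : 0 <= B by apply: sumr_ge0.
have hB k i : `|W k i| <= B.
  by rewrite /B (bigD1 (k, i))//= lerDl sumr_ge0.
have nM0 : 0 <= n%:R * M by rewrite mulr_ge0.
have nL0 : 0 <= n%:R * L by rewrite mulr_ge0.
have nB0 : 0 <= n%:R * B by rewrite mulr_ge0.
have rho20 : 0 < rho / 2 by rewrite divr_gt0.
have half0 : 0 < 2^-1 :> R by rewrite invr_gt0.
(* The three radii ensure a speed of at most [rho / 2] ([e1]), the Lipschitz constant 1/2 that
   [picard] asks for ([e2]), and a start within [rho / 2] of [p] ([e3]), so that the box is never
   left. *)
have [e1 e10 h1] := small_factor nM0 rho20.
have [e2 e20 h2] := small_factor nL0 half0.
have [e3 e30 h3] := small_factor nB0 rho20.
pose e := Num.min e1 (Num.min e2 e3).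
have e0 : 0 < e by rewrite !lt_min e10 e20.
have ballE (u : 'rV[R]_n) : ball 0 e u -> [/\ `|u| < e1, `|u| < e2 & `|u| < e3].
  by rewrite -ball_normE /ball_/= sub0r normrN !lt_min => /andP[-> /andP[-> ->]].
have sol u : exists x : R -> 'rV[R]_n, ball 0 e u ->
    [/\ x 0 = p + u *m W, forall s, 0 <= s <= 1 -> box p (const_mx rho) (x s) &
      qder x (fun s => u *m Z (x s))].
  have [bu|nb] := pselect (ball 0 e u); last by exists (fun=> 0).
  have [u1 u2 u3] := ballE u bu.
  (* Clamping makes the field global; the trajectories turn out to stay in the box, where the clamp
     is the identity. *)
  pose G y := u *m Z (clamp_box p rho y).
  have GM y : `|G y| <= rho / 2.
    have bc := clamp_box_in p y (ltW rho0).
    apply: le_trans (norm_mulmx_le u M0 _) (h1 _ _ u1) => // k i.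
    by have := hM (k, i) _ bc; rewrite mulr1.
  have GL y z : `|G y - G z| <= 2^-1 * `|y - z|.
    rewrite /G -mulmxBr.
    have bcy := clamp_box_in p y (ltW rho0); have bcz := clamp_box_in p z (ltW rho0).
    apply: le_trans (norm_mulmx_le (M := L * `|y - z|) u _ _) _.
    - by rewrite mulr_ge0.
    - move=> k i; rewrite !mxE (le_trans (hL (k, i) (_, _) (conj bcz bcy)))//.
      by rewrite ler_wpM2l// clamp_box_lipschitz.
    - by rewrite mulrA mulrAC ler_wpM2r// h2.
  have [x x0 qx] := picard (p + u *m W) GM GL.
  have bx s : 0 <= s <= 1 -> box p (const_mx rho) (x s).
    move=> /andP[s0 s1]; apply/box_const_norm; first exact: ltW.
    have H := qder_mean_value qx (lexx 0) s0 s1 (ltW rho20) (fun t _ => GM (x t)).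
    have -> : x s - p = (x s - x 0) + u *m W by rewrite x0 opprD -addrA addrNK.
    rewrite (le_trans (ler_normD _ _))// [leRHS]splitr lerD//.
      by rewrite (le_trans H)// subr0 ler_piMr// ltW.
    apply: le_trans (norm_mulmx_le u B0 _) (h3 _ _ u3) => // k i; exact: hB.
  exists x => _; split=> //; apply: qder_ext qx => // s s01.
  by rewrite /= /G clamp_box_id//; exact: bx.
have [x hx] := choice sol.
pose X s u := row_mx (x u s) u.
have XF : solution_family [set z : 'rV[R]_(n + n) | V (lsubmx z)] (row_mx p 0)
    (row_mx (const_mx rho) (const_mx e)) (controlled_field Z) (ball 0 e) X.
  split.
  - split=> [|z bz]; first exact: open_lsubmx.
    apply: bV => k; have := bz (lshift n k).
    by rewrite !row_mxEl [lsubmx z 0 k]mxE.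
  - exact: smooth_controlled_field.
  - have ob : open (ball (0 : 'rV[R]_n) e) by exact: ball_open.
    split=> // m i; rewrite /X; case: (split_ordP i) => k ->; last first.
      by apply: eq_Ck (Ck_coord m _ k) => // u _; rewrite row_mxEr.
    have : Ck m (ball (0 : 'rV[R]_n) e) (fun u => p 0 k + \sum_l u 0 l * W l k).
      apply: CkD => //; first exact: Ck_cst.
      apply: Ck_sum => // l _; apply: CkM => //; [exact: Ck_coord|exact: Ck_cst].
    apply: eq_Ck => // u; rewrite inE => bu.
    by rewrite row_mxEl; have [-> _ _] := hx u bu; rewrite !mxE.
  - move=> s u s01 bu i; rewrite /X; case: (split_ordP i) => k ->.
      by rewrite !row_mxEl; have [_ + _] := hx u bu; exact.
    rewrite !row_mxEr [(0 : 'rV_n) 0 k]mxE [const_mx _ _ _]mxE subr0.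
    rewrite (le_trans (coord_le_norm _ _))//.
    by move: bu; rewrite -ball_normE /ball_/= sub0r normrN => /ltW.
  - move=> u bu; have [_ _ qx] := hx u bu.
    apply: qder_ext (qder_row_mx qx (qder_cst u)) => // s s01.
    by rewrite /X /= /controlled_field row_mxKl row_mxKr.
exists e, rho, (fun s u => x u s); split=> //.
- by move=> u bu; have [] := hx u bu.
- by move=> s u s01 bu; have [_ + _] := hx u bu; exact.
- move=> s s01 m i.
  have := solution_family_smooth XF s01 m (lshift n i).
  apply: eq_Ck; first exact: ball_open.
  by move=> u _; rewrite /X row_mxEl.
- move=> u bu; have [_ _ qx] := hx u bu; split=> // j.
  have [_ qD] := family_derivable XF j bu.
  have jacX s : row j (jac (X s) u) = row_mx (row j (jac (fun u => x u s) u)) 'e_j.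
    apply/rowP => i; case: (split_ordP i) => k ->; rewrite 2![LHS]mxE /X.
      rewrite [RHS]row_mxEl 2![RHS]mxE; apply: eq_pderiv => z.
      by rewrite row_mxEl.
    rewrite [RHS]row_mxEr.
    rewrite (_ : (fun z => _) = (fun z : 'rV_n => (z *m 1%:M) 0 k)); last first.
      by apply/funext => z; rewrite row_mxEr mulmx1.
    by rewrite pderiv_mulmx !mxE eqxx/= eq_sym.
  apply: qder_ext (qder_lsubmx qD) => s s01; first by rewrite jacX row_mxKl.
  by rewrite jacX /X mul_jac_controlled_field row_mxKl -rowE.
Qed.

End FlowLemma.
End Flow.

(** * Inverse functions and commuting fields *)

Section SmoothMatrices.
Variables (R : realType) (d : nat).
Implicit Types (U : set 'rV[R]_d).

Definition smooth_mx (p q : nat) U (A : 'rV[R]_d -> 'M[R]_(p, q)) :=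
  forall m i j, Ck m U (fun x => A x i j).

Lemma Ck_det m U (p : nat) (A : 'rV[R]_d -> 'M[R]_p) : open U ->
  (forall i j, Ck m U (fun x => A x i j)) -> Ck m U (fun x => \det (A x)).
Proof.
move=> oU CA; apply: Ck_sum => // s _; apply: CkM => //; first exact: Ck_cst.
by apply: Ck_prod => // i _.
Qed.

Lemma smooth_invmx U (p : nat) (A : 'rV[R]_d -> 'M[R]_p) : open U ->
  (forall x, U x -> A x \in unitmx) -> smooth_mx U A -> smooth_mx U (fun x => invmx (A x)).
Proof.
move=> oU uA sA m i j.
have C1 : Ck m U (fun x => (\det (A x))^-1).
  apply: CkV => // [x Ux|]; first by have := uA x Ux; rewrite unitmxE unitfE.
  by apply: Ck_det => // k l; exact: sA.
have C2 : Ck m U (fun x => (-1) ^+ (j + i) * \det (row' j (col' i (A x)))).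
  apply: CkM => //; first exact: Ck_cst.
  apply: Ck_det => // k l.
  by apply: eq_Ck (sA m (lift j k) (lift i l)) => // x _; rewrite !mxE.
apply: eq_Ck (CkM oU C1 C2) => // x; rewrite inE => Ux.
by rewrite /invmx (uA x Ux) !mxE.
Qed.

Lemma smooth_mulmx U (p q r : nat) (A : 'rV[R]_d -> 'M[R]_(p, q)) (B : 'rV[R]_d -> 'M[R]_(q, r)) :
  open U -> smooth_mx U A -> smooth_mx U B -> smooth_mx U (fun x => A x *m B x).
Proof.
move=> oU sA sB m i j.
have : Ck m U (fun x => \sum_k A x i k * B x k j).
  by apply: Ck_sum => // k _; apply: CkM.
by apply: eq_Ck => // x _; rewrite mxE.
Qed.

Lemma smooth_cst_mx U (p q : nat) (A : 'M[R]_(p, q)) : smooth_mx U (fun=> A).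
Proof. by move=> m i j; exact: Ck_cst. Qed.

Lemma smooth_trmx U (p q : nat) (A : 'rV[R]_d -> 'M[R]_(p, q)) :
  open U -> smooth_mx U A -> smooth_mx U (fun x => (A x)^T).
Proof. by move=> oU sA m i j; apply: eq_Ck (sA m j i) => // x _; rewrite mxE. Qed.

Lemma smooth_jac U (p : nat) (F : 'rV[R]_d -> 'rV[R]_p) :
  open U -> smooth_map U F -> smooth_mx U (jac F).
Proof.
by move=> oU sF m i j; apply: eq_Ck ((sF m.+1 j).2 i).2 => // x _; rewrite mxE.
Qed.

Lemma smooth_affine_map (q : nat) (O : set 'rV[R]_d) (c : 'rV[R]_q) (B : 'M[R]_(d, q)) : open O ->
  smooth_map O (fun x : 'rV[R]_d => c + x *m B).
Proof.
move=> oO m i; have : Ck m O (fun x : 'rV[R]_d => c 0 i + \sum_l x 0 l * B l i).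
  apply: CkD => //; first exact: Ck_cst.
  apply: Ck_sum => // l _; apply: CkM => //; [exact: Ck_coord|exact: Ck_cst].
by apply: eq_Ck => // x _; rewrite !mxE.
Qed.

Lemma pderiv_sum (p : nat) (f : 'I_p -> 'rV[R]_d -> R) k x :
  (forall i, derivable (f i) x 'e_k) ->
  pderiv k (fun x => \sum_i f i x) x = \sum_i pderiv k (f i) x.
Proof.
move=> df; rewrite /pderiv -derive_sum//; congr derive.
by apply/funext => z; rewrite fct_sumE.
Qed.

Definition pderiv_mx (p q : nat) k (A : 'rV[R]_d -> 'M[R]_(p, q)) x : 'M[R]_(p, q) :=
  \matrix_(i, j) pderiv k (fun x => A x i j) x.

Lemma pderiv_mulmx_rule (U : set 'rV[R]_d) (p q r : nat) k
    (A : 'rV[R]_d -> 'M[R]_(p, q)) (B : 'rV[R]_d -> 'M[R]_(q, r)) x :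
  smooth_mx U A -> smooth_mx U B -> U x ->
  pderiv_mx k (fun x => A x *m B x) x = pderiv_mx k A x *m B x + A x *m pderiv_mx k B x.
Proof.
move=> sA sB Ux; apply/matrixP => i j; rewrite !mxE.
have dA l : derivable (fun x => A x i l) x 'e_k by exact: ((sA 1%N i l).2 k).1.
have dB l : derivable (fun x => B x l j) x 'e_k by exact: ((sB 1%N l j).2 k).1.
have -> : (fun x => (A x *m B x) i j) = (fun x => \sum_l A x i l * B x l j).
  by apply/funext => z; rewrite mxE.
rewrite pderiv_sum => [|l]; last exact: derivableM.
rewrite -big_split/=; apply: eq_bigr => l _.
by rewrite pderivM// !mxE.
Qed.

Lemma pderiv_mx_cst (p q : nat) k (A : 'M[R]_(p, q)) x : pderiv_mx k (fun=> A) x = 0.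
Proof. by apply/matrixP => i j; rewrite !mxE; exact: derive_cst. Qed.

Lemma eq_on_pderiv_mx U (p q : nat) k (A B : 'rV[R]_d -> 'M[R]_(p, q)) x : open U -> U x ->
  {in U, A =1 B} -> pderiv_mx k A x = pderiv_mx k B x.
Proof.
move=> oU Ux AB; apply/matrixP => i j; rewrite !mxE.
by apply: (eq_on_pderiv k oU Ux) => y yU; rewrite AB.
Qed.

Lemma eq_on_jac U (p : nat) (F G : 'rV[R]_d -> 'rV[R]_p) x : open U -> U x ->
  {in U, F =1 G} -> jac F x = jac G x.
Proof.
move=> oU Ux FG; apply/matrixP => i j; rewrite !mxE.
by apply: (eq_on_pderiv i oU Ux) => y yU; rewrite FG.
Qed.

End SmoothMatrices.

Section InverseFunction.
Variables (R : realType).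

Lemma jac_comp (n p q : nat) (U : set 'rV[R]_n) (V : set 'rV[R]_p)
    (G : 'rV[R]_n -> 'rV[R]_p) (F : 'rV[R]_p -> 'rV[R]_q) x :
  open U -> open V -> smooth_map U G -> smooth_map V F -> U x -> V (G x) ->
  jac (F \o G) x = jac G x *m jac F (G x).
Proof.
move=> oU oV sG sF Ux Vx; apply/matrixP => k i; rewrite !mxE.
rewrite {1}/pderiv (@chain_rule _ _ _ G (fun z => F z 0 i)).
- by apply: eq_bigr => l _; rewrite !mxE.
- by move=> l; apply: Ck_differentiable oU (sG 1%N l) Ux.
- by apply: Ck_differentiable oV (sF 1%N i) Vx.
Qed.

Lemma smooth_map_comp (n p q : nat) (U : set 'rV[R]_n) (V : set 'rV[R]_p)
    (G : 'rV[R]_n -> 'rV[R]_p) (F : 'rV[R]_p -> 'rV[R]_q) :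
  open U -> open V -> (forall x, U x -> V (G x)) -> smooth_map U G -> smooth_map V F ->
  smooth_map U (F \o G).
Proof.
by move=> oU oV UV sG sF m i; apply: (Ck_comp oU oV UV (fun i => sG m i) (sF m i)).
Qed.

Lemma jac_id (n : nat) (x : 'rV[R]_n) : jac id x = 1%:M.
Proof.
apply/matrixP => k i; rewrite !mxE.
have := pderiv_mulmx (1%:M : 'M[R]_n) k i x; rewrite mxE => <-.
by apply: eq_pderiv => z; rewrite mulmx1.
Qed.

Lemma jac_affine (n p : nat) (c : 'rV[R]_p) (A : 'M[R]_(n, p)) x : jac (fun u => c + u *m A) x = A.
Proof.
apply/matrixP => k i; rewrite !mxE -(pderiv_mulmx A k i x) /pderiv /derive.
set F := (X in X @ _); set G := (X in _ = lim (X @ _)).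
suff -> : F = G by []; rewrite /F /G; apply/funext => h /=.
by rewrite ![(_ + _ *m A) _ _]mxE; congr (_ *: _); ring.
Qed.

Lemma qder_cst_path (n : nat) (y w : R -> 'rV[R]_n) : qder y w ->
  (forall s, 0 <= s <= 1 -> w s = 0) -> forall s, 0 <= s <= 1 -> y s = y 0.
Proof.
move=> qy w0 s /andP[s0 s1]; apply/eqP; rewrite -subr_eq0 -normr_le0.
have := qder_mean_value qy (lexx 0) s0 s1 (lexx 0); rewrite mul0r; apply.
by move=> t /andP[t0 ts]; rewrite w0 ?normr0// t0 (le_trans ts).
Qed.

Lemma qder_comp (n p : nat) (V : set 'rV[R]_n) c r (F : 'rV[R]_n -> 'rV[R]_p)
    (y w : R -> 'rV[R]_n) (M : R) :
  open V -> box c r `<=` V -> smooth_map V F -> qder y w ->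
  (forall s, 0 <= s <= 1 -> box c r (y s)) -> (forall s, 0 <= s <= 1 -> `|w s| <= M) ->
  qder (F \o y) (fun s => w s *m jac F (y s)).
Proof.
move=> oV bV sF qy yb wM; have [C C0 hC] := qy.
have M0 : 0 <= M by apply: le_trans (wM 0 _) => //; rewrite lexx ler01.
have [K [K0 _ _ FQ FJ]] := field_boundsP oV bV sF.
exists (K * M ^+ 2 + K * C) => [|s t s0 st t1]; first by rewrite addr_ge0// mulr_ge0// sqr_ge0.
have s01 : 0 <= s <= 1 by rewrite s0 (le_trans st).
have t01 : 0 <= t <= 1 by rewrite t1 (le_trans s0).
have ts0 : 0 <= t - s by rewrite subr_ge0.
have -> : (F \o y) t - (F \o y) s - (t - s) *: (w s *m jac F (y s)) =
  (F (y t) - F (y s) - (y t - y s) *m jac F (y s)) + (y t - y s - (t - s) *: w s) *m jac F (y s).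
  rewrite [(_ - _ *: _) *m _]mulmxBl -scalemxAl.
  by apply/rowP => i; rewrite !mxE /=; ring.
rewrite (le_trans (ler_normD _ _))// mulrDl lerD//.
  rewrite (le_trans (FQ _ _ (yb _ s01) (yb _ t01)))// -mulrA -exprMn ler_wpM2l//.
  rewrite lerXn2r ?nnegrE ?mulr_ge0//.
  apply: (qder_mean_value qy s0 st t1 M0) => a /andP[sa at_].
  by apply: wM; rewrite (le_trans s0)// (le_trans at_).
have [H _] := FJ _ _ (y t - y s - (t - s) *: w s) (yb _ s01) (yb _ s01).
by rewrite (le_trans H)// -mulrA ler_wpM2l// hC.
Qed.

Lemma det_neq0_nbhs (n d : nat) (V : set 'rV[R]_d) (A : 'rV[R]_d -> 'M[R]_n) p :
  open V -> V p -> smooth_mx V A -> A p \in unitmx ->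
  exists2 e : R, 0 < e & ball p e `<=` V `&` [set x | A x \in unitmx].
Proof.
move=> oV Vp sA uA.
have [cd _] := @Ck_det R d 0 V n A oV (fun i j => sA 0%N i j).
have n0 : \det (A p) != 0 by move: uA; rewrite unitmxE unitfE.
have pos : 0 < `|\det (A p)| / 2 by rewrite divr_gt0// normr_gt0.
have H : \forall x \near p, `|\det (A p) - \det (A x)| <= `|\det (A p)| / 2.
  exact: ((cvgrPdist_le _ _).1 (cd p Vp)).
have HV : \forall x \near p, V x by apply: open_nbhs_nbhs.
have [e /= e0 he] := (nbhs_ballP _ _).1 (filterI HV H).
exists e => // x /he[Vx hx]; split=> //=.
rewrite unitmxE unitfE; apply/eqP => E; move: hx.
rewrite E subr0; apply/negP; rewrite -ltNge ltr_pdivrMr// ltr_pMr ?ltr1n//.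
by rewrite normr_gt0.
Qed.

(* The solution at time 1 of [x' = u (DF(x))^-1], [x(0) = p], satisfies
   [F(x(s)) = F(p) + s u]. *)
Theorem local_right_inverse (n : nat) (V : set 'rV[R]_n) (F : 'rV[R]_n -> 'rV[R]_n) p :
  open V -> V p -> smooth_map V F -> jac F p \in unitmx ->
  exists e, exists G : 'rV[R]_n -> 'rV[R]_n,
    [/\ 0 < e, G 0 = p, smooth_map (ball 0 e) G &
      forall u, ball 0 e u -> V (G u) /\ F (G u) = F p + u].
Proof.
move=> oV Vp sF uF.
have [d d0 bd] := det_neq0_nbhs oV Vp (smooth_jac oV sF) uF.
pose V' := ball p d.
have oV' : open V' by exact: ball_open.
have V'p : V' p by exact: ballxx.
have V'V x : V' x -> V x by move=> /bd[].
have V'u x : V' x -> jac F x \in unitmx by move=> /bd[].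
have sF' : smooth_map V' F by move=> m i; exact: Ck_subset V'V (sF m i).
pose Z x := invmx (jac F x).
have sZ : smooth_mx V' Z by apply: smooth_invmx => //; exact: smooth_jac.
have [e [rho [x [[e0 rho0 bV] x0 xb xs xq]]]] := parametric_flow 0 oV' V'p sZ.
have x00 u : ball 0 e u -> x 0 u = p by move=> /x0; rewrite mulmx0 addr0.
have i1 : 0 <= (1 : R) <= 1 by rewrite lexx ler01.
exists e, (x 1); split=> //.
- have b0 : ball (0 : 'rV[R]_n) e 0 by exact: ballxx.
  have [q0 _] := xq 0 b0.
  have -> : x 1 0 = x 0 0 by apply: (qder_cst_path q0 _ i1) => s _; rewrite mul0mx.
  exact: x00.
- exact: xs.
- move=> u bu; have [qu _] := xq u bu; split; first by apply/V'V/bV/xb.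
  have [K KZ] : exists K, forall s, 0 <= s <= 1 -> `|u *m Z (x s u)| <= K.
    have suZ : smooth_map V' (fun y => u *m Z y).
      by move=> m i; apply: (smooth_mulmx oV' (@smooth_cst_mx R n V' _ _ u) sZ).
    have [K [_ FK _ _ _]] := field_boundsP oV' bV suZ.
    by exists K => s s01; apply: FK; exact: xb.
  have qF := qder_comp oV' bV sF' qu (fun s s01 => xb s u s01 bu) KZ.
  have qq := qder_cst_path (qderB qF (qder_id u)) _ i1.
  move: qq; rewrite /= scale1r scale0r subr0 x00// => <-; first by rewrite subrK.
  move=> s s01; rewrite -mulmxA mulVmx ?mulmx1 ?subrr//.
  by apply/V'u/bV/xb.
Qed.

(** A right inverse taken twice: [G] of [F], then [H] of [G]. From [G (H (x - p)) = x], applying [F]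
    identifies [H (x - p)] with [F x - F p], so [G] is a left inverse too. *)
Theorem local_inverse (n : nat) (V : set 'rV[R]_n) (F : 'rV[R]_n -> 'rV[R]_n) p :
  open V -> V p -> smooth_map V F -> jac F p \in unitmx ->
  exists d e, exists G : 'rV[R]_n -> 'rV[R]_n,
    [/\ [/\ 0 < d, 0 < e & ball p d `<=` V], smooth_map (ball 0 e) G,
      forall u, ball 0 e u -> F (G u) = F p + u &
      forall x, ball p d x -> ball 0 e (F x - F p) /\ G (F x - F p) = x].
Proof.
move=> oV Vp sF uF.
have [e [G [e0 G0 sG hG]]] := local_right_inverse oV Vp sF uF.
have ob : open (ball (0 : 'rV[R]_n) e) by exact: ball_open.
have b0 : ball (0 : 'rV[R]_n) e 0 by exact: ballxx.
have uG : jac G 0 \in unitmx.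
  have VG0 : V (G 0) by case: (hG 0 b0).
  have H : jac G 0 *m jac F (G 0) = 1%:M.
    rewrite -(jac_comp ob oV sG sF b0 VG0) -(jac_affine (F p) 1%:M 0).
    apply: (eq_on_jac ob b0) => u; rewrite inE => bu /=.
    by have [_ ->] := hG u bu; rewrite mulmx1.
  by have [] := mulmx1_unit H.
have [d [H [d0 H0 sH hH]]] := local_right_inverse ob b0 sG uG.
rewrite G0 in hH.
have key x : ball p d x -> ball 0 e (F x - F p) /\ G (F x - F p) = x.
  move=> bx.
  have bz : ball 0 d (x - p).
    by move: bx; rewrite -!ball_normE /ball_/= sub0r normrN distrC.
  have [bH GH] := hH _ bz.
  have pE : p + (x - p) = x by rewrite addrC subrK.
  rewrite pE in GH.
  have [_ FG] := hG _ bH; rewrite GH in FG.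
  have -> : F x - F p = H (x - p) by apply/eqP; rewrite subr_eq FG addrC.
  by split.
exists d, e, G; split=> //.
- split=> // x bx; have [bF GF] := key x bx.
  by rewrite -GF; case: (hG _ bF).
- by move=> u bu; case: (hG u bu).
Qed.

Lemma jac_mulmx_field (n : nat) (V : set 'rV[R]_n) (Z : 'rV[R]_n -> 'M[R]_n) (u v : 'rV[R]_n) x :
  smooth_mx V Z -> V x ->
  v *m jac (fun y => u *m Z y) x = \sum_l u 0 l *: (v *m jac (fun y => row l (Z y)) x).
Proof.
move=> sZ Vx.
have -> : jac (fun y => u *m Z y) x = \sum_l u 0 l *: jac (fun y => row l (Z y)) x.
  apply/matrixP => k i; rewrite !mxE summxE.
  have dZ l : derivable (fun y => Z y l i) x 'e_k by exact: ((sZ 1%N l i).2 k).1.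
  have -> : (fun z => (u *m Z z) 0 i) = (fun z => \sum_l u 0 l * Z z l i).
    by apply/funext => z; rewrite mxE.
  have dc l : derivable (fun _ : 'rV[R]_n => u 0 l) x 'e_k by exact: derivable_cst.
  rewrite pderiv_sum => [|l]; last exact: (derivableM (dc l) (dZ l)).
  apply: eq_bigr => l _; rewrite pderivM//.
  rewrite pderiv_cst mul0r add0r !mxE; congr (_ * pderiv _ _ _).
  by apply/funext => z; rewrite mxE.
by rewrite mulmx_sumr; apply: eq_bigr => l _; rewrite scalemxAr.
Qed.

(* For commuting fields, [d x(s)/du_j] and [s Z_j(x(s))] solve the same linear
   equation with the same initial value. *)
Theorem commuting_flow (n : nat) (V : set 'rV[R]_n) p (Z : 'rV[R]_n -> 'M[R]_n) (W : 'M[R]_n) :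
  open V -> V p -> smooth_mx V Z ->
  (forall x i j, V x -> row i (Z x) *m jac (fun y => row j (Z y)) x =
                        row j (Z x) *m jac (fun y => row i (Z y)) x) ->
  exists e, exists Phi : 'rV[R]_n -> 'rV[R]_n,
    [/\ 0 < e, Phi 0 = p /\ jac Phi 0 = W + Z p, smooth_map (ball 0 e) Phi,
      forall u, ball 0 e u -> V (Phi u) &
      forall u j, ball 0 e u -> row j W = 0 -> row j (jac Phi u) = row j (Z (Phi u))].
Proof.
move=> oV Vp sZ comm.
have [e [rho [x [[e0 rho0 bV] x0 xb xs xq]]]] := parametric_flow W oV Vp sZ.
have i1 : 0 <= (1 : R) <= 1 by rewrite lexx ler01.
have ob : open (ball (0 : 'rV[R]_n) e) by exact: ball_open.
have b0 : ball (0 : 'rV[R]_n) e 0 by exact: ballxx.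
have jx0 u : ball 0 e u -> jac (x 0) u = W.
  move=> bu; rewrite -[RHS](jac_affine p W u).
  by apply: (eq_on_jac ob bu) => v; rewrite inE => bv; exact: x0.
have x0p s : 0 <= s <= 1 -> x s 0 = p.
  move=> s01; have [q0 _] := xq 0 b0.
  have -> : x s 0 = x 0 0 by apply: (qder_cst_path q0 _ s01) => t _; rewrite mul0mx.
  by rewrite x0// mul0mx addr0.
exists e, (x 1); split=> //.
- split; first exact: x0p.
  apply/row_matrixP => j; have [_ /(_ j) qj] := xq 0 b0.
  (* At [u = 0] the trajectory stays at [p] and the homogeneous part of the variational equation
     vanishes, so the derivative in [u_j] grows linearly with slope [row j (Z p)]. *)
  have qq := qder_cst_path (qderB qj (qder_id (row j (Z p)))) _ i1.
  move: qq; rewrite /= scale1r scale0r subr0 jx0//.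
  move=> H; rewrite raddfD/= -H ?subrK// => s s01.
  rewrite x0p// (jac_mulmx_field _ _ sZ Vp) big1 ?add0r ?subrr// => l _.
  by rewrite mxE scale0r.
- exact: xs.
- by move=> u bu; apply/bV/xb.
move=> u j bu Wj; have [qu /(_ j) qj] := xq u bu.
have sZj : smooth_map V (fun y => row j (Z y)).
  by move=> m i; apply: eq_Ck (sZ m j i) => // y _; rewrite mxE.
have suZ : smooth_map V (fun y => u *m Z y).
  by move=> m i; apply: (smooth_mulmx oV (@smooth_cst_mx R n V _ _ u) sZ).
have [K [K0 FK _ _ FJ]] := field_boundsP oV bV suZ.
have [L [L0 FL _ _ FLJ]] := field_boundsP oV bV sZj.
have xbu s : 0 <= s <= 1 -> box p (const_mx rho) (x s u) by move=> s01; exact: xb.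
have qZ := qder_comp oV bV sZj qu xbu (fun s s01 => FK _ (xbu s s01)).
have bZ s : 0 <= s <= 1 -> `|u *m Z (x s u) *m jac (fun y => row j (Z y)) (x s u)| <= L * K.
  move=> s01; have [H _] := FLJ _ _ (u *m Z (x s u)) (xbu s s01) (xbu s s01).
  by rewrite (le_trans H)// ler_wpM2l// FK//; exact: xbu.
have qd := qderB qj (qder_scale qZ bZ).
have := gronwall qd (lexx 0) ler01 (lexx 1) K0 (lexx 0).
rewrite /= mul0r addr0 scale0r !subr0 jx0// Wj normr0 mulr0 scale1r => H.
apply/eqP; rewrite -subr_eq0 -normr_le0; apply: H => s s01.
rewrite addr0.
have VV := bV _ (xbu s s01).
(* Commutation enters here: the derivative of [Z_j] along [u Z] equals that of [u Z] along [Z_j], so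
   the difference obeys a homogeneous linear equation. *)
have E : u *m Z (x s u) *m jac (fun y => row j (Z y)) (x s u) =
         row j (Z (x s u)) *m jac (fun y => u *m Z y) (x s u).
  rewrite (jac_mulmx_field _ _ sZ VV) {1}(row_sum_coord u) mulmx_suml mulmx_suml.
  by apply: eq_bigr => l _; rewrite -!scalemxAl -rowE comm.
have [H2 _] := FJ _ _ (row j (jac (x s) u) - s *: row j (Z (x s u))) (xbu s s01) (xbu s s01).
apply: le_trans H2; rewrite E mulmxBl -scalemxAl.
rewrite le_eqVlt; apply/orP; left; apply/eqP; congr (`| _ |).
by apply/rowP => i; rewrite !mxE; ring.
Qed.

End InverseFunction.

(** * Flat coordinates *)

Section FlatCoordinates.
Variables (R : realType) (n : nat).
Local Notation E := 'rV[R]_n.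
Implicit Types (U V W : set E) (T g omega : E -> 'M[R]_n) (phi psi : E -> E).

Lemma smooth_map_onP U (F : E -> E) : smooth_map_on U F <-> smooth_map U F.
Proof.
split=> [sF m i|sF i]; first by have /smooth_onP := sF i; exact.
by apply/smooth_onP => m; exact: sF.
Qed.

Lemma smooth_tensor_onP U T : smooth_tensor_on U T <-> smooth_mx U T.
Proof.
split=> [sT m i j|sT i j]; first by have /smooth_onP := sT i j; exact.
by apply/smooth_onP => m; exact: sT.
Qed.

Lemma componentsE T psi y a b :
  components T psi y a b = (jac psi y *m T (psi y) *m (jac psi y)^T) a b.
Proof.
rewrite -mulmxA [RHS]mxE; apply: eq_bigr => i _; rewrite [X in _ * X]mxE mulr_sumr.
by apply: eq_bigr => j _; rewrite !mxE mulrAC mulrA.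
Qed.

Lemma flat_forP T W psi (C : 'M[R]_n) : (forall y, W y -> forall a b, components T psi y a b = C a b) <->
  (forall y, W y -> jac psi y *m T (psi y) *m (jac psi y)^T = C).
Proof.
split=> h y Wy; first by apply/matrixP => a b; rewrite -componentsE h.
by move=> a b; rewrite componentsE h.
Qed.

Lemma jac_coordinates V W phi psi x : local_coordinates V W phi psi -> V x ->
  jac phi x *m jac psi (phi x) = 1%:M.
Proof.
move=> [oV oW VW WV [/smooth_map_onP sphi /smooth_map_onP spsi]] Vx.
rewrite -(jac_comp oV oW sphi spsi Vx (VW x Vx).1) -(jac_id x).
by apply: (eq_on_jac oV Vx) => z; rewrite inE => Vz /=; exact: (VW z Vz).2.
Qed.

Lemma flat_tensor V W phi psi T (C : 'M[R]_n) x : local_coordinates V W phi psi ->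
  (forall y, W y -> forall a b, components T psi y a b = C a b) -> V x ->
  T x = jac phi x *m C *m (jac phi x)^T.
Proof.
move=> co /flat_forP flat Vx; have J := jac_coordinates co Vx.
have [_ _ VW _ _] := co; have [Wy pp] := VW x Vx.
rewrite -(flat _ Wy) pp !mulmxA J mul1mx -mulmxA -trmx_mul J trmx1 mulmx1.
by [].
Qed.

(** Six alternating swaps of neighbouring indices lead back to the same triple, and three of them
    change the sign. *)
Lemma braid (a : 'I_n -> 'I_n -> 'I_n -> R) :
  (forall i j k, a i j k = - a j i k) -> (forall i j k, a i j k = a i k j) ->
  forall i j k, a i j k = 0.
Proof.
move=> anti sym i j k.
have : a i j k = - a i j k.
  by rewrite {1}anti sym anti opprK sym anti sym.
by lra.
Qed.

Definition christoffel_mx (Gamma : E -> 'I_n -> 'I_n -> 'I_n -> R) x k : 'M[R]_n :=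
  \matrix_(s, b) Gamma x s k b.

Definition nabla_mx Gamma omega x k : 'M[R]_n :=
  pderiv_mx k omega x - ((christoffel_mx Gamma x k)^T *m omega x +
                         omega x *m christoffel_mx Gamma x k).

Lemma nablaE Gamma omega x k b c : nabla Gamma omega x k b c = nabla_mx Gamma omega x k b c.
Proof.
rewrite /nabla /nabla_mx !mxE -big_split/=; congr (_ - _); apply: eq_bigr => s _.
by rewrite !mxE [omega x b s * _]mulrC.
Qed.

Lemma compatibility_conditionE g omega Gamma x :
  compatibility_condition g omega Gamma x <->
  forall k, g x *m invmx (omega x) *m nabla_mx Gamma omega x k *m invmx (omega x) *m g x = 0.
Proof.
have E i j k : \sum_(a < n) \sum_(b < n) \sum_(c < n) \sum_(d < n)
      g x i a * invmx (omega x) a b * invmx (omega x) c d * g x d j * nabla Gamma omega x k b c =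
    (g x *m invmx (omega x) *m nabla_mx Gamma omega x k *m invmx (omega x) *m g x) i j.
  rewrite -!mulmxA [RHS]mxE; apply: eq_bigr => a _.
  rewrite [X in _ = _ * X]mxE mulr_sumr; apply: eq_bigr => b _.
  rewrite [X in _ = _ * (_ * X)]mxE !mulr_sumr; apply: eq_bigr => c _.
  rewrite [X in _ = _ * (_ * (_ * X))]mxE !mulr_sumr; apply: eq_bigr => d _.
  by rewrite nablaE; ring.
split=> h.
  by move=> k; apply/matrixP => i j; rewrite -E mxE; exact: h.
by move=> i j k; rewrite E h mxE.
Qed.

Lemma compatible_mx U g Gamma x k : symmetric_on U g -> compatible_connection U g Gamma -> U x ->
  pderiv_mx k g x = g x *m christoffel_mx Gamma x k + (christoffel_mx Gamma x k)^T *m g x.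
Proof.
move=> gs [_ Gs Gc] Ux; apply/matrixP => i j; rewrite !mxE -(Gc x Ux) -big_split/=.
apply: eq_bigr => s _; rewrite !mxE (Gs x Ux s j k) (Gs x Ux s i k) (gs x Ux j s).
by rewrite mulrC.
Qed.

Section InFlatCoordinates.
Variables (U V : set E) (g omega : E -> 'M[R]_n) (phi : E -> E) (C : 'M[R]_n).
Variable Gamma : E -> 'I_n -> 'I_n -> 'I_n -> R.
Hypotheses (oV : open V) (VU : V `<=` U) (sphi : smooth_map V phi).
Hypotheses (uphi : forall x, V x -> jac phi x \in unitmx).
Hypotheses (gs : symmetric_on U g) (CT : C^T = C).
Hypotheses (gC : forall x, V x -> g x = jac phi x *m C *m (jac phi x)^T).
Hypotheses (Gc : compatible_connection U g Gamma).

(* In flat coordinates the Christoffel symbols take values in the kernel of [g]. *)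
Lemma flat_christoffel x k : V x ->
  C *m (pderiv_mx k (jac phi) x)^T = C *m (jac phi x)^T *m christoffel_mx Gamma x k.
Proof.
move=> Vx; set B := jac phi x; set Bk := fun k => pderiv_mx k (jac phi) x.
have sB : smooth_mx V (jac phi) by exact: smooth_jac.
have dg l : pderiv_mx l g x = Bk l *m C *m B^T + B *m C *m (Bk l)^T.
  rewrite (eq_on_pderiv_mx l oV Vx (B := fun x => jac phi x *m C *m (jac phi x)^T)); last first.
    by move=> y; rewrite inE; exact: gC.
  have sBC : smooth_mx V (fun x => jac phi x *m C).
    by apply: smooth_mulmx => //; exact: smooth_cst_mx.
  rewrite (pderiv_mulmx_rule l sBC (smooth_trmx oV sB) Vx).
  rewrite (pderiv_mulmx_rule l sB (@smooth_cst_mx R n V _ _ C) Vx) pderiv_mx_cst mulmx0 addr0.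
  by congr (_ + _ *m _); apply/matrixP => i j; rewrite !mxE; apply: eq_pderiv => z; rewrite mxE.
(* Antisymmetry in i, j compares the derivative of [g = B C B^T] with its expression through the
   connection. Symmetry in j, l is equality of mixed partials together with vanishing torsion. *)
pose a i j l := (B *m C *m (Bk l)^T - g x *m christoffel_mx Gamma x l) i j.
have aE i j l : a i j l = (B *m C *m (Bk l)^T) i j - (g x *m christoffel_mx Gamma x l) i j.
  by rewrite /a [LHS]mxE [X in _ + X]mxE.
have a0 i j l : a i j l = 0.
  apply: braid => {i j l} i j l.
    apply/eqP; rewrite -addr_eq0; apply/eqP.
    have gT : (g x)^T = g x by apply/matrixP => s t; rewrite mxE; exact: gs (VU Vx) _ _.
    have -> : a j i l = (Bk l *m C *m B^T - (christoffel_mx Gamma x l)^T *m g x) i j.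
      transitivity ((B *m C *m (Bk l)^T - g x *m christoffel_mx Gamma x l)^T i j).
        by rewrite mxE.
      by rewrite linearB/= !trmx_mul trmxK CT gT mulmxA.
    have := dg l; rewrite (compatible_mx l gs Gc (VU Vx)) => /matrixP/(_ i j).
    by rewrite aE !mxE; lra.
  rewrite !aE; congr (_ - _).
    rewrite [LHS]mxE [RHS]mxE; apply: eq_bigr => s _; congr (_ * _).
    have SE m q : (Bk m)^T s q = pderiv m (pderiv q (fun z => phi z 0 s)) x.
      rewrite mxE /Bk mxE; suff -> : (fun z => jac phi z q s) = pderiv q (fun z => phi z 0 s) by [].
      by apply/funext => z; rewrite mxE.
    apply: etrans (SE l j) _; apply: etrans _ (esym (SE j l)).
    exact: (pderivC l j oV (sphi 2%N s) Vx).
  rewrite [LHS]mxE [RHS]mxE; apply: eq_bigr => s _; congr (_ * _).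
  by rewrite !mxE; case: Gc => _ Gs _; exact: Gs (VU Vx) _ _ _.
have H : B *m (C *m (Bk k)^T) = B *m (C *m B^T *m christoffel_mx Gamma x k).
  rewrite !mulmxA -(gC Vx); apply/eqP; rewrite -subr_eq0; apply/eqP/matrixP => i j.
  by rewrite [RHS]mxE; exact: a0.
by rewrite -[LHS](mulKmx (uphi Vx)) H mulKmx// uphi.
Qed.

Hypotheses (so : smooth_mx V omega) (uo : forall x, V x -> omega x \in unitmx).

(* The matrix of the Poisson brackets of the coordinates of [phi]. *)
Definition poisson_mx omega phi x : 'M[R]_n := (jac phi x)^T *m invmx (omega x) *m jac phi x.

(** The two conditions are linked by [g P (nabla_k omega) P g = - B (C (d_k Q) C) B^T] with [B] the
    invertible Jacobian. The sign comes from differentiating the inverse of [omega], and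
    [flat_christoffel] turns the derivatives of [B] inside [d_k Q] into the Christoffel terms of
    [nabla_k omega]. *)
Lemma flat_condition x : V x ->
  (forall k, g x *m invmx (omega x) *m nabla_mx Gamma omega x k *m invmx (omega x) *m g x = 0) <->
  (forall k, C *m pderiv_mx k (poisson_mx omega phi) x *m C = 0).
Proof.
move=> Vx; set B := jac phi x; set P := invmx (omega x).
have sB : smooth_mx V (jac phi) by exact: smooth_jac.
have sP : smooth_mx V (fun x => invmx (omega x)) by exact: smooth_invmx.
suff H k : g x *m P *m nabla_mx Gamma omega x k *m P *m g x =
    - (B *m (C *m pderiv_mx k (poisson_mx omega phi) x *m C) *m B^T).
  split=> h k; last by rewrite H h mulmx0 mul0mx oppr0.
  have := h k; rewrite H => /eqP; rewrite oppr_eq0 => /eqP E.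
  have uB := uphi Vx; have uBT : B^T \in unitmx by rewrite unitmx_tr.
  by rewrite -[LHS](mulKmx uB) -[X in invmx _ *m X](mulmxK uBT) E mul0mx mulmx0.
set Bk := pderiv_mx k (jac phi) x; set Gk := christoffel_mx Gamma x k.
have C1 : C *m Bk^T = C *m B^T *m Gk by exact: flat_christoffel.
have C2 : Bk *m C = Gk^T *m B *m C.
  by apply: trmx_inj; rewrite !trmx_mul trmxK CT C1 mulmxA.
have dP : pderiv_mx k (fun x => invmx (omega x)) x = - (P *m pderiv_mx k omega x *m P).
  have := pderiv_mulmx_rule k sP so Vx.
  rewrite (eq_on_pderiv_mx k oV Vx (B := fun=> 1%:M)); last first.
    by move=> y; rewrite inE => Vy; rewrite mulVmx// uo.
  rewrite pderiv_mx_cst => /esym/eqP; rewrite addr_eq0 => /eqP H.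
  by rewrite -[LHS](mulmxK (uo Vx)) H mulNmx.
have dQ : pderiv_mx k (poisson_mx omega phi) x =
    Bk^T *m P *m B - B^T *m (P *m pderiv_mx k omega x *m P) *m B + B^T *m P *m Bk.
  rewrite /poisson_mx.
  have sBT := smooth_trmx oV sB.
  rewrite (pderiv_mulmx_rule k (smooth_mulmx oV sBT sP) sB Vx).
  rewrite (pderiv_mulmx_rule k sBT sP Vx) dP mulmxDl mulmxN mulNmx.
  congr (_ *m _ *m _ - _ + _); apply/matrixP => i j; rewrite !mxE.
  by apply: eq_pderiv => z; rewrite mxE.
have gE : g x = B *m C *m B^T by exact: gC.
have E : B *m (C *m pderiv_mx k (poisson_mx omega phi) x *m C) *m B^T =
   g x *m Gk *m P *m g x - g x *m P *m pderiv_mx k omega x *m P *m g x + g x *m P *m Gk^T *m g x.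
  rewrite dQ !(mulmxDr, mulmxDl) !(mulmxN, mulNmx).
  congr (_ - _ + _).
  - by rewrite !mulmxA -(mulmxA B C) C1 gE !mulmxA.
  - by rewrite gE !mulmxA.
  - by rewrite -!mulmxA (mulmxA Bk) C2 gE !mulmxA.
rewrite E /nabla_mx -/Gk !(mulmxDr, mulmxDl, mulmxN, mulNmx).
rewrite !mulmxA -(mulmxA _ (omega x) P) /P (mulmxV (uo Vx)) mulmx1.
rewrite -(mulmxA (g x) (invmx (omega x)) (omega x)) (mulVmx (uo Vx)) mulmx1 -/P.
by rewrite !opprD opprK [RHS]addrAC [RHS]addrC (addrC (- (g x *m P *m Gk^T *m g x))).
Qed.

End InFlatCoordinates.
End FlatCoordinates.

(** * Hamiltonian fields *)

Section Hamiltonian.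
Variables (R : realType) (n : nat).
Local Notation E := 'rV[R]_n.

Lemma box_self (p : E) rho : 0 <= rho -> box p (const_mx rho) p.
Proof. by move=> r0 i; rewrite subrr normr0 mxE. Qed.

Lemma ball_sub_box (p : E) rho x : 0 < rho -> ball p rho x -> box p (const_mx rho) x.
Proof.
move=> r0; rewrite -ball_normE /ball_/= => h.
by apply/box_const_norm; [exact: ltW|rewrite distrC ltW].
Qed.

Lemma eq_of_pderiv0 (V : set E) (f : E -> R) p rho x : open V -> Ck 1 V f ->
  box p (const_mx rho) `<=` V -> 0 <= rho ->
  (forall x k, V x -> pderiv k f x = 0) -> box p (const_mx rho) x -> f x = f p.
Proof.
move=> oV Cf bV r0 d0 bx; apply/eqP; rewrite -subr_eq0.
have [t t01 ->] := mean_value_segment oV Cf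
  (fun t t01 => bV _ (box_convex t01 (box_self p r0) bx)).
have bt := bV _ (box_convex t01 (box_self p r0) bx).
rewrite derive_sum_coord; last exact: Ck_differentiable oV Cf bt.
by rewrite big1// => k _; rewrite d0// mulr0.
Qed.

Definition grad (f : E -> R) x : E := \row_k pderiv k f x.

Lemma mx_entryD0 (p q : nat) (A B : 'M[R]_(p, q)) i j : A + B = 0 -> B i j = - A i j.
Proof. by move=> /eqP; rewrite addrC addr_eq0 => /eqP ->; rewrite mxE. Qed.

(** Scalar identities kept apart from the matrices, so that [ring] and [lra] meet plain real
    variables. Here the vanishing cyclic sum is closedness of [omega]; the next identity assembles
    the terms of the commutator. *)
Let cyclic_sum_identity (s t o1 o2 o2' o3 : R) : o2' = - o2 -> o1 + o2 + o3 = 0 ->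
  s * (t * o1) - t * (s * o2') = - (s * (o3 * t)).
Proof. by move=> -> H; have -> : o3 = - (o1 + o2); [lra|ring]. Qed.

Let three_term_identity (t1 t2 t3 s1 s2 : R) : s1 - s2 = - t3 -> t2 = - (t1 + t3) ->
  t1 - s1 - (- t2 - s2) = 0.
Proof. lra. Qed.

Section Commutation.
Variables (V : set E) (omega : E -> 'M[R]_n) (f h : E -> R).
Hypotheses (oV : open V) (so : smooth_mx V omega).
Hypotheses (wT : forall x, V x -> (omega x)^T = - omega x).
Hypotheses (wd : forall x i j k, V x -> pderiv i (fun z => omega z j k) x
  + pderiv j (fun z => omega z k i) x + pderiv k (fun z => omega z i j) x = 0).
Hypotheses (uo : forall x, V x -> omega x \in unitmx).
Hypotheses (sf : forall m, Ck m V f) (sh : forall m, Ck m V h).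

(** The sign convention is [omega(X, .) = df], that is [X *m omega = grad f] for row vectors. The
    bracket of [f] and [h] is then the derivative of [h] along [X]. *)
Definition hamiltonian_field (f : E -> R) x : E := grad f x *m invmx (omega x).
Local Notation X := (hamiltonian_field f).
Local Notation Y := (hamiltonian_field h).

Hypothesis bracket_cst : exists c, forall x, V x -> X x *m (grad h x)^T = c.

Let smooth_grad k : (forall m, Ck m V k) -> smooth_mx V (grad k).
Proof.
by move=> sk m i j; apply: eq_Ck ((sk m.+1).2 j).2 => // x _; rewrite mxE.
Qed.

Let smooth_field k : (forall m, Ck m V k) -> smooth_mx V (hamiltonian_field k).
Proof.
move=> sk; apply: smooth_mulmx => //; first exact: smooth_grad.
exact: smooth_invmx.
Qed.

Let fieldK k x : V x -> hamiltonian_field k x *m omega x = grad k x.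
Proof. by move=> Vx; rewrite mulmxKV// uo. Qed.

Let pderiv_fieldK k a x : (forall m, Ck m V k) -> V x ->
  pderiv_mx a (hamiltonian_field k) x *m omega x =
  pderiv_mx a (grad k) x - hamiltonian_field k x *m pderiv_mx a omega x.
Proof.
move=> sk Vx; have := pderiv_mulmx_rule a (smooth_field sk) so Vx.
rewrite (eq_on_pderiv_mx a oV Vx (B := grad k)) => [->|y]; last by rewrite inE => /fieldK.
by rewrite addrK.
Qed.

Let pderiv_trmx (A : E -> E) a x : pderiv_mx a (fun z => (A z)^T) x = (pderiv_mx a A x)^T.
Proof. by apply/matrixP => i j; rewrite !mxE; apply: eq_pderiv => z; rewrite mxE. Qed.

Let pderiv_bracket c x : V x ->
  pderiv_mx c X x *m (grad h x)^T + X x *m (pderiv_mx c (grad h) x)^T = 0.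
Proof.
move=> Vx; have [K hK] := bracket_cst.
have := pderiv_mulmx_rule c (smooth_field sf) (smooth_trmx oV (smooth_grad sh)) Vx.
rewrite pderiv_trmx => <-.
rewrite (eq_on_pderiv_mx c oV Vx (B := fun=> K)); first exact: pderiv_mx_cst.
by move=> y; rewrite inE => /hK.
Qed.

Let bracketE x : V x -> Y x *m (grad f x)^T = - (X x *m (grad h x)^T)^T.
Proof.
move=> Vx; rewrite [in RHS]trmx_mul trmxK -(fieldK f Vx) -(fieldK h Vx) trmx_mul wT//.
by rewrite mulNmx mulmxN mulmxA.
Qed.

Let pderiv_bracket' c x : V x ->
  pderiv_mx c Y x *m (grad f x)^T + Y x *m (pderiv_mx c (grad f) x)^T = 0.
Proof.
move=> Vx; have [K hK] := bracket_cst.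
have := pderiv_mulmx_rule c (smooth_field sh) (smooth_trmx oV (smooth_grad sf)) Vx.
rewrite pderiv_trmx => <-.
rewrite (eq_on_pderiv_mx c oV Vx (B := fun=> - K^T)); first exact: pderiv_mx_cst.
by move=> y; rewrite inE => Vy; rewrite bracketE// hK.
Qed.

(** Leibniz expansion of [omega(X, Y)], which is constant because it is the bracket of [f] and [h]
    up to sign. *)
Let pderiv_omega_XY c x : V x ->
  pderiv_mx c X x *m omega x *m (Y x)^T + X x *m pderiv_mx c omega x *m (Y x)^T
  + X x *m omega x *m (pderiv_mx c Y x)^T = 0.
Proof.
move=> Vx; rewrite pderiv_fieldK// mulmxBl subrK fieldK//.
by have := pderiv_bracket' c Vx => /(congr1 trmx); rewrite linearD/= !trmx_mul !trmxK trmx0 addrC.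
Qed.

(* [X_f] and [X_h] commute because [i_[X_f, X_h] omega] is, up to sign, the
   differential of the bracket of [f] and [h]. *)
Lemma hamiltonian_commute x : V x -> X x *m jac Y x = Y x *m jac X x.
Proof.
move=> Vx; apply/eqP; rewrite -subr_eq0; apply/eqP.
(* Multiplying by the invertible [omega x] trades derivatives of the fields for Hessians of [f] and
   [h] and derivatives of [omega]. *)
rewrite -[LHS](mulmxK (uo Vx)) -[RHS](mul0mx _ (invmx (omega x))); congr (_ *m _).
have mul_jac k (v : E) : (forall m, Ck m V k) -> v *m jac (hamiltonian_field k) x *m omega x =
   \sum_a v 0 a *: (pderiv_mx a (grad k) x - hamiltonian_field k x *m pderiv_mx a omega x).
  move=> sk; rewrite {1}(row_sum_coord v) !mulmx_suml; apply: eq_bigr => a _.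
  rewrite -!scalemxAl -rowE -pderiv_fieldK//; congr (_ *: (_ *m _)).
  by apply/rowP => i; rewrite !mxE.
have hess k (v : E) c : (forall m, Ck m V k) ->
    (\sum_a v 0 a *: pderiv_mx a (grad k) x) 0 c = (v *m (pderiv_mx c (grad k) x)^T) 0 0.
  move=> sk; rewrite summxE [RHS]mxE; apply: eq_bigr => a _.
  have SE i j : (pderiv_mx i (grad k) x) 0 j = pderiv i (pderiv j k) x.
    rewrite mxE; suff -> : (fun z => grad k z 0 j) = pderiv j k by [].
    by apply/funext => z; rewrite mxE.
  rewrite mxE [X in _ = _ * X]mxE; congr (_ * _).
  apply: etrans (SE a c) _; apply: etrans _ (esym (SE c a)).
  exact: (pderivC a c oV (sk 2%N) Vx).
apply/rowP => c; rewrite mulmxBl.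
apply: etrans (congr2 (fun v w : E => (v - w) 0 c) (mul_jac h (X x) sh) (mul_jac f (Y x) sf)) _.
rewrite [RHS]mxE.
have hX : (X x *m (pderiv_mx c (grad h) x)^T) 0 0 =
    (pderiv_mx c X x *m omega x *m (Y x)^T) 0 0.
  rewrite (mx_entryD0 0 0 (pderiv_bracket c Vx)) -(fieldK h Vx) trmx_mul wT//.
  by rewrite mulNmx mulmxN mulmxA [X in - X = _]mxE opprK.
have hY : (Y x *m (pderiv_mx c (grad f) x)^T) 0 0 =
    - (X x *m omega x *m (pderiv_mx c Y x)^T) 0 0.
  rewrite (mx_entryD0 0 0 (pderiv_bracket' c Vx)) -(fieldK f Vx); congr (- _).
  transitivity ((pderiv_mx c Y x *m (X x *m omega x)^T)^T 0 0); first by rewrite [RHS]mxE.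
  by rewrite trmx_mul trmxK.
have hO := pderiv_omega_XY c Vx.
have split_sum k (v : E) : (forall m, Ck m V k) ->
   (\sum_a v 0 a *: (pderiv_mx a (grad k) x - hamiltonian_field k x *m pderiv_mx a omega x)) 0 c =
   (v *m (pderiv_mx c (grad k) x)^T) 0 0 -
   \sum_a \sum_b v 0 a * (hamiltonian_field k x 0 b * pderiv_mx a omega x b c).
  move=> sk; rewrite -(hess k v c sk) !summxE -sumrB; apply: eq_bigr => a _.
  rewrite scalerBr [LHS]mxE; congr (_ + _).
  by rewrite 2!mxE [X in _ * X]mxE mulr_sumr.
(* Closedness replaces the derivatives of [omega] along [X] and [Y] by its derivative in direction
   [c], evaluated on the two fields. *)
have dO : \sum_a \sum_b X x 0 a * (Y x 0 b * pderiv_mx a omega x b c) -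
   \sum_a \sum_b Y x 0 a * (X x 0 b * pderiv_mx a omega x b c) =
   - (X x *m pderiv_mx c omega x *m (Y x)^T) 0 0.
  rewrite [X in _ - X]exchange_big/= -mulmxA [X in _ = - X]mxE -sumrB -sumrN; apply: eq_bigr => a _.
  rewrite [X in _ = - (_ * X)]mxE mulr_sumr -sumrB -sumrN; apply: eq_bigr => b _.
  rewrite [X in _ = - (_ * (_ * X))]mxE.
  have oT i k l : pderiv_mx i omega x k l = - pderiv_mx i omega x l k.
    rewrite 2!mxE (eq_on_pderiv i oV Vx (g := fun z => - omega z l k)); last first.
      by move=> y; rewrite inE => /wT/matrixP/(_ l k); rewrite !mxE.
    by apply: deriveN; exact: ((so 1%N l k).2 i).1.
  have pE i k l : pderiv_mx i omega x k l = pderiv i (fun z => omega z k l) x by rewrite mxE.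
  have wE := etrans (congr2 +%R (congr2 +%R (pE a b c) (pE b c a)) (pE c a b)) (wd a b c Vx).
  exact (cyclic_sum_identity (X x 0 a) (Y x 0 b) (oT b a c) wE).
have e1 := etrans (split_sum h (X x) sh) (congr1 (fun t => t - _) hX).
have e2 := etrans (split_sum f (Y x) sf) (congr1 (fun t => t - _) hY).
have hO2 : (X x *m omega x *m (pderiv_mx c Y x)^T) 0 0 =
    - ((pderiv_mx c X x *m omega x *m (Y x)^T) 0 0 + (X x *m pderiv_mx c omega x *m (Y x)^T) 0 0).
  by rewrite (mx_entryD0 0 0 hO) [X in - X = _]mxE.
rewrite [LHS]mxE [X in _ + X]mxE.
apply: etrans (congr2 (fun s t : R => s - t) e1 e2) _.
exact (three_term_identity dO hO2).
Qed.

End Commutation.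
End Hamiltonian.

(** * Simultaneous Darboux coordinates *)

Section LinearAlgebra.
Variables (F : fieldType) (n : nat).
Local Notation pid m := (pid_mx m : 'M[F]_n).

Lemma row_pid_mulmx m (p : nat) (A : 'M[F]_(n, p)) i :
  row i (pid_mx m *m A) = if (i < m)%N then row i A else 0.
Proof.
rewrite row_mul; case: ifP => im.
  have -> : row i (pid_mx m : 'M[F]_n) = 'e_i.
    by apply/rowP => j; rewrite !mxE im andbT eq_sym.
  by rewrite -rowE.
have -> : row i (pid_mx m : 'M[F]_n) = 0.
  by apply/rowP => j; rewrite !mxE im andbF.
by rewrite mul0mx.
Qed.

Lemma pid_mulmx_pidE m (A : 'M[F]_n) i j :
  (pid_mx m *m A *m pid_mx m) i j = if (i < m)%N && (j < m)%N then A i j else 0.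
Proof.
have E (B : 'M[F]_n) a b : (pid_mx m *m B) a b = if (a < m)%N then B a b else 0.
  by have := row_pid_mulmx m B a => /rowP/(_ b); rewrite mxE => ->; case: ifP; rewrite !mxE.
transitivity ((pid_mx m *m (pid_mx m *m A)^T)^T i j).
  by rewrite trmx_mul trmxK tr_pid_mx.
rewrite mxE E mxE E.
by case: (j < m)%N; case: (i < m)%N.
Qed.

(** Take the rank factorisation [C = L pid K] and, by symmetry, its transpose [C = K^T pid L^T]; the
    new coordinates come from [M = K^T]. With the left factor of [C Q C] in the first form and the
    right one in the second, cancelling [L] and [L^T] leaves the upper left r by r block of
    [K Q K^T]. So [C Q C] determines the brackets of the first r new coordinates. *)
Lemma symmetric_factor (C : 'M[F]_n) : C^T = C ->
  exists r, exists M S : 'M[F]_n, [/\ (r <= n)%N, M \in unitmx, C = M *m S *m M^T,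
    S = pid r *m S *m pid r &
    forall Q1 Q2 : 'M[F]_n, C *m Q1 *m C = C *m Q2 *m C ->
      pid r *m (M^T *m Q1 *m M) *m pid r = pid r *m (M^T *m Q2 *m M) *m pid r].
Proof.
move=> CT; pose L := col_ebase C; pose K := row_ebase C; pose r := \rank C.
have uL : L \in unitmx := col_ebase_unit C.
have uK : K \in unitmx := row_ebase_unit C.
have uLT : L^T \in unitmx by rewrite unitmx_tr.
have uKT : K^T \in unitmx by rewrite unitmx_tr.
have CE : C = L *m pid r *m K by rewrite mulmx_ebase.
have CE' : C = K^T *m pid r *m L^T by rewrite -{1}CT CE !trmx_mul tr_pid_mx mulmxA.
have pp : pid r *m pid r = pid r by apply: pid_mx_id; exact: rank_leq_row.
pose S := invmx K^T *m C *m invmx K.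
have S1 : S = invmx K^T *m L *m pid r by rewrite /S CE -!mulmxA mulmxV// mulmx1.
have S2 : S = pid r *m L^T *m invmx K by rewrite /S CE' !mulmxA mulVmx// mul1mx.
exists r, K^T, S; split=> //.
- exact: rank_leq_row.
- by rewrite trmxK /S !mulmxA mulmxV// mul1mx -mulmxA mulVmx// mulmx1.
- have -> : pid r *m S = S by rewrite S2 !mulmxA pp.
  have Sp : invmx K^T *m L *m pid r *m pid r = invmx K^T *m L *m pid r.
    by rewrite -[LHS]mulmxA pp.
  by rewrite S1 Sp.
- move=> Q1 Q2; rewrite trmxK {1 3}CE CE' => H.
  have {H} : L *m (pid r *m (K *m Q1 *m K^T) *m pid r) *m L^T =
         L *m (pid r *m (K *m Q2 *m K^T) *m pid r) *m L^T.
    by move: H; rewrite !mulmxA.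
  by move=> /(congr1 (fun X => invmx L *m X *m invmx L^T)); rewrite -!mulmxA !mulKmx// !mulmxA !mulmxK.
Qed.

End LinearAlgebra.

Section Darboux.
Variables (R : realType) (n : nat).
Local Notation E := 'rV[R]_n.
Variables (V : set E) (p : E) (omega : E -> 'M[R]_n).
Hypotheses (so : smooth_mx V omega).
Hypotheses (wT : forall x, V x -> (omega x)^T = - omega x).
Hypotheses (wd : forall x i j k, V x -> pderiv i (fun z => omega z j k) x
  + pderiv j (fun z => omega z k i) x + pderiv k (fun z => omega z i j) x = 0).
Hypotheses (uo : forall x, V x -> omega x \in unitmx).

Lemma grad_coord (F : E -> E) x i : grad (fun z => F z 0 i) x = (col i (jac F x))^T.
Proof. by apply/rowP => k; rewrite !mxE. Qed.

Lemma hamiltonian_field_coord (F : E -> E) x i :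
  hamiltonian_field omega (fun z => F z 0 i) x = row i ((jac F x)^T *m invmx (omega x)).
Proof. by rewrite /hamiltonian_field grad_coord row_mul tr_col. Qed.

Lemma poisson_mxE (F : E -> E) x i j :
  poisson_mx omega F x i j = (row i ((jac F x)^T *m invmx (omega x)) *m col j (jac F x)) 0 0.
Proof.
rewrite /poisson_mx [LHS]mxE [RHS]mxE; apply: eq_bigr => k _.
by rewrite [X in _ = X * _]mxE [X in _ = _ * X]mxE.
Qed.

Lemma tr_invmx_antisym x : V x -> (invmx (omega x))^T = - invmx (omega x).
Proof.
move=> Vx; rewrite -[LHS](mulmxK (uo Vx)) -[X in _ *m X *m _]opprK -wT//.
by rewrite mulmxN -trmx_mul mulmxV ?uo// trmx1 mulNmx mul1mx.
Qed.

Lemma poisson_mx_antisym (F : E -> E) x i j : V x ->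
  poisson_mx omega F x j i = - poisson_mx omega F x i j.
Proof.
move=> Vx; have H : (poisson_mx omega F x)^T = - poisson_mx omega F x.
  by rewrite /poisson_mx !trmx_mul trmxK tr_invmx_antisym// mulNmx mulmxN mulmxA.
by have := congr1 (fun M : 'M[R]_n => M i j) H; rewrite mxE [RHS]mxE.
Qed.

(** All n functions are carried along, though only brackets among the first [m] are controlled; the
    others supply independent differentials. Independence is recorded at [p] only, where
    [darboux_extension] leaves the Jacobian unchanged. *)
Definition darboux_upto m (F : E -> E) (rho : R) : Prop :=
  [/\ 0 < rho, ball p rho `<=` V, smooth_map (ball p rho) F, jac F p \in unitmx &
    forall x (i j : 'I_n), ball p rho x -> (i < m)%N -> (j < m)%N ->
      poisson_mx omega F x i j = poisson_mx omega F p i j].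

(* The commuting fields [X_{F_i}], [i < m], are the first [m] coordinate fields
   [d/du_i] of a chart [Phi], completed by the frame [X_{F_i}(p)].  An affine
   function of [u] with the differential of [F_m] at [p] replaces [F_m]. *)
Lemma darboux_extension (M : 'I_n) (F : E -> E) rho : darboux_upto M F rho ->
  exists F' : E -> E, exists rho', [/\ rho' <= rho, darboux_upto M.+1 F' rho' &
    forall x i, i != M -> F' x 0 i = F x 0 i].
Proof.
move=> [rho0 bV sF uF FQ]; pose U := ball p rho.
have oU : open U by exact: ball_open.
have Up : U p by exact: ballxx.
have so' : smooth_mx U omega by move=> m i j; exact: Ck_subset bV (so m i j).
have uo' x : U x -> omega x \in unitmx by move=> /bV/uo.
have wT' x : U x -> (omega x)^T = - omega x by move=> /bV/wT.
have wd' x i j k : U x -> pderiv i (fun z => omega z j k) x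
  + pderiv j (fun z => omega z k i) x + pderiv k (fun z => omega z i j) x = 0.
  by move=> /bV; exact: wd.
pose A x := (jac F x)^T *m invmx (omega x).
have sA : smooth_mx U A.
  apply: smooth_mulmx => //; first by apply: smooth_trmx => //; exact: smooth_jac.
  exact: smooth_invmx.
(* The rows of index below [M] are Hamiltonian fields; the others are zero and commute with
   everything, so [commuting_flow] applies to all n rows. *)
pose Z x := (pid_mx M : 'M[R]_n) *m A x.
have sZ : smooth_mx U Z by apply: smooth_mulmx => //; exact: smooth_cst_mx.
have rowZ x i : row i (Z x) = if (i < M)%N then hamiltonian_field omega (fun z => F z 0 i) x else 0.
  by rewrite /Z row_pid_mulmx hamiltonian_field_coord.
have jac0 x : jac (fun _ : E => 0 : E) x = 0.
  by apply/matrixP => k i; rewrite [LHS]mxE [RHS]mxE; exact: pderiv_cst.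
have comm x i j : U x -> row i (Z x) *m jac (fun y => row j (Z y)) x =
    row j (Z x) *m jac (fun y => row i (Z y)) x.
  move=> Ux; pose G (k : 'I_n) := if (k < M)%N then hamiltonian_field omega (fun z => F z 0 k) else fun=> 0.
  have fE k : (fun y => row k (Z y)) = G k.
    by apply/funext => y; rewrite rowZ /G; case: ifP.
  have rE k : row k (Z x) = G k x by rewrite rowZ /G; case: ifP.
  pose act (a : E) (f : E -> E) := a *m jac f x.
  apply: etrans (congr2 act (rE i) (fE j)) _; apply: etrans _ (esym (congr2 act (rE j) (fE i))).
  have act0 f : act 0 f = 0 by exact: mul0mx.
  have act0' a : act a (fun=> 0) = 0 by rewrite /act jac0 mulmx0.
  rewrite /G; case: (ltnP i M) => iM; case: (ltnP j M) => jM; last first.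
  - exact: etrans (act0 _) (esym (act0 _)).
  - exact: etrans (act0 _) (esym (act0' _)).
  - exact: etrans (act0' _) (esym (act0 _)).
  rewrite /act.
  apply: (hamiltonian_commute oU so' wT' wd' uo' (fun m => sF m i) (fun m => sF m j) _ Ux).
  exists (poisson_mx omega F p i j)%:M => y Uy.
  apply/matrixP => a b; rewrite !ord1 [RHS]mxE mulr1n -(FQ y)//.
  by rewrite poisson_mxE hamiltonian_field_coord grad_coord trmxK.
have uA : A p \in unitmx by rewrite unitmx_mul unitmx_tr uF unitmx_inv uo'.
(* Supplies the missing rows: [W + Z p = A p] is invertible, while the rows of [W] of index below
   [M] vanish, as [commuting_flow] demands for coordinate fields. *)
pose W := A p - (pid_mx M : 'M[R]_n) *m A p.
have [e [Phi [e0 [Phi0 jPhi0] sPhi PhiU jPhi]]] := commuting_flow W oU Up sZ comm.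
have {}jPhi0 : jac Phi 0 = A p by rewrite jPhi0 /W /Z subrK.
have W0 (j : 'I_n) : (j < M)%N -> row j W = 0.
  by move=> jM; rewrite /W linearB/= row_pid_mulmx jM subrr.
have ob : open (ball (0 : E) e) by exact: ball_open.
have b0 : ball (0 : E) e 0 by exact: ballxx.
have uPhi : jac Phi 0 \in unitmx by rewrite jPhi0.
have [d [H [d0 H0 sH hH]]] := local_right_inverse ob b0 sPhi uPhi.
rewrite Phi0 in hH.
pose shift_p x : E := - p + x *m 1%:M.
have shiftE x : shift_p x = x - p by rewrite /shift_p mulmx1 addrC.
pose U' := ball p (Num.min rho d).
have U'U x : U' x -> U x.
  by apply: le_ball; rewrite ge_min lexx.
have oU' : open U' by exact: ball_open.
have rho'0 : 0 < Num.min rho d by rewrite lt_min rho0.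
have U'p : U' p by exact: ballxx.
have U'd x : U' x -> ball 0 d (shift_p x).
  rewrite /U' shiftE -!ball_normE /ball_/= sub0r normrN distrC => /lt_le_trans; apply.
  by rewrite ge_min lexx orbT.
have od : open (ball (0 : E) d) by exact: ball_open.
pose Ht := H \o shift_p.
have sHt : smooth_map U' Ht.
  by apply: (smooth_map_comp oU' od U'd _ sH); exact: smooth_affine_map.
have HtE x : U' x -> ball 0 e (Ht x) /\ Phi (Ht x) = x.
  move=> /U'd bx; have [h1 h2] := hH _ bx; split=> //.
  by rewrite /Ht /= h2 shiftE addrC subrK.
have jHt x : U' x -> jac Ht x *m jac Phi (Ht x) = 1%:M.
  move=> U'x; rewrite -(jac_comp oU' ob sHt sPhi U'x (HtE _ U'x).1) -(jac_id x).
  by apply: (eq_on_jac oU' U'x) => z; rewrite inE => /HtE[].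
have Htp : Ht p = 0 by rewrite /Ht /= shiftE subrr.
(* These coefficients give [hm] the differential of [F_M] at [p], because [jac Ht p] is the inverse
   of [A p]. Entry [B i 0] is the bracket of [F_i] and [F_M] at [p]; for i below [M] it becomes the
   value of the new bracket on the whole smaller ball. *)
pose B := A p *m col M (jac F p).
pose hm x : 'rV[R]_1 := const_mx (F p 0 M) + Ht x *m B.
pose aff (z : E) : 'rV[R]_1 := const_mx (F p 0 M) + z *m B.
have saff : smooth_map setT aff by apply: smooth_affine_map; exact: openT.
have shm : smooth_map U' hm.
  exact: (@smooth_map_comp R n n 1 U' setT Ht aff oU' openT (fun _ _ => I) sHt saff).
have jhm x : U' x -> jac hm x = jac Ht x *m B.
  move=> U'x; apply: etrans (jac_comp oU' openT sHt saff U'x I) _.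
  by rewrite jac_affine.
pose F' x : E := \row_i (if i == M then hm x 0 0 else F x 0 i).
have F'M : (fun z => F' z 0 M) = (fun z => hm z 0 0).
  by apply/funext => z; rewrite mxE eqxx.
have F'n i : i != M -> (fun z => F' z 0 i) = (fun z => F z 0 i).
  by move=> iM; apply/funext => z; rewrite mxE (negbTE iM).
have colM x : U' x -> col M (jac F' x) = jac Ht x *m B.
  move=> U'x; rewrite -jhm//; apply/colP => k; rewrite 2![LHS]mxE [RHS]mxE.
  exact: (congr1 (fun f => pderiv k f x) F'M).
have coln x i : i != M -> col i (jac F' x) = col i (jac F x).
  move=> iM; apply/colP => k; rewrite 2![LHS]mxE 2![RHS]mxE.
  exact: (congr1 (fun f => pderiv k f x) (F'n i iM)).
have jF'p : jac F' p = jac F p.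
  apply/matrixP => k i; have [->|iM] := eqVneq i M.
    have := congr1 (fun v : 'cV[R]_n => v k 0) (colM p U'p).
    rewrite mxE => ->; have := jHt p U'p; rewrite Htp jPhi0 => JA.
    by rewrite /B mulmxA JA mul1mx mxE.
  by have := congr1 (fun v : 'cV[R]_n => v k 0) (coln p i iM); rewrite !mxE.
exists F', (Num.min rho d); split.
- by rewrite ge_min lexx.
- split=> //.
  + by move=> x /U'U/bV.
  + move=> m i; have [->|iM] := eqVneq i M; first by rewrite F'M; exact: shm.
    by rewrite F'n//; exact: Ck_subset U'U (sF m i).
  + by rewrite jF'p.
  + have rowE' x (i : 'I_n) : (i < M)%N -> row i ((jac F' x)^T *m invmx (omega x)) = row i (A x).
      move=> iM; have ne : i != M by rewrite -val_eqE neq_ltn iM.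
      apply: etrans (row_mul _ _ _) _; apply: etrans _ (esym (row_mul _ _ _)).
      apply: (congr1 (fun a : E => a *m invmx (omega x))).
      apply: etrans (esym (tr_col _ _)) _; apply: etrans _ (tr_col _ _).
      by apply: (congr1 (@trmx _ _ _)); exact: coln.
    have lt_lt x (i j : 'I_n) : U' x -> (i < M)%N -> (j < M)%N ->
        poisson_mx omega F' x i j = poisson_mx omega F' p i j.
      move=> U'x iM jM; have nj : j != M by rewrite -val_eqE neq_ltn jM.
      have step y : poisson_mx omega F' y i j = poisson_mx omega F y i j.
        apply: etrans (poisson_mxE F' y i j) _; apply: etrans _ (esym (poisson_mxE F y i j)).
        exact: (congr2 (fun (a : E) (b : 'cV[R]_n) => (a *m b) 0 0) (rowE' y i iM) (coln y j nj)).
      apply: etrans (step x) _; apply: etrans _ (esym (step p)).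
      exact: FQ (U'U _ U'x) iM jM.
    (* Row i of [A] is the coordinate field d/du_i pushed forward by [Phi], so it takes an affine
       function of [u] to its i-th coefficient. *)
    have lt_eq x (i : 'I_n) : U' x -> (i < M)%N -> poisson_mx omega F' x i M = B i 0.
      move=> U'x iM; rewrite poisson_mxE rowE'// colM//.
      have [bH PhiH] := HtE x U'x.
      have -> : row i (A x) = row i (jac Phi (Ht x)).
        by rewrite (jPhi _ _ bH (W0 i iM)) PhiH /Z row_pid_mulmx iM.
      rewrite mulmxA -row_mul (mulmx1C (jHt x U'x)) row1 -rowE.
      by rewrite mxE.
    have anti x i j : U' x -> poisson_mx omega F' x j i = - poisson_mx omega F' x i j.
      by move=> /U'U/bV; exact: poisson_mx_antisym.
    move=> x i j U'x; rewrite !ltnS (leq_eqVlt i) (leq_eqVlt j).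
    have eqM (k : 'I_n) : (k == M :> nat) = (k == M) by rewrite val_eqE.
    rewrite !eqM => /orP[/eqP ->|iM] /orP[/eqP ->|jM].
    * have self y : U' y -> poisson_mx omega F' y M M = 0.
        by move=> /(anti _ M M); lra.
      by rewrite !self.
    * by rewrite !(anti _ j M)// !lt_eq.
    * by rewrite !lt_eq.
    * exact: lt_lt.
- by move=> x i iM; rewrite mxE (negbTE iM).
Qed.

(** That the first [m] functions stay untouched matters because [g] will be expressed through
    them. *)
Lemma darboux_completion m (F : E -> E) rho : (m <= n)%N -> darboux_upto m F rho ->
  exists F' : E -> E, exists rho', [/\ rho' <= rho, darboux_upto n F' rho' &
    forall x (i : 'I_n), (i < m)%N -> F' x 0 i = F x 0 i].
Proof.
move=> mn; have [k E] : exists k, n = (m + k)%N by exists (n - m)%N; rewrite subnKC.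
elim: k m F rho mn E => [|k IH] m F rho mn nE FD.
  by exists F, rho; split=> //; rewrite nE addn0.
have mn' : (m < n)%N by rewrite nE -addSnnS leq_addr.
have [F1 [r1 [r1r FD1 F1E]]] := @darboux_extension (Ordinal mn') F rho FD.
have nE' : n = (m.+1 + k)%N by rewrite addSnnS.
have [F2 [r2 [r2r FD2 F2E]]] := IH m.+1 F1 r1 mn' nE' FD1.
exists F2, r2; split=> //; first exact: le_trans r1r.
move=> x i im; rewrite F2E; last exact: ltnW.
by rewrite F1E// -val_eqE/= neq_ltn im.
Qed.

End Darboux.

(** * Charts with constant components, and the equivalence *)

Section Main.
Variables (R : realType) (n : nat).
Local Notation E := 'rV[R]_n.

Lemma smooth_poisson_mx (V : set E) (omega : E -> 'M[R]_n) (phi : E -> E) : open V ->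
  smooth_mx V omega -> (forall x, V x -> omega x \in unitmx) -> smooth_map V phi ->
  smooth_mx V (poisson_mx omega phi).
Proof.
move=> oV so uo sphi; have sB := smooth_jac oV sphi.
apply: (smooth_mulmx oV _ sB); apply: (smooth_mulmx oV (smooth_trmx oV sB)).
exact: smooth_invmx.
Qed.

Section Charts.
Variables (U : set E) (g omega : E -> 'M[R]_n).
Hypotheses (gs : symmetric_on U g) (om : symplectic_on U omega).

Let so : smooth_mx U omega. Proof. by case: om => /smooth_tensor_onP. Qed.
Let uo x : U x -> omega x \in unitmx. Proof. by case: om => _ _ _; exact. Qed.

Section OneChart.
Variables (V W : set E) (phi psi : E -> E) (C : 'M[R]_n).
Hypotheses (VU : V `<=` U) (co : local_coordinates V W phi psi).
Hypothesis fg : forall y, W y -> forall a b, components g psi y a b = C a b.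

Let oV : open V. Proof. by case: co. Qed.
Let sphi : smooth_map V phi. Proof. by case: co => _ _ _ _ [/smooth_map_onP]. Qed.
Let uphi x : V x -> jac phi x \in unitmx.
Proof. by move=> Vx; have [] := mulmx1_unit (jac_coordinates co Vx). Qed.

Lemma flat_sym p : V p -> C^T = C.
Proof.
move=> Vp; have [_ _ VW _ _] := co; have [Wp pp] := VW p Vp.
have /flat_forP/(_ _ Wp) <- := fg; rewrite !trmx_mul trmxK mulmxA pp.
congr (_ *m _ *m _); apply/matrixP => i j; rewrite mxE.
exact: gs (VU Vp) _ _.
Qed.

Lemma condition_in_chart Gamma x : compatible_connection U g Gamma -> V x ->
  compatibility_condition g omega Gamma x <->
  (forall k, C *m pderiv_mx k (poisson_mx omega phi) x *m C = 0).
Proof.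
move=> Gc Vx; rewrite compatibility_conditionE.
apply: (flat_condition oV VU sphi uphi gs (flat_sym Vx) _ Gc _ _ Vx).
- by move=> y Vy; exact: flat_tensor co fg Vy.
- by move=> m i j; exact: Ck_subset VU (so m i j).
- by move=> y /VU/uo.
Qed.

Lemma flat_poisson_mx (D : 'M[R]_n) x : (forall y, W y -> forall a b, components omega psi y a b = D a b) ->
  V x -> poisson_mx omega phi x = invmx D.
Proof.
move=> /flat_forP fo Vx; have [_ _ VW _ _] := co; have [Wx pp] := VW x Vx.
have BA := jac_coordinates co Vx; have AB := mulmx1C BA.
have QD : poisson_mx omega phi x *m D = 1%:M.
  rewrite -(fo _ Wx) pp /poisson_mx -!mulmxA (mulmxA (jac phi x)) BA mul1mx.
  by rewrite (mulmxA (invmx _)) (mulVmx (uo (VU Vx))) mul1mx -trmx_mul AB trmx1.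
have [_ uD] := mulmx1_unit QD.
by rewrite -[LHS](mulmxK uD) QD mul1mx.
Qed.

End OneChart.

(** The inverse function theorem makes the functions [F] themselves a chart. In it the brackets form
    the inverse of the matrix of [omega], whose components are therefore [invmx K]. *)
Lemma chart_of_constant_tensors (p : E) rho (F : E -> E) (S K : 'M[R]_n) :
  0 < rho -> ball p rho `<=` U -> smooth_map (ball p rho) F -> jac F p \in unitmx ->
  (forall x, ball p rho x -> g x = jac F x *m S *m (jac F x)^T) ->
  (forall x, ball p rho x -> poisson_mx omega F x = K) ->
  exists V W phi psi, [/\ V p, V `<=` U, local_coordinates V W phi psi,
    flat_for g W psi & flat_for omega W psi].
Proof.
move=> rho0 bU sF uF gE QE.
have ob : open (ball p rho) by exact: ball_open.
have bp : ball p rho p by exact: ballxx.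
have [d [e [G [[d0 e0 db] sG FG GF]]]] := local_inverse ob bp sF uF.
pose shift y : E := - F p + y *m 1%:M.
have shiftE y : shift y = y - F p by rewrite /shift mulmx1 addrC.
pose O := ball (F p) e.
have oO : open O by exact: ball_open.
have oe : open (ball (0 : E) e) by exact: ball_open.
have Oe y : O y -> ball 0 e (shift y).
  by rewrite /O shiftE -!ball_normE /ball_/= sub0r normrN distrC.
pose psi := G \o shift.
have spsi : smooth_map O psi.
  exact: (smooth_map_comp oO oe Oe (smooth_affine_map _ _ oO) sG).
have Fpsi y : O y -> F (psi y) = y.
  by move=> /Oe; rewrite shiftE /psi /= shiftE => /FG ->; rewrite addrC subrK.
(* The image of the ball under [F], described through [psi] so that its openness is continuity of
   [psi]. *)
pose W := [set y | O y /\ ball p d (psi y)].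
have od : open (ball p d) by exact: ball_open.
have oW : open W.
  rewrite openE => y [Oy by_].
  have cpsi : {for y, continuous psi}.
    by apply: continuous_row => i; exact: Ck_continuous (spsi 0%N i) Oy.
  apply: filterI; first exact: open_nbhs_nbhs.
  by apply: cpsi; exact: open_nbhs_nbhs.
have psiF x : ball p d x -> W (F x) /\ psi (F x) = x.
  move=> bx; have [bFx GFx] := GF x bx.
  have E1 : psi (F x) = x by rewrite /psi /= shiftE.
  split=> //; split; last by rewrite E1.
  by move: bFx; rewrite /O -!ball_normE /ball_/= sub0r normrN distrC.
have WO : W `<=` O by move=> y [].
have sF' : smooth_map (ball p d) F by move=> m i; exact: Ck_subset db (sF m i).
have spsi' : smooth_map W psi by move=> m i; exact: Ck_subset WO (spsi m i).
have co : local_coordinates (ball p d) W F psi.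
  split=> //; last by split; apply/smooth_map_onP.
  by move=> y [Oy by_]; split=> //; exact: Fpsi.
have AB y : W y -> jac psi y *m jac F (psi y) = 1%:M.
  move=> Wy; rewrite -(jac_comp oW od spsi' sF' Wy Wy.2) -(jac_id y).
  by apply: (eq_on_jac oW Wy) => z; rewrite inE => /WO/Fpsi.
exists (ball p d), W, F, psi; split=> //.
- exact: ballxx.
- by move=> x /db/bU.
- exists S; apply/flat_forP => y Wy; have bx := db _ Wy.2.
  rewrite gE// !mulmxA AB// mul1mx -mulmxA -trmx_mul AB// trmx1 mulmx1.
  by [].
- exists (invmx K); apply/flat_forP => y Wy; have bx := db _ Wy.2.
  have uw := uo (bU _ bx).
  have H : jac psi y *m omega (psi y) *m (jac psi y)^T *m K = 1%:M.
    rewrite -(QE _ bx) /poisson_mx -!mulmxA (mulmxA (jac psi y)^T) -trmx_mul.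
    rewrite (mulmx1C (AB y Wy)) trmx1 mul1mx (mulmxA (omega _)) mulmxV// mul1mx.
    exact: AB.
  have [_ uK] := mulmx1_unit H.
  by rewrite -[LHS](mulmxK uK) H mul1mx.
Qed.

(** The linear change [M] makes the first r coordinates carry all of [g] and have constant brackets.
    Completing them alters only later functions, so [g] keeps the matrix [S] while all brackets
    become constant. *)
Lemma simultaneous_chart Gamma p : locally_flat U g -> compatible_connection U g Gamma ->
  (forall x, U x -> compatibility_condition g omega Gamma x) -> U p ->
  exists V W phi psi, [/\ V p, V `<=` U, local_coordinates V W phi psi,
    flat_for g W psi & flat_for omega W psi].
Proof.
move=> gf Gc cond Up; have [V [W [phi [psi [Vp VU co [C fg]]]]]] := gf p Up.
have oV : open V by case: co.
have sphi : smooth_map V phi by case: co => _ _ _ _ [/smooth_map_onP].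
have soV : smooth_mx V omega by move=> m i j; exact: Ck_subset VU (so m i j).
have uoV x : V x -> omega x \in unitmx by move=> /VU/uo.
have sQ := smooth_poisson_mx oV soV uoV sphi.
have [_ wA wd _] := om.
have wT x : V x -> (omega x)^T = - omega x.
  by move=> Vx; apply/matrixP => i j; rewrite !mxE; exact: wA (VU _ Vx) _ _.
have wdV x i j k : V x -> pderiv i (fun z => omega z j k) x
    + pderiv j (fun z => omega z k i) x + pderiv k (fun z => omega z i j) x = 0.
  by move=> /VU Ux; exact: wd.
have [rho rho0 bV] := open_box_nbhs oV Vp.
(* The condition makes the partial derivatives of [C Q C] vanish on [V], and the segment from [p] to
   [x] stays in a box inside [V]. *)
have CQC x : ball p rho x -> C *m poisson_mx omega phi x *m C = C *m poisson_mx omega phi p *m C.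
  move=> bx; apply/matrixP => i j.
  have sC : smooth_mx V (fun _ : E => C) by exact: smooth_cst_mx.
  have sCQ := smooth_mulmx oV sC sQ.
  apply: (@eq_of_pderiv0 R n V (fun x => (C *m poisson_mx omega phi x *m C) i j) p rho) => //.
  - exact: (smooth_mulmx oV sCQ sC).
  - exact: ltW.
  - move=> y k Vy.
    have := pderiv_mulmx_rule k sCQ sC Vy; rewrite (pderiv_mulmx_rule k sC sQ Vy).
    rewrite !pderiv_mx_cst mul0mx add0r mulmx0 addr0.
    rewrite ((condition_in_chart VU co fg Gc Vy).1 (cond y (VU _ Vy)) k).
    by move=> /matrixP/(_ i j); rewrite mxE => ->; rewrite mxE.
  - exact: ball_sub_box.
have [r [M [S [rn uM CE SE QQ]]]] := symmetric_factor (flat_sym VU co fg Vp).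
(* The summand 0 puts this linear map into the affine form of [smooth_affine_map] and
   [jac_affine]. *)
pose F0 x : E := 0 + phi x *m M.
have saff : smooth_map setT (fun z : E => 0 + z *m M) by apply: smooth_affine_map; exact: openT.
have sF0 : smooth_map V F0.
  exact: (@smooth_map_comp R n n n V setT phi _ oV openT (fun _ _ => I) sphi saff).
have jF0 x : V x -> jac F0 x = jac phi x *m M.
  move=> Vx; apply: etrans (jac_comp oV openT sphi saff Vx I) _.
  by rewrite jac_affine.
have bV' : ball p rho `<=` V by move=> x /(ball_sub_box rho0)/bV.
have bp : ball p rho p by exact: ballxx.
have uphi x : V x -> jac phi x \in unitmx.
  by move=> Vx; have [] := mulmx1_unit (jac_coordinates co Vx).
have QF0 x : V x -> poisson_mx omega F0 x = M^T *m poisson_mx omega phi x *m M.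
  by move=> Vx; rewrite /poisson_mx jF0// trmx_mul !mulmxA.
have D0 : darboux_upto V p omega r F0 rho.
  split; [exact: rho0|exact: bV'| | |].
  - by move=> m i; exact: Ck_subset bV' (sF0 m i).
  - by rewrite jF0// unitmx_mul uphi.
  - move=> x i j bx ir jr; have /matrixP/(_ i j) := QQ _ _ (CQC x bx).
    rewrite !pid_mulmx_pidE ir jr /= => H.
    apply: etrans (congr1 (fun A : 'M[R]_n => A i j) (QF0 x (bV' _ bx))) _.
    exact: etrans H (congr1 (fun A : 'M[R]_n => A i j) (esym (QF0 p Vp))).
have [F [rho1 [rho1r [rho10 b1V sF uF FQ] FE]]] := darboux_completion soV wT wdV uoV rn D0.
apply: (@chart_of_constant_tensors p rho1 F S (poisson_mx omega F p)) => //.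
- by move=> x /b1V/VU.
- move=> x bx; have Vx := b1V x bx.
  (* [F] and [F0] share their first r components, hence the first r columns of their Jacobians; [S]
     is supported there and cannot tell them apart. *)
  have jE : jac F x *m pid_mx r = jac F0 x *m (pid_mx r : 'M[R]_n).
    apply: trmx_inj; rewrite !trmx_mul tr_pid_mx; apply/row_matrixP => i.
    rewrite !row_pid_mulmx; case: ifP => // ir.
    rewrite -!tr_col; congr (_^T); apply/colP => k; rewrite 2![LHS]mxE 2![RHS]mxE.
    apply: eq_pderiv => z; exact: FE.
  have E1 : jac F x *m S *m (jac F x)^T = jac F0 x *m S *m (jac F0 x)^T.
    have half (A : 'M[R]_n) :
        A *m S *m A^T = (A *m (pid_mx r : 'M[R]_n)) *m S *m (A *m (pid_mx r : 'M[R]_n))^T.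
      by rewrite {1}SE trmx_mul tr_pid_mx !mulmxA.
    apply: etrans (half _) _; apply: etrans _ (esym (half _)).
    exact: (congr1 (fun A : 'M[R]_n => A *m S *m A^T) jE).
  rewrite E1 jF0// (flat_tensor co fg Vx) CE trmx_mul !mulmxA.
  by [].
- by move=> x bx; apply/matrixP => i j; exact: FQ.
Qed.

End Charts.
End Main.

Theorem theorem3p1 (R : realType) (n : nat) (U : set 'rV[R]_n)
  (g omega : 'rV[R]_n -> 'M[R]_n)
  (U_domain : domain U)
  (g_smooth : smooth_tensor_on U g)
  (g_sym : symmetric_on U g)
  (g_flat : locally_flat U g)
  (omega_symplectic : symplectic_on U omega)
  (Gamma : 'rV[R]_n -> 'I_n -> 'I_n -> 'I_n -> R)
  (Gamma_compat : compatible_connection U g Gamma) :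
  (locally_simultaneously_flat U g omega <->
     forall x, U x -> compatibility_condition g omega Gamma x) /\
  (forall Gamma' : 'rV[R]_n -> 'I_n -> 'I_n -> 'I_n -> R,
     compatible_connection U g Gamma' ->
     forall x, U x ->
       (compatibility_condition g omega Gamma x <->
        compatibility_condition g omega Gamma' x)).
Proof.
split; [split=> [sim x Ux|cond p Up]|move=> Gamma' Gamma'_compat x Ux].
- have [V [W [phi [psi [Vx VU co [C fg] [D fo]]]]]] := sim x Ux.
  apply/(condition_in_chart g_sym omega_symplectic VU co fg Gamma_compat Vx) => k.
  have oV : open V by case: co.
  rewrite (eq_on_pderiv_mx k oV Vx (B := fun=> invmx D)); last first.
    by move=> y; rewrite inE; exact: (flat_poisson_mx omega_symplectic VU co fo).
  by rewrite pderiv_mx_cst mulmx0 mul0mx.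
- exact: (simultaneous_chart g_sym omega_symplectic g_flat Gamma_compat cond Up).
- have [V [W [phi [psi [Vx VU co [C fg]]]]]] := g_flat x Ux.
  apply: iff_trans (condition_in_chart g_sym omega_symplectic VU co fg Gamma_compat Vx) _.
  exact: iff_sym (condition_in_chart g_sym omega_symplectic VU co fg Gamma'_compat Vx).
Qed.
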